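(* Let $\tau\in L^1_{loc}(\mathbb{R})$ with $\operatorname{supp}\tau\subseteq[0,\infty)$ be slowly decreasing and have (improper) Laplace transform $\mathcal{L}\{\tau;s\}=\int_0^\infty\tau(x)e^{-sx}\,\mathrm{d}x$ convergent for $\Re e\, s>0$. Let $g\in L^\infty(\mathbb{R})$, $G(s)=\int_0^\infty g(x)e^{-sx}\,\mathrm{d}x$ for $\Re e\, s>0$, and $b$ a constant. Suppose that $$F(s)=\mathcal{L}\{\tau;s\}-\frac{b}{s}-\frac{G(s)}{s}$$ has local pseudofunction boundary behavior on $i(\mathbb{R}\setminus E)$, where $E\subset\mathbb{R}$ is a closed null set, and that for each $t\in E$ the function $F(s)/(s-it)$ has pseudomeasure boundary behavior at $it$. Then $\tau(x)=b+\int_0^xg(y)\,\mathrm{d}y+o(1)$ as $x\to\infty$. Conversely, if $\tau$ satisfies $\tau(x)=b+\int_0^xg(y)\,\mathrm{d}y+o(1)$, then $F$ has local pseudofunction boundary behavior on the whole line $\Re e\, s=0$.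
   Context: A real-valued $\tau$ is slowly decreasing if for each $\varepsilon>0$ there is $\delta>0$ with $\liminf_{x\to\infty}\inf_{h\in[0,\delta]}(\tau(x+h)-\tau(x))>-\varepsilon$; complex-valued: real and imaginary parts are. Fourier transform $\hat\varphi(t)=\int e^{-itx}\varphi(x)\,\mathrm{d}x$. A tempered distribution $f$ is a pseudomeasure if $\hat f\in L^\infty$, a pseudofunction if moreover $\hat f(x)\to0$ as $|x|\to\infty$; a distribution on an open $U$ is a local pseudofunction (pseudomeasure) on $U$ if near each point of $U$ it coincides with a pseudofunction (pseudomeasure). An analytic $F$ on $\Re e\, s>0$ has local pseudofunction boundary behavior on $iU$ ($U$ open) if $F(\sigma+it)$ converges in $\mathcal{D}'(U)$ as $\sigma\to0^+$ to a local pseudofunction on $U$; it has pseudomeasure boundary behavior at $it_0$ if this holds with ''local pseudomeasure'' for some open interval $U\ni t_0$. *)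

(* Defs.v *)
From HB Require Import structures.
From mathcomp Require Import all_boot all_order all_algebra.
From mathcomp Require Import all_classical all_reals all_analysis.
From mathcomp Require Import complex.
Set Implicit Arguments. Unset Strict Implicit. Unset Printing Implicit Defensive.
Import Order.TTheory GRing.Theory Num.Theory.
Import numFieldNormedType.Exports.
Local Open Scope classical_set_scope.
Local Open Scope ring_scope.
Local Open Scope complex_scope.

Section Defs.
Variable R : realType.
Local Notation mu := (@lebesgue_measure R).

Definition cexp (z : R[i]) : R[i] :=
  ((expR (complex.Re z) * cos (complex.Im z)) +i* (expR (complex.Re z) * sin (complex.Im z)))%C.

Definition cint (D : set R) (f : R -> R[i]) : R[i] :=
  (Rintegral mu D (fun x => complex.Re (f x)) +i* Rintegral mu D (fun x => complex.Im (f x)))%C.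

Definition cintegrable (D : set R) (f : R -> R[i]) : Prop :=
  mu.-integrable D (fun x => (complex.Re (f x))%:E) /\
  mu.-integrable D (fun x => (complex.Im (f x))%:E).

Definition cmeasurable (f : R -> R[i]) : Prop :=
  measurable_fun setT (fun x => complex.Re (f x)) /\
  measurable_fun setT (fun x => complex.Im (f x)).

Definition ccvg (F : set_system R) (f : R -> R[i]) (l : R[i]) : Prop :=
  ((fun x => complex.Re (f x)) @ F --> complex.Re l) /\ ((fun x => complex.Im (f x)) @ F --> complex.Im l).

Definition L1loc (f : R -> R[i]) : Prop :=
  forall a b : R, cintegrable `[a, b] f.

Definition Linfty (g : R -> R[i]) : Prop :=
  cmeasurable g /\ exists M : R, {ae mu, forall x, `|g x| <= M%:C}.

(* slow decrease, real-valued: for each eps > 0 there is delta > 0 with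
   liminf_{x -> oo} inf_{h in [0,delta]} (f (x+h) - f x) > -eps,
   the liminf being written out as sup_{x0} inf_{x >= x0} *)
Definition slowly_decreasing_real (f : R -> R) : Prop :=
  forall eps : R, 0 < eps -> exists2 delta : R, 0 < delta &
    (- eps%:E < ereal_sup [set ereal_inf [set ereal_inf
         [set ((f (x + h) - f x)%R)%:E | h in `[0%R, delta]] | x in [set x | (x0 <= x)%R]]
       | x0 in [set: R]])%E.

Definition slowly_decreasing (f : R -> R[i]) : Prop :=
  slowly_decreasing_real (fun x => complex.Re (f x)) /\
  slowly_decreasing_real (fun x => complex.Im (f x)).

Definition laplace_trunc (tau : R -> R[i]) (s : R[i]) (T : R) : R[i] :=
  cint `[0, T] (fun x => tau x * cexp (- (s * x%:C)))%C.

Definition laplace_converges (tau : R -> R[i]) (s : R[i]) : Prop :=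
  exists l : R[i], ccvg +oo (laplace_trunc tau s) l.

Definition laplace (tau : R -> R[i]) (s : R[i]) : R[i] :=
  (lim ((fun T => complex.Re (laplace_trunc tau s T)) @ +oo)
   +i* lim ((fun T => complex.Im (laplace_trunc tau s T)) @ +oo))%C.

Definition laplace_abs (g : R -> R[i]) (s : R[i]) : R[i] :=
  cint [set x | 0 <= x] (fun x => g x * cexp (- (s * x%:C)))%C.

Definition smooth (phi : R -> R) : Prop :=
  forall (n : nat) (x : R), derivable (derive1n n phi) x 1.

Definition supp (phi : R -> R) : set R := closure [set x | phi x != 0].

Definition test_fun (U : set R) (phi : R -> R) : Prop :=
  smooth phi /\ compact (supp phi) /\ supp phi `<=` U.

Definition fourier (phi : R -> R) (t : R) : R[i] :=
  cint [set: R] (fun x => cexp (- ('i * (t * x)%:C)) * (phi x)%:C)%C.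

(* action on a test function phi of the tempered distribution h whose
   Fourier transform is the bounded function psi:
   <h, phi> = <hat h, check phi> with hat(check phi) = phi, i.e.
   <h, phi> = (2 pi)^-1 int psi(x) hat(phi)(-x) dx *)
Definition inv_fourier_pairing (psi : R -> R[i]) (phi : R -> R) : R[i] :=
  ((2 * pi)^-1)%:C * cint [set: R] (fun x => psi x * fourier phi (- x))%C.

Definition bounded_cfun (psi : R -> R[i]) : Prop :=
  cmeasurable psi /\ exists M : R, forall x, `|psi x| <= M%:C.

(* f (a distribution on U, given by its action on real test functions) is a
   local pseudomeasure on U *)
Definition local_pseudomeasure (U : set R) (f : (R -> R) -> R[i]) : Prop :=
  forall t0, U t0 -> exists V : set R, [/\ open V, V t0 & V `<=` U] /\
    exists psi : R -> R[i], bounded_cfun psi /\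
      forall phi, test_fun V phi -> f phi = inv_fourier_pairing psi phi.

Definition local_pseudofunction (U : set R) (f : (R -> R) -> R[i]) : Prop :=
  forall t0, U t0 -> exists V : set R, [/\ open V, V t0 & V `<=` U] /\
    exists psi : R -> R[i], bounded_cfun psi /\
      ccvg +oo psi 0 /\ ccvg -oo psi 0 /\
      forall phi, test_fun V phi -> f phi = inv_fourier_pairing psi phi.

(* F(sigma + i t) converges in D'(U) as sigma -> 0+ to some f with
   property P (the pointwise limit of distributions is a distribution) *)
Definition boundary_behavior (P : set R -> ((R -> R) -> R[i]) -> Prop)
    (F : R[i] -> R[i]) (U : set R) : Prop :=
  exists f : (R -> R) -> R[i],
    (forall phi, test_fun U phi ->
       ccvg 0^'+ (fun sigma => cint [set: R]
               (fun t => F (sigma +i* t)%C * (phi t)%:C)%C) (f phi))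
    /\ P U f.

Definition local_pseudofunction_bb (F : R[i] -> R[i]) (U : set R) : Prop :=
  boundary_behavior local_pseudofunction F U.

Definition pseudomeasure_bb_at (F : R[i] -> R[i]) (t0 : R) : Prop :=
  exists a b : R, a < t0 < b /\
    boundary_behavior local_pseudomeasure F `]a, b[.

End Defs.

(* Main.v *)
Require Import Defs.
From HB Require Import structures.
From mathcomp Require Import all_boot all_order all_algebra.
From mathcomp Require Import all_classical all_reals all_analysis.
From mathcomp Require Import measurable_realfun complex.
From mathcomp Require Import ring lra.
Set Implicit Arguments. Unset Strict Implicit. Unset Printing Implicit Defensive.
Import Order.TTheory GRing.Theory Num.Theory.
Import numFieldNormedType.Exports.
Local Open Scope classical_set_scope.
Local Open Scope ring_scope.
Local Open Scope complex_scope.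

(** Put rho(x) = tau(x) - b - int_0^x g for x >= 0 and rho(x) = 0 for x < 0; then F is the Laplace
    transform of rho, and rho is slowly decreasing.  For a test function phi, Fubini turns the boundary
    values of F into convolutions of rho with the Fourier transform phi^.

    Boundedness: near 0, F (or F(s)/s, if 0 belongs to E) has pseudomeasure boundary values; choosing
    phi with phi^ >= 0 bounds the averages of rho against phi^, and slow decrease upgrades this to
    boundedness of rho up to an integrable part.  The same argument applied to the primitive
    J_t(x) = int_0^x rho(v) exp(-itv) dv, whose Laplace transform is F(s)/(s - it) up to a shift,
    shows that J_t is bounded for every t in E.

    Call t regular if int rho(x) phi^(x - h) dx tends to 0 as h -> oo for all test functions phi
    supported near t.  Points outside E are regular.  If the closed set S of non-regular points were
    nonempty, Baire's theorem on S would give an interval on which the bound of J_t is uniform for t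
    in S.  Cut phi, supported there, into pieces of size e: a piece near t in S costs O(e), by
    integrating by parts against J_t, and since S is null the pieces near S have total length as small
    as we please; the other pieces are regular.  So the whole interval is regular, a contradiction.
    Hence all convolutions of rho tend to 0, and slow decrease yields rho -> 0.

    Conversely, if rho -> 0, then rho is an integrable function plus a bounded one tending to 0; the
    second is the inverse transform of a pseudofunction, and the first becomes one after localization
    by a test function equal to 1 near the given point. *)

(** * Integrals on the real line *)

Section RealIntegrals.
Variable R : realType.
Local Notation mu := (@lebesgue_measure R).
Implicit Types f g h : R -> R.

(** The boundary values only control pairings that still carry the damping factor
    [expR (- (s * x))]. Removing it is the first obstacle, since rho is not yet known to be bounded
    and nothing dominates the integrands. Slow decrease lets rho fall at most linearly, so adding an
    explicit integrable function makes the integrands nonnegative, and Fatou's lemma replaces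
    dominated convergence. Test functions with nonnegative transform are autocorrelations, whose
    transform is |chi^|^2; their first moment must be finite, because it is integrated against a
    linear bound. Test functions are real, so a modulation by [cis (h * t)] is handled as a cosine
    and a sine part. The primitive J_t needs no slow decrease of its own: once rho is bounded, J_t
    is Lipschitz. Baire's theorem applies because J_t(x) is continuous in t for each fixed x, which
    makes the sets of t with |J_t| <= n closed. *)

Definition RL1 f : Prop := mu.-integrable setT (EFin \o f).
Definition RInt f : R := Rintegral mu setT f.

Lemma RL1_meas f : RL1 f -> measurable_fun setT f.
Proof. by move=> /measurable_int/measurable_EFinP. Qed.

Lemma RL1_dom f g : measurable_fun setT f -> (forall x, `|f x| <= g x) ->
  RL1 g -> RL1 f.
Proof.
move=> mf fg; apply: le_integrable => //; first exact/measurable_EFinP.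
by move=> x _ /=; rewrite lee_fin (le_trans (fg x))// ler_norm.
Qed.

Lemma RL1D f g : RL1 f -> RL1 g -> RL1 (fun x => f x + g x).
Proof. by move=> f1 g1; apply: (integrableD measurableT f1 g1). Qed.

Lemma RL1B f g : RL1 f -> RL1 g -> RL1 (fun x => f x - g x).
Proof. by move=> f1 g1; apply: (integrableB measurableT f1 g1). Qed.

Lemma RL1Zl c f : RL1 f -> RL1 (fun x => c * f x).
Proof. by move=> f1; apply: (integrableZl measurableT c f1). Qed.

Lemma RL1_norm f : RL1 f -> RL1 (fun x => `|f x|).
Proof. by move=> f1; apply: (integrable_norm f1). Qed.

Lemma RL1M f h M : RL1 f -> measurable_fun setT h ->
  (forall x, `|h x| <= M) -> RL1 (fun x => h x * f x).
Proof.
move=> f1 mh hM; apply: (@RL1_dom _ (fun x => M * `|f x|)).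
- by apply: measurable_funM => //; exact: RL1_meas.
- by move=> x; rewrite normrM ler_wpM2r.
- exact/RL1Zl/RL1_norm.
Qed.

Lemma RL10 : RL1 (fun=> 0).
Proof. exact: integrable0. Qed.

Lemma RIntD f g : RL1 f -> RL1 g ->
  RInt (fun x => f x + g x) = RInt f + RInt g.
Proof. by move=> f1 g1; rewrite /RInt RintegralD. Qed.

Lemma RIntB f g : RL1 f -> RL1 g ->
  RInt (fun x => f x - g x) = RInt f - RInt g.
Proof. by move=> f1 g1; rewrite /RInt RintegralB. Qed.

Lemma RIntZl c f : RL1 f -> RInt (fun x => c * f x) = c * RInt f.
Proof. by move=> f1; rewrite /RInt RintegralZl. Qed.

Lemma RInt0 : RInt (fun=> 0) = 0.
Proof. by rewrite /RInt /Rintegral integral0. Qed.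

Lemma RInt_le f g : RL1 f -> RL1 g -> (forall x, f x <= g x) ->
  RInt f <= RInt g.
Proof. by move=> f1 g1 fg; apply: le_Rintegral. Qed.

Lemma RInt_ge0 f : (forall x, 0 <= f x) -> 0 <= RInt f.
Proof. by move=> f0; apply: Rintegral_ge0. Qed.

Lemma RInt_norm f : RL1 f -> `|RInt f| <= RInt (fun x => `|f x|).
Proof. by move=> f1; apply: le_normr_Rintegral. Qed.

Lemma RInt_dom f g : measurable_fun setT f -> (forall x, `|f x| <= g x) ->
  RL1 g -> `|RInt f| <= RInt g.
Proof.
move=> mf fg g1; have f1 := RL1_dom mf fg g1.
apply: (le_trans (RInt_norm f1)); apply: RInt_le => //; exact: RL1_norm.
Qed.

Lemma RL1_indic (a b : R) : RL1 (\1_`[a, b]).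
Proof. exact: integrable_indic_itv. Qed.

Lemma RInt_indic (a b : R) : a <= b -> RInt (\1_`[a, b]) = b - a.
Proof.
move=> ab; rewrite /RInt /Rintegral integral_indic// setIT.
suff h : mu `[a, b]%classic = (b - a)%:E by exact: (congr1 fine h).
rewrite lebesgue_measure_itv/= lte_fin.
by move: ab; rewrite le_eqVlt => /predU1P[->|->]//; rewrite ltxx subrr.
Qed.

Lemma RL1_restrict (D : set R) f : measurable D ->
  mu.-integrable D (EFin \o f) <-> RL1 (f \_ D).
Proof.
move=> mD; rewrite /RL1 -restrict_EFin; exact: integrable_mkcond.
Qed.

Lemma RInt_restrict (D : set R) f : Rintegral mu D f = RInt (f \_ D).
Proof. exact: Rintegral_mkcond. Qed.

(** * Affine changes of variables *)

(** Both sides are measures that agree on the intervals []c, d]], so uniqueness of Lebesgue measure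
    applies. For [a < 0] the preimage is closed on the left instead, with the same length. *)
Lemma pushforward_affine (a b : R) : a != 0 -> forall A : set R, measurable A ->
  (`|a|%:E * mu ((fun x : R => (a * x + b)%R) @^-1` A) = mu A)%E.
Proof.
move=> a0.
have ma : measurable_fun setT ((fun x : R => a * x + b) : _ -> measurableTypeR R).
  by apply: measurable_funD => //; exact: measurable_funM.
have [m0 m0E] : exists m0 : {measure set (measurableTypeR R) -> \bar R},
    forall A, m0 A = mu ((fun x : R => a * x + b) @^-1` A).
  by exists (measure_function_pushforward__canonical__measure_function_Measure
    mu (f := (fun x : R => a * x + b) : _ -> measurableTypeR R) ma).
move=> A mA; rewrite -m0E.
transitivity (mscale (NngNum (normr_ge0 a)) m0 A) => //.
apply/esym/lebesgue_measure_unique => //= _ [[c d]] _ <-.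
  rewrite /mscale/= m0E.
  have [a1|a1] := ltP 0 a.
  - have -> : (fun x : R => a * x + b) @^-1` `]c, d] = `](c - b) / a, (d - b) / a]%classic.
      apply/seteqP; split => x /=; rewrite !in_itv/= ltr_pdivrMr// ler_pdivlMr//; lra.
    rewrite !lebesgue_measure_itv/= !lte_fin ltr_pM2r ?invr_gt0// ltrD2r.
    case: ifP => _; last by rewrite mule0.
    rewrite -!EFinB -EFinM gtr0_norm//; congr EFin; field.
    by rewrite gt_eqF.
  - have {}a1 : a < 0 by rewrite lt_neqAle a0.
    have -> : (fun x : R => a * x + b) @^-1` `]c, d] = `[(d - b) / a, (c - b) / a[%classic.
      apply/seteqP; split => x /=; rewrite !in_itv/= ltr_ndivlMr// ler_ndivrMr//; lra.
    rewrite !lebesgue_measure_itv/= !lte_fin ltr_nM2r ?invr_lt0// ltrD2r.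
    case: ifP => _; last by rewrite mule0.
    rewrite -!EFinB -EFinM ltr0_norm//; congr EFin; field.
    by rewrite lt_eqF.
Qed.

Lemma measurable_affine (a b : R) :
  measurable_fun setT (fun x : R => a * x + b).
Proof. by apply: measurable_funD => //; exact: measurable_funM. Qed.

Lemma ge0_integral_affine (f : R -> \bar R) a b : a != 0 ->
  measurable_fun setT f -> (forall x, 0 <= f x)%E ->
  (`|a|%:E * \int[mu]_x f (a * x + b)%R = \int[mu]_x f x)%E.
Proof.
move=> a0 mf f0.
have ma := measurable_affine a b.
have := @ge0_integral_pushforward _ _ (measurableTypeR R) (measurableTypeR R) R
  (fun x : R => a * x + b) ma mu setT f measurableT mf (fun x _ => f0 x).
rewrite preimage_setT => <-.
have := @ge0_integral_mscale _ _ R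
  (@measure_function_pushforward__canonical__measure_function_Measure _ _
    (measurableTypeR R) (measurableTypeR R) R mu (fun x : R => a * x + b) ma)
  setT measurableT (NngNum (normr_ge0 a)) f mf (fun x _ => f0 x).
move=> /= <-.
apply: eq_measure_integral => A mA _.
exact: pushforward_affine.
Qed.

Lemma RL1_affine f a b : a != 0 -> RL1 f -> RL1 (fun x => f (a * x + b)).
Proof.
move=> a0 f1; have mf := RL1_meas f1.
apply/integrableP; split.
  by apply/measurable_EFinP; apply: measurableT_comp => //; exact: measurable_affine.
have /integrableP[_ ifoo] := f1.
have := @ge0_integral_affine (fun x => `|(f x)%:E|%E) a b a0.
move=> /(_ _ (fun=> abse_ge0 _)) h.
have {}h : (`|a|%:E * \int[mu]_x `|(f (a * x + b)%R)%:E| = \int[mu]_x `|(f x)%:E|)%E.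
  by apply: h; do 2 apply: measurableT_comp => //.
rewrite ltey; apply/eqP => hoo.
by move: h ifoo; rewrite /= hoo mulry gtr0_sg ?normr_gt0// mul1e => <-; rewrite ltxx.
Qed.

Lemma RIntE f : RL1 f -> (RInt f)%:E = (\int[mu]_x (f x)%:E)%E.
Proof. by move=> f1; rewrite /RInt /Rintegral fineK//; exact: integrable_fin_num. Qed.

Let RInt_affine_ge0 f a b : a != 0 -> RL1 f -> (forall x, 0 <= f x) ->
  RInt (fun x => f (a * x + b)) = `|a|^-1 * RInt f.
Proof.
move=> a0 f1 f0; have mf := RL1_meas f1.
have na0 : `|a| != 0 by rewrite normr_eq0.
apply: (mulfI na0); rewrite mulrA divff// mul1r; apply: EFin_inj.
rewrite EFinM !RIntE//; last exact: RL1_affine.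
by apply: (@ge0_integral_affine (EFin \o f)) => //; exact/measurable_EFinP.
Qed.

Lemma RInt_affine f a b : a != 0 -> RL1 f ->
  RInt (fun x => f (a * x + b)) = `|a|^-1 * RInt f.
Proof.
move=> a0 f1; have nf := RL1_norm f1.
have pf : RL1 (fun x => `|f x| + f x) by exact: RL1D.
have -> : f = (fun x => (`|f x| + f x) - `|f x|) by apply/funext => x; rewrite addrC addKr.
have := @RInt_affine_ge0 (fun x => `|f x| + f x) a b a0 pf.
have := @RInt_affine_ge0 (fun x => `|f x|) a b a0 nf.
rewrite (RIntB pf nf) (RIntB (RL1_affine b a0 pf) (RL1_affine b a0 nf)).
move=> -> // -> //; first by rewrite mulrBr.
by move=> x; rewrite -lerBlDr sub0r -normrN ler_norm.
Qed.

Lemma RInt_cvg_seq (f_ : nat -> R -> R) f g :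
  (forall n, measurable_fun setT (f_ n)) -> RL1 g ->
  (forall n x, `|f_ n x| <= g x) -> (forall x, f_ ^~ x @ \oo --> f x) ->
  (fun n => RInt (f_ n)) @ \oo --> RInt f.
Proof.
move=> mf g1 fg ff.
have mf' : measurable_fun setT f.
  by apply: (measurable_fun_cvg (h := f_)) => // x _; exact: ff.
have fg' x : `|f x| <= g x.
  have /cvg_norm h := ff x.
  rewrite -(cvg_lim _ h)//; apply: limr_le; first by apply/cvg_ex; eexists; exact: h.
  exact: nearW.
have f1 : RL1 f by exact: RL1_dom fg' g1.
have h : ((\int[mu]_x (f_ n x)%:E) @[n --> \oo] --> \int[mu]_x (f x)%:E)%E.
  apply: (@dominated_cvg _ _ R mu setT measurableT (fun n => EFin \o f_ n)
    (EFin \o f) (EFin \o g)) => //=.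
  - by move=> n; apply: (measurable_EFinP _ _).2; exact: mf.
  - move=> x _; apply: cvg_EFin; last exact: ff. apply: nearW => n. by [].
  - by move=> n x _; rewrite lee_fin.
move: h; rewrite -(RIntE f1) => h.
exact: (fine_cvg h).
Qed.

(** * Iterated integrals with bounded kernels *)

(** Tonelli gives measurability for nonnegative integrands, so [M * |b y|] is added to the
    integrand, and its integral, independent of [x], is subtracted afterwards. *)
Lemma measurable_RInt_kernel (b : R -> R) (c : R * R -> R) (M : R) :
  RL1 b -> measurable_fun setT c -> (forall z, `|c z| <= M) ->
  measurable_fun setT (fun x => RInt (fun y => b y * c (x, y))).
Proof.
move=> b1 mc cM.
have mb := RL1_meas b1.
have mcx x : measurable_fun setT (fun y => c (x, y)).
  by apply: measurableT_comp => //; exact: measurable_fun_pair.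
have bc x : RL1 (fun y => b y * c (x, y)).
  have := RL1M b1 (mcx x) (fun y => cM (x, y)).
  by under eq_fun do rewrite mulrC.
have nb := RL1Zl M (RL1_norm b1).
pose G x := (\int[mu]_y (M * `|b y| + b y * c (x, y))%R%:E)%E.
have GE x : RInt (fun y => b y * c (x, y)) = fine (G x) - M * RInt (fun y => `|b y|).
  rewrite -RIntZl; last exact: RL1_norm.
  have -> : fine (G x) = RInt (fun y => M * `|b y| + b y * c (x, y)) by [].
  by rewrite RIntD// addrC addKr.
rewrite (_ : (fun x => _) = (fun x => fine (G x) - M * RInt (fun y => `|b y|))); last exact/funext.
apply: measurable_funB => //; apply: measurableT_comp => //.
apply: (@measurable_fun_fubini_tonelli_F _ _ _ _ R mu
  (fun z => (M * `|b z.2| + b z.2 * c z)%:E)).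
- apply/measurable_EFinP; apply: measurable_funD; apply: measurable_funM => //.
  + by apply: measurableT_comp => //; apply: measurableT_comp.
  + exact: measurableT_comp.
- move=> z; rewrite lee_fin.
  have := ler_norm (- (b z.2 * c z)).
  have : `|b z.2 * c z| <= M * `|b z.2| by rewrite normrM mulrC ler_wpM2r.
  rewrite normrN; lra.
Qed.

(** The integrand is dominated by the tensor product [M * |a x| * |b y|], hence integrable on the
    plane. Every exchange of integrals below is brought to this shape: two integrable factors and a
    bounded measurable kernel. *)
Lemma Fubini_kernel (a b : R -> R) (c : R * R -> R) (M : R) :
  RL1 a -> RL1 b -> measurable_fun setT c -> (forall z, `|c z| <= M) ->
  RInt (fun x => a x * RInt (fun y => b y * c (x, y))) =
  RInt (fun y => b y * RInt (fun x => a x * c (x, y))).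
Proof.
move=> a1 b1 mc cM.
have [ma mb] := (RL1_meas a1, RL1_meas b1).
have mcx x : measurable_fun setT (fun y => c (x, y)).
  by apply: measurableT_comp => //; exact: measurable_fun_pair.
have mcy y : measurable_fun setT (fun x => c (x, y)).
  by apply: measurableT_comp => //; exact: measurable_fun_pair.
have bc x : RL1 (fun y => b y * c (x, y)).
  have := RL1M b1 (mcx x) (fun y => cM (x, y)).
  by under eq_fun do rewrite mulrC.
have ac y : RL1 (fun x => a x * c (x, y)).
  have := RL1M a1 (mcy y) (fun x => cM (x, y)).
  by under eq_fun do rewrite mulrC.
pose f (z : R * R) := (a z.1 * (b z.2 * c z))%:E.
have mf : measurable_fun setT f.
  apply/measurable_EFinP; apply: measurable_funM.
    exact: measurableT_comp.
  by apply: measurable_funM => //; exact: measurableT_comp.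
have f1 : (mu \x mu)%E.-integrable setT f.
  apply: (@integrable12ltyP _ _ (measurableTypeR R) (measurableTypeR R) R mu mu f mf).2.
  apply: (@le_lt_trans _ _ (\int[mu]_x (`|a x| * (M * RInt (fun y => `|b y|)))%R%:E)%E).
    apply: ge0_le_integral => //.
    - by move=> x _; exact: integral_ge0.
    - apply: (@measurable_fun_fubini_tonelli_F _ _ _ _ R mu (fun z => `|f z|%E)) => //.
      exact: measurableT_comp.
    - apply/measurable_EFinP; apply: measurable_funM => //; exact: measurableT_comp.
    - move=> x _; rewrite EFinM -RIntZl; last exact: RL1_norm.
      rewrite RIntE; last exact/RL1Zl/RL1_norm.
      rewrite -ge0_integralZl//; last 2 first.
      + by apply/measurable_EFinP; apply: measurable_funM => //; exact: measurableT_comp.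
      + by move=> y _; rewrite lee_fin mulr_ge0// (le_trans _ (cM (0, 0))).
      apply: ge0_le_integral => //.
      + by apply: measurableT_comp => //; apply: measurableT_comp => //; exact: measurable_fun_pair.
      + apply/measurable_EFinP; apply: measurable_funM => //; apply: measurable_funM => //.
        exact: measurableT_comp.
      + move=> y _; rewrite /f /= lee_fin !normrM ler_wpM2l// mulrC ler_wpM2r//; exact: cM.
  have h : RL1 (fun x => `|a x| * (M * RInt (fun y => `|b y|))).
    have := RL1Zl (M * RInt (fun y => `|b y|)) (RL1_norm a1).
    by under eq_fun do rewrite mulrC.
  exact: integrable_lty h.
have fubini := Fubini f1.
rewrite /RInt /Rintegral.
have -> : (\int[mu]_x (a x * fine (\int[mu]_y (b y * c (x, y))%R%:E))%R%:E =
    \int[mu]_x \int[mu]_y f (x, y))%E.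
  apply: eq_integral => x _; rewrite EFinM fineK; last exact: integrable_fin_num (bc x).
  by rewrite -(integralZl measurableT (bc x)).
rewrite fubini; congr fine; apply: eq_integral => y _.
rewrite EFinM fineK; last exact: integrable_fin_num (ac y).
rewrite -(integralZl measurableT (ac y)).
by apply: eq_integral => x _; rewrite /f/= -EFinM mulrCA.
Qed.


Lemma measurable_pair1 (c : R * R -> R) x : measurable_fun setT c ->
  measurable_fun setT (fun y => c (x, y)).
Proof. by move=> mc; apply: measurableT_comp => //; exact: measurable_fun_pair. Qed.

Lemma RInt_kernel_bound (b : R -> R) (c : R * R -> R) (M : R) x :
  RL1 b -> measurable_fun setT c -> (forall z, `|c z| <= M) ->
  RL1 (fun y => b y * c (x, y)) /\
  `|RInt (fun y => b y * c (x, y))| <= M * RInt (fun y => `|b y|).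
Proof.
move=> b1 mc cM.
have mb := RL1_meas b1.
have h y : `|b y * c (x, y)| <= M * `|b y| by rewrite normrM mulrC ler_wpM2r.
have mbc : measurable_fun setT (fun y => b y * c (x, y)).
  by apply: measurable_funM => //; exact: measurable_pair1.
split; first exact: (RL1_dom mbc h (RL1Zl M (RL1_norm b1))).
by rewrite -RIntZl; [apply: RInt_dom => //; apply: RL1Zl|]; exact: RL1_norm.
Qed.

Lemma RL1_kernel (a b : R -> R) (c : R * R -> R) (M : R) :
  RL1 a -> RL1 b -> measurable_fun setT c -> (forall z, `|c z| <= M) ->
  RL1 (fun x => a x * RInt (fun y => b y * c (x, y))).
Proof.
move=> a1 b1 mc cM.
have := RL1M a1 (measurable_RInt_kernel b1 mc cM)
  (fun x => (RInt_kernel_bound x b1 mc cM).2).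
by under eq_fun do rewrite mulrC.
Qed.

Lemma RInt_cvg_at_right (f_ : R -> R -> R) f g :
  (forall s, 0 < s -> measurable_fun setT (f_ s)) -> RL1 g ->
  (forall s, 0 < s -> forall x, `|f_ s x| <= g x) ->
  (forall x, f_ ^~ x @ 0^'+ --> f x) ->
  (fun s => RInt (f_ s)) @ 0^'+ --> RInt f.
Proof.
move=> mf g1 fg ff; apply/cvg_at_rightP => u [u0 ucvg].
apply: (RInt_cvg_seq (g := g)) => //.
- by move=> n; exact: mf.
- by move=> n x; exact: fg.
- by move=> x; have /cvg_at_rightP := ff x; apply.
Qed.

Lemma RInt_cvg_pinfty (f_ : R -> R -> R) f g :
  (forall s, measurable_fun setT (f_ s)) -> RL1 g ->
  (forall s x, `|f_ s x| <= g x) -> (forall x, f_ ^~ x @ +oo --> f x) ->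
  (fun s => RInt (f_ s)) @ +oo --> RInt f.
Proof.
move=> mf g1 fg ff; apply/cvg_pinftyP => u ucvg.
apply: (RInt_cvg_seq (g := g)) => //.
by move=> x; have /cvg_pinftyP := ff x; apply.
Qed.

End RealIntegrals.

(** * Complex-valued integrals *)

Section ComplexIntegrals.
Variable R : realType.
Local Notation mu := (@lebesgue_measure R).
Local Notation Re := complex.Re.
Local Notation Im := complex.Im.

(** Used in place of the modulus: it is real-valued, splits into components that are integrated
    separately, and is still submultiplicative. The crude bound 2 for [cis] is the source of many
    factors 2 below. *)
Definition n1 (z : R[i]) : R := `|Re z| + `|Im z|.
Definition cis (t : R) : R[i] := cos t +i* sin t.
(** Stated over an arbitrary domain, unlike [cmeasurable], because the kernels live on pairs. *)
Definition cmeas d (T : measurableType d) (f : T -> R[i]) : Prop :=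
  measurable_fun setT (fun x => Re (f x)) /\ measurable_fun setT (fun x => Im (f x)).
Definition CL1 (f : R -> R[i]) : Prop := cintegrable setT f.
Definition CInt (f : R -> R[i]) : R[i] := cint setT f.

Lemma ReM (z w : R[i]) : Re (z * w) = Re z * Re w - Im z * Im w.
Proof. by case: z; case: w. Qed.
Lemma ImM (z w : R[i]) : Im (z * w) = Re z * Im w + Im z * Re w.
Proof. by case: z; case: w. Qed.
Lemma ReD (z w : R[i]) : Re (z + w) = Re z + Re w.
Proof. by case: z; case: w. Qed.
Lemma ImD (z w : R[i]) : Im (z + w) = Im z + Im w.
Proof. by case: z; case: w. Qed.
Lemma ReN (z : R[i]) : Re (- z) = - Re z.
Proof. by case: z. Qed.
Lemma ImN (z : R[i]) : Im (- z) = - Im z.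
Proof. by case: z. Qed.
Lemma ReB (z w : R[i]) : Re (z - w) = Re z - Re w.
Proof. by rewrite ReD ReN. Qed.
Lemma ImB (z w : R[i]) : Im (z - w) = Im z - Im w.
Proof. by rewrite ImD ImN. Qed.
Lemma ReC (x : R) : Re (x%:C) = x. Proof. by []. Qed.
Lemma ImC (x : R) : Im (x%:C) = 0. Proof. by []. Qed.
Lemma ReX (x y : R) : Re (x +i* y) = x. Proof. by []. Qed.
Lemma ImX (x y : R) : Im (x +i* y) = y. Proof. by []. Qed.
Definition xE := (ReX, ImX).
Lemma ReI : Re ('i : R[i]) = 0. Proof. by []. Qed.
Lemma ImI : Im ('i : R[i]) = 1. Proof. by []. Qed.
Definition cE := (ReI, ImI, ReM, ImM, ReD, ImD, ReN, ImN, ReC, ImC).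
Lemma complex_ext (z w : R[i]) : Re z = Re w -> Im z = Im w -> z = w.
Proof. by case: z => a b; case: w => c d /= -> ->. Qed.

Lemma n1_ge0 z : 0 <= n1 z. Proof. by rewrite addr_ge0. Qed.
Lemma n1_Re z : `|Re z| <= n1 z. Proof. by rewrite lerDl. Qed.
Lemma n1_Im z : `|Im z| <= n1 z. Proof. by rewrite lerDr. Qed.
Lemma n1D z w : n1 (z + w) <= n1 z + n1 w.
Proof.
rewrite /n1 !cE; have := ler_normD (Re z) (Re w); have := ler_normD (Im z) (Im w); lra.
Qed.
Lemma n1N z : n1 (- z) = n1 z.
Proof. by rewrite /n1 !cE !normrN. Qed.
Lemma n1B z w : n1 (z - w) <= n1 z + n1 w.
Proof. by rewrite -(n1N w) n1D. Qed.
Lemma n1M z w : n1 (z * w) <= n1 z * n1 w.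
Proof.
rewrite /n1 !cE.
have := ler_normB (Re z * Re w) (Im z * Im w).
have := ler_normD (Re z * Im w) (Im z * Re w).
rewrite !normrM; lra.
Qed.
Lemma n1C (x : R) : n1 x%:C = `|x|.
Proof. by rewrite /n1 !cE normr0 addr0. Qed.
Lemma n1MC z (x : R) : n1 (z * x%:C) = n1 z * `|x|.
Proof. by rewrite /n1 !cE !mulr0 subr0 add0r !normrM mulrDl. Qed.
Lemma n1CM z (x : R) : n1 (x%:C * z) = `|x| * n1 z.
Proof. by rewrite mulrC n1MC mulrC. Qed.
Lemma n1_cis t : n1 (cis t) <= 2.
Proof.
rewrite /n1 /=; have := cos_le1 t; have := cos_geN1 t; have := sin_le1 t; have := sin_geN1 t.
have : `|cos t| <= 1 by rewrite ler_norml cos_geN1 cos_le1.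
have : `|sin t| <= 1 by rewrite ler_norml sin_geN1 sin_le1.
lra.
Qed.
Lemma n10 : n1 0 = 0. Proof. by rewrite /n1 normr0 addr0. Qed.
Lemma cisD s t : cis (s + t) = cis s * cis t.
Proof. by rewrite /cis cosD sinD; apply: complex_ext; rewrite !cE//= addrC. Qed.
Lemma cis0 : cis 0 = 1.
Proof. by rewrite /cis cos0 sin0. Qed.
Lemma cmeasD d (T : measurableType d) (f g : T -> R[i]) :
  cmeas f -> cmeas g -> cmeas (fun x => f x + g x).
Proof.
move=> [f1 f2] [g1 g2]; split.
- by under eq_fun do rewrite ReD; exact: measurable_funD.
- by under eq_fun do rewrite ImD; exact: measurable_funD.
Qed.

Lemma cmeasM d (T : measurableType d) (f g : T -> R[i]) :
  cmeas f -> cmeas g -> cmeas (fun x => f x * g x).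
Proof.
move=> [f1 f2] [g1 g2]; split.
- by under eq_fun do rewrite ReM; apply: measurable_funB; exact: measurable_funM.
- by under eq_fun do rewrite ImM; apply: measurable_funD; exact: measurable_funM.
Qed.

Lemma cmeasN d (T : measurableType d) (f : T -> R[i]) :
  cmeas f -> cmeas (fun x => - f x).
Proof.
move=> [f1 f2]; split.
- by under eq_fun do rewrite ReN; exact: measurable_funN.
- by under eq_fun do rewrite ImN; exact: measurable_funN.
Qed.

Lemma cmeasB d (T : measurableType d) (f g : T -> R[i]) :
  cmeas f -> cmeas g -> cmeas (fun x => f x - g x).
Proof. by move=> f1 g1; apply: cmeasD => //; exact: cmeasN. Qed.

Lemma cmeas_cst d (T : measurableType d) (z : R[i]) : cmeas (fun _ : T => z).
Proof. by split; exact: measurable_cst. Qed.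

Lemma cmeasC d (T : measurableType d) (f : T -> R) :
  measurable_fun setT f -> cmeas (fun x => (f x)%:C).
Proof. by move=> mf; split => //=; exact: measurable_cst. Qed.

Lemma cmeas_cis d (T : measurableType d) (f : T -> R) :
  measurable_fun setT f -> cmeas (fun x => cis (f x)).
Proof.
move=> mf; split => /=.
- by apply: measurableT_comp mf; apply: continuous_measurable_fun; exact: continuous_cos.
- by apply: measurableT_comp mf; apply: continuous_measurable_fun; exact: continuous_sin.
Qed.

Lemma cmeas_comp d d' (T : measurableType d) (T' : measurableType d')
  (f : T -> R[i]) (g : T' -> T) :
  cmeas f -> measurable_fun setT g -> cmeas (fun x => f (g x)).
Proof.
by move=> [f1 f2] mg; split; [apply: measurableT_comp f1 mg|apply: measurableT_comp f2 mg].
Qed.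

Lemma measurable_n1 d (T : measurableType d) (f : T -> R[i]) :
  cmeas f -> measurable_fun setT (fun x => n1 (f x)).
Proof. by move=> [f1 f2]; apply: measurable_funD; exact: measurableT_comp. Qed.

Lemma CL1_meas f : CL1 f -> cmeas f.
Proof. by move=> [f1 f2]; split; exact: RL1_meas. Qed.

Lemma CL1_dom f g : cmeas f -> (forall x, n1 (f x) <= g x) -> RL1 g -> CL1 f.
Proof.
move=> [m1 m2] fg g1; split.
- by apply: (RL1_dom m1 _ g1) => x; rewrite (le_trans (n1_Re _)).
- by apply: (RL1_dom m2 _ g1) => x; rewrite (le_trans (n1_Im _)).
Qed.

Lemma RL1_n1 f : CL1 f -> RL1 (fun x => n1 (f x)).
Proof. by move=> [f1 f2]; apply: RL1D; exact: RL1_norm. Qed.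

Lemma RL1_Re f : CL1 f -> RL1 (fun x => Re (f x)).
Proof. by case. Qed.

Lemma RL1_Im f : CL1 f -> RL1 (fun x => Im (f x)).
Proof. by case. Qed.

Lemma CL1C (f : R -> R) : RL1 f -> CL1 (fun x => (f x)%:C).
Proof. by move=> f1; split => //=; exact: RL10. Qed.

Lemma CL1D f g : CL1 f -> CL1 g -> CL1 (fun x => f x + g x).
Proof.
move=> f1 g1; apply: (@CL1_dom _ (fun x => n1 (f x) + n1 (g x))).
- by apply: cmeasD; exact: CL1_meas.
- by move=> x; exact: n1D.
- by apply: RL1D; exact: RL1_n1.
Qed.

Lemma CL1Mb f h (M : R) : CL1 f -> cmeas h -> (forall x, n1 (h x) <= M) ->
  CL1 (fun x => f x * h x).
Proof.
move=> f1 mh hM; apply: (@CL1_dom _ (fun x => M * n1 (f x))).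
- by apply: cmeasM => //; exact: CL1_meas.
- by move=> x; rewrite (le_trans (n1M _ _))// mulrC ler_wpM2r// n1_ge0.
- exact/RL1Zl/RL1_n1.
Qed.

Lemma CL1Zr f z : CL1 f -> CL1 (fun x => f x * z).
Proof. by move=> f1; apply: (CL1Mb (M := n1 z)) => //; exact: cmeas_cst. Qed.

Lemma CL1Zl f z : CL1 f -> CL1 (fun x => z * f x).
Proof. by move=> f1; under eq_fun do rewrite mulrC; exact: CL1Zr. Qed.

Lemma CL1N f : CL1 f -> CL1 (fun x => - f x).
Proof. by move=> f1; under eq_fun do rewrite -mulN1r; exact: CL1Zl. Qed.

Lemma CL1B f g : CL1 f -> CL1 g -> CL1 (fun x => f x - g x).
Proof. by move=> f1 g1; apply: CL1D => //; exact: CL1N. Qed.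

Lemma ReCInt f : Re (CInt f) = RInt (fun x => Re (f x)). Proof. by []. Qed.
Lemma ImCInt f : Im (CInt f) = RInt (fun x => Im (f x)). Proof. by []. Qed.

Lemma CInt0 : CInt (fun=> 0) = 0.
Proof. by apply: complex_ext; rewrite ?ReCInt ?ImCInt /= RInt0. Qed.

Lemma CIntC (f : R -> R) : CInt (fun x => (f x)%:C) = (RInt f)%:C.
Proof. by apply: complex_ext; rewrite ?ReCInt ?ImCInt //= RInt0. Qed.

Lemma CIntD f g : CL1 f -> CL1 g ->
  CInt (fun x => f x + g x) = CInt f + CInt g.
Proof.
move=> [f1 f2] [g1 g2]; apply: complex_ext; rewrite !cE ?ReCInt ?ImCInt -RIntD//;
  congr RInt; apply/funext => x; by rewrite cE.
Qed.

Lemma CIntZl f z : CL1 f -> CInt (fun x => z * f x) = z * CInt f.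
Proof.
move=> [f1 f2]; apply: complex_ext.
- rewrite ReM.
  change (RInt (fun x => Re (z * f x)) =
    Re z * RInt (fun x => Re (f x)) - Im z * RInt (fun x => Im (f x))).
  rewrite -!RIntZl// -RIntB; [|exact: RL1Zl..].
  by congr RInt; apply/funext => x; rewrite cE.
- rewrite ImM.
  change (RInt (fun x => Im (z * f x)) =
    Re z * RInt (fun x => Im (f x)) + Im z * RInt (fun x => Re (f x))).
  rewrite -!RIntZl// -RIntD; [|exact: RL1Zl..].
  by congr RInt; apply/funext => x; rewrite cE.
Qed.

Lemma CIntZr f z : CL1 f -> CInt (fun x => f x * z) = CInt f * z.
Proof.
by move=> f1; rewrite mulrC -CIntZl//; congr CInt; apply/funext => x; rewrite mulrC.
Qed.

Lemma CIntN f : CL1 f -> CInt (fun x => - f x) = - CInt f.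
Proof.
move=> f1; rewrite -mulN1r -CIntZl//; congr CInt; apply/funext => x; by rewrite mulN1r.
Qed.

Lemma CIntB f g : CL1 f -> CL1 g ->
  CInt (fun x => f x - g x) = CInt f - CInt g.
Proof. by move=> f1 g1; rewrite CIntD ?CIntN//; exact: CL1N. Qed.

Lemma n1_CInt f : CL1 f -> n1 (CInt f) <= RInt (fun x => n1 (f x)).
Proof.
move=> [f1 f2]; rewrite /n1 RIntD; [|exact: RL1_norm..].
by apply: lerD; exact: RInt_norm.
Qed.

Lemma n1_CInt_dom f g : cmeas f -> (forall x, n1 (f x) <= g x) -> RL1 g ->
  n1 (CInt f) <= RInt g.
Proof.
move=> mf fg g1; have f1 := CL1_dom mf fg g1.
by rewrite (le_trans (n1_CInt f1))// RInt_le//; exact: RL1_n1.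
Qed.

Lemma CL1_affine f (a b : R) : a != 0 -> CL1 f -> CL1 (fun x => f (a * x + b)).
Proof. by move=> a0 [f1 f2]; split; [apply: RL1_affine f1|apply: RL1_affine f2]. Qed.

Lemma CInt_affine f (a b : R) : a != 0 -> CL1 f ->
  CInt (fun x => f (a * x + b)) = (`|a|^-1)%:C * CInt f.
Proof.
move=> a0 [f1 f2]; apply: complex_ext.
- rewrite ReM ReC ImC mul0r subr0.
  exact: (@RInt_affine _ (fun x => Re (f x))).
- rewrite ImM ReC ImC mul0r addr0.
  exact: (@RInt_affine _ (fun x => Im (f x))).
Qed.

Lemma CL1_shift f (b : R) : CL1 f -> CL1 (fun x => f (x + b)).
Proof. by move=> f1; have := CL1_affine b (oner_neq0 R) f1; under eq_fun do rewrite mul1r. Qed.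

Lemma CInt_shift f (b : R) : CL1 f -> CInt (fun x => f (x + b)) = CInt f.
Proof.
move=> f1; have := CInt_affine b (oner_neq0 R) f1; under eq_fun do rewrite mul1r.
by rewrite normr1 invr1 mul1r.
Qed.

Lemma CL1_flip f (b : R) : CL1 f -> CL1 (fun x => f (b - x)).
Proof.
have n10 : (-1 : R) != 0 by rewrite oppr_eq0 oner_neq0.
by move=> f1; have := CL1_affine b n10 f1; under eq_fun do rewrite mulN1r addrC.
Qed.

Lemma CInt_flip f (b : R) : CL1 f -> CInt (fun x => f (b - x)) = CInt f.
Proof.
have n10 : (-1 : R) != 0 by rewrite oppr_eq0 oner_neq0.
move=> f1; have := CInt_affine b n10 f1; under eq_fun do rewrite mulN1r addrC.
by rewrite normrN normr1 invr1 mul1r.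
Qed.

Lemma ccvgD (F : set_system R) (FF : Filter F) f g a b :
  ccvg F f a -> ccvg F g b -> ccvg F (fun x => f x + g x) (a + b).
Proof.
move=> [f1 f2] [g1 g2]; split; rewrite cE.
- by under eq_cvg do rewrite cE; exact: cvgD.
- by under eq_cvg do rewrite cE; exact: cvgD.
Qed.

Lemma ccvgM (F : set_system R) (FF : Filter F) f g a b :
  ccvg F f a -> ccvg F g b -> ccvg F (fun x => f x * g x) (a * b).
Proof.
move=> [f1 f2] [g1 g2]; split; rewrite cE.
- by under eq_cvg do rewrite cE; apply: cvgB; exact: cvgM.
- by under eq_cvg do rewrite cE; apply: cvgD; exact: cvgM.
Qed.

Lemma ccvg_cst (F : set_system R) (FF : Filter F) a : ccvg F (fun=> a) a.
Proof. by split; exact: cvg_cst. Qed.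

Lemma ccvgN (F : set_system R) (FF : Filter F) f a :
  ccvg F f a -> ccvg F (fun x => - f x) (- a).
Proof.
move=> [f1 f2]; split; rewrite cE.
- by under eq_cvg do rewrite cE; exact: cvgN.
- by under eq_cvg do rewrite cE; exact: cvgN.
Qed.

Lemma ccvgB (F : set_system R) (FF : Filter F) f g a b :
  ccvg F f a -> ccvg F g b -> ccvg F (fun x => f x - g x) (a - b).
Proof. by move=> f1 g1; apply: ccvgD => //; exact: ccvgN. Qed.

Lemma ccvgC (F : set_system R) (FF : Filter F) (f : R -> R) (a : R) :
  f @ F --> a -> ccvg F (fun x => (f x)%:C) a%:C.
Proof. by move=> fa; split => //=; exact: cvg_cst. Qed.

Lemma ccvg_unique (F : set_system R) (FF : ProperFilter F) f a b :
  ccvg F f a -> ccvg F f b -> a = b.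
Proof.
move=> [f1 f2] [g1 g2]; apply: complex_ext.
- exact: (cvg_unique _ f1 g1).
- exact: (cvg_unique _ f2 g2).
Qed.

Lemma ccvg_n1P (F : set_system R) (FF : Filter F) f a :
  ccvg F f a <-> (forall e, 0 < e -> \forall x \near F, n1 (f x - a) <= e).
Proof.
split.
- move=> [/cvgrPdist_le f1 /cvgrPdist_le f2] e e0.
  have e2 : 0 < e / 2 by rewrite divr_gt0.
  near=> x.
  rewrite /n1 ReB ImB (splitr e) distrC [X in _ + X]distrC.
  by apply: lerD; near: x; [exact: f1|exact: f2].
- move=> h; split; apply/cvgrPdist_le => e e0; near=> x.
  + have : n1 (f x - a) <= e by near: x; exact: h.
    by rewrite distrC -ReB; exact/le_trans/n1_Re.
  + have : n1 (f x - a) <= e by near: x; exact: h.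
    by rewrite distrC -ImB; exact/le_trans/n1_Im.
Unshelve. all: by end_near.
Qed.

Lemma CInt_cvg_at_right (f_ : R -> R -> R[i]) f g :
  (forall s, 0 < s -> cmeas (f_ s)) -> RL1 g ->
  (forall s, 0 < s -> forall x, n1 (f_ s x) <= g x) ->
  (forall x, ccvg 0^'+ (f_ ^~ x) (f x)) ->
  ccvg 0^'+ (fun s => CInt (f_ s)) (CInt f).
Proof.
move=> mf g1 fg ff; split.
- apply: (@RInt_cvg_at_right _ (fun s x => Re (f_ s x)) (fun x => Re (f x)) g) => //.
  + by move=> s /mf[].
  + by move=> s s0 x; rewrite (le_trans (n1_Re _))// fg.
  + by move=> x; have [] := ff x.
- apply: (@RInt_cvg_at_right _ (fun s x => Im (f_ s x)) (fun x => Im (f x)) g) => //.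
  + by move=> s /mf[].
  + by move=> s s0 x; rewrite (le_trans (n1_Im _))// fg.
  + by move=> x; have [] := ff x.
Qed.

Lemma CInt_cvg_pinfty (f_ : R -> R -> R[i]) f g :
  (forall s, cmeas (f_ s)) -> RL1 g ->
  (forall s x, n1 (f_ s x) <= g x) ->
  (forall x, ccvg +oo (f_ ^~ x) (f x)) ->
  ccvg +oo (fun s => CInt (f_ s)) (CInt f).
Proof.
move=> mf g1 fg ff; split.
- apply: (@RInt_cvg_pinfty _ (fun s x => Re (f_ s x)) (fun x => Re (f x)) g) => //.
  + by move=> s; case: (mf s).
  + by move=> s x; rewrite (le_trans (n1_Re _))// fg.
  + by move=> x; have [] := ff x.
- apply: (@RInt_cvg_pinfty _ (fun s x => Im (f_ s x)) (fun x => Im (f x)) g) => //.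
  + by move=> s; case: (mf s).
  + by move=> s x; rewrite (le_trans (n1_Im _))// fg.
  + by move=> x; have [] := ff x.
Qed.

Lemma ccvg_compN f (l : R[i]) : ccvg +oo (fun x => f (- x)) l -> ccvg -oo f l.
Proof.
move=> [h1 h2]; split.
- by apply: (cvgNy_compNP (fun x => Re (f x)) _).2; exact: h1.
- by apply: (cvgNy_compNP (fun x => Im (f x)) _).2; exact: h2.
Qed.

Definition RIntK (a b : R -> R) (c : R * R -> R) : R :=
  RInt (fun x => a x * RInt (fun y => b y * c (x, y))).

(** Expands the complex iterated integral into eight real ones, to each of which the real Fubini
    lemma applies. *)
Let CInt_kernelE (a b : R -> R[i]) (c : R * R -> R[i]) (M : R) :
  CL1 a -> CL1 b -> cmeas c -> (forall z, n1 (c z) <= M) ->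
  let ar := fun x => Re (a x) in let ai := fun x => Im (a x) in
  let br := fun x => Re (b x) in let bi := fun x => Im (b x) in
  let cr := fun x => Re (c x) in let ci := fun x => Im (c x) in
  CInt (fun x => a x * CInt (fun y => b y * c (x, y))) =
  (RIntK ar br cr - RIntK ar bi ci - (RIntK ai br ci + RIntK ai bi cr)) +i*
  (RIntK ar br ci + RIntK ar bi cr + (RIntK ai br cr - RIntK ai bi ci)).
Proof.
move=> [a1 a2] [b1 b2] [c1 c2] cM /=.
have crM z : `|Re (c z)| <= M by rewrite (le_trans (n1_Re _)).
have ciM z : `|Im (c z)| <= M by rewrite (le_trans (n1_Im _)).
have inr x : Re (CInt (fun y => b y * c (x, y))) =
    RInt (fun y => Re (b y) * Re (c (x, y))) - RInt (fun y => Im (b y) * Im (c (x, y))).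
  rewrite ReCInt -RIntB.
  - by congr RInt; apply/funext => y; rewrite cE.
  - exact: (RInt_kernel_bound x b1 c1 crM).1.
  - exact: (RInt_kernel_bound x b2 c2 ciM).1.
have ini x : Im (CInt (fun y => b y * c (x, y))) =
    RInt (fun y => Re (b y) * Im (c (x, y))) + RInt (fun y => Im (b y) * Re (c (x, y))).
  rewrite ImCInt -RIntD.
  - by congr RInt; apply/funext => y; rewrite cE.
  - exact: (RInt_kernel_bound x b1 c2 ciM).1.
  - exact: (RInt_kernel_bound x b2 c1 crM).1.
have q1 := RL1_kernel a1 b1 c1 crM.
have q2 := RL1_kernel a1 b2 c2 ciM.
have q3 := RL1_kernel a2 b1 c2 ciM.
have q4 := RL1_kernel a2 b2 c1 crM.
have q5 := RL1_kernel a1 b1 c2 ciM.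
have q6 := RL1_kernel a1 b2 c1 crM.
have q7 := RL1_kernel a2 b1 c1 crM.
have q8 := RL1_kernel a2 b2 c2 ciM.
apply: complex_ext; rewrite [RHS]/=.
- have E := RIntB (RL1B q1 q2) (RL1D q3 q4).
  rewrite (RIntB q1 q2) (RIntD q3 q4) in E; rewrite ReCInt; apply: etrans E.
  by congr RInt; apply/funext => x; rewrite ReM inr ini mulrBr mulrDr.
- have E := RIntD (RL1D q5 q6) (RL1B q7 q8).
  rewrite (RIntD q5 q6) (RIntB q7 q8) in E; rewrite ImCInt; apply: etrans E.
  by congr RInt; apply/funext => x; rewrite ImM inr ini mulrBr mulrDr.
Qed.

Lemma CFubini_kernel (a b : R -> R[i]) (c : R * R -> R[i]) (M : R) :
  CL1 a -> CL1 b -> cmeas c -> (forall z, n1 (c z) <= M) ->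
  CInt (fun x => a x * CInt (fun y => b y * c (x, y))) =
  CInt (fun y => b y * CInt (fun x => a x * c (x, y))).
Proof.
move=> a1 b1 c1 cM.
have mswap : measurable_fun setT (fun z : R * R => (z.2, z.1)).
  by apply: measurable_fun_pair.
have c1' : cmeas (fun z : R * R => c (z.2, z.1)) by exact: cmeas_comp c1 mswap.
rewrite (CInt_kernelE a1 b1 c1 cM).
rewrite (@CInt_kernelE b a (fun z => c (z.2, z.1)) M b1 a1 c1' (fun z => cM _)) /=.
have crM z : `|Re (c z)| <= M by rewrite (le_trans (n1_Re _)).
have ciM z : `|Im (c z)| <= M by rewrite (le_trans (n1_Im _)).
case: a1 b1 c1 => [a1 a2] [b1 b2] [c1 c2].
have FK (u v : R -> R) (w : R * R -> R) : RL1 u -> RL1 v ->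
  measurable_fun setT w -> (forall z, `|w z| <= M) ->
  RIntK u v w = RIntK v u (fun z => w (z.2, z.1)).
  by move=> u1 v1 mw wM; rewrite /RIntK (Fubini_kernel u1 v1 mw wM).
(* Exchanging the two functions transposes the mixed terms; [swap] records the resulting
   permutation. *)
have swap (A B C D A' B' C' D' : R) :
  (A - B - (C + D)) +i* (A' + B' + (C' - D')) = (A - C - (B + D)) +i* (A' + C' + (B' - D')).
  by congr (_ +i* _); ring.
rewrite (FK _ _ _ a1 b1 c1 crM) (FK _ _ _ a1 b2 c2 ciM) (FK _ _ _ a2 b1 c2 ciM) (FK _ _ _ a2 b2 c1 crM).
rewrite (FK _ _ _ a1 b1 c2 ciM) (FK _ _ _ a1 b2 c1 crM) (FK _ _ _ a2 b1 c1 crM) (FK _ _ _ a2 b2 c2 ciM).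
exact: swap.
Qed.

Lemma cmeas_kernel (b : R -> R[i]) (c : R * R -> R[i]) (M : R) :
  CL1 b -> cmeas c -> (forall z, n1 (c z) <= M) ->
  cmeas (fun x => CInt (fun y => b y * c (x, y))).
Proof.
move=> [b1 b2] [c1 c2] cM.
have crM z : `|Re (c z)| <= M by rewrite (le_trans (n1_Re _)).
have ciM z : `|Im (c z)| <= M by rewrite (le_trans (n1_Im _)).
split.
- rewrite (_ : (fun x => _) = (fun x => RInt (fun y => Re (b y) * Re (c (x, y))) -
    RInt (fun y => Im (b y) * Im (c (x, y))))).
    by apply: measurable_funB; [exact: measurable_RInt_kernel b1 c1 crM|exact: measurable_RInt_kernel b2 c2 ciM].
  apply/funext => x; rewrite ReCInt -RIntB.
  - by congr RInt; apply/funext => y; rewrite cE.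
  - exact: (RInt_kernel_bound x b1 c1 crM).1.
  - exact: (RInt_kernel_bound x b2 c2 ciM).1.
- rewrite (_ : (fun x => _) = (fun x => RInt (fun y => Re (b y) * Im (c (x, y))) +
    RInt (fun y => Im (b y) * Re (c (x, y))))).
    by apply: measurable_funD; [exact: measurable_RInt_kernel b1 c2 ciM|exact: measurable_RInt_kernel b2 c1 crM].
  apply/funext => x; rewrite ImCInt -RIntD.
  - by congr RInt; apply/funext => y; rewrite cE.
  - exact: (RInt_kernel_bound x b1 c2 ciM).1.
  - exact: (RInt_kernel_bound x b2 c1 crM).1.
Qed.

Lemma n1_CInt_kernel (b : R -> R[i]) (c : R * R -> R[i]) (M : R) x :
  CL1 b -> cmeas c -> (forall z, n1 (c z) <= M) ->
  n1 (CInt (fun y => b y * c (x, y))) <= M * RInt (fun y => n1 (b y)).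
Proof.
move=> b1 c1 cM; rewrite -RIntZl; last exact: RL1_n1.
apply: n1_CInt_dom.
- by apply: cmeasM; [exact: CL1_meas|apply: (cmeas_comp c1); exact: measurable_fun_pair].
- by move=> y; rewrite (le_trans (n1M _ _))// mulrC ler_wpM2r// n1_ge0.
- exact/RL1Zl/RL1_n1.
Qed.

End ComplexIntegrals.

(** * Smooth functions *)

Section Smooth.
Variable R : realType.
Implicit Types (f g : R -> R).

Lemma is_derive_all f (f' : R -> R) : (forall x, is_derive (x : R) 1 f (f' x)) ->
  (forall x, derivable f x 1) /\ (derive1 f) = f'.
Proof.
move=> h; split=> [x|]; first by have [] := h x.
by apply/funext => x; rewrite derive1E; have [] := h x.
Qed.

(** Avoids formulas for iterated derivatives: it is enough to exhibit a class of functions closed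
    under differentiation. Sums, products, affine substitutions, the flat function and correlations
    are all treated this way. *)
Lemma smooth_coind (P : (R -> R) -> Prop) :
  (forall f, P f -> exists2 f' : R -> R, (forall x, is_derive (x : R) 1 f (f' x)) & P f') ->
  forall f, P f -> smooth f.
Proof.
move=> hP f Pf n.
suff : P (derive1n n f) by move=> /hP[f' h _] x; have [] := is_derive_all h.
elim: n => [//|n IH]; rewrite derive1nS.
by have [f' h Pf'] := hP _ IH; have [_ ->] := is_derive_all h.
Qed.

Lemma smooth_derivable f x : smooth f -> derivable f x 1.
Proof. by move=> sf; exact: (sf 0%N). Qed.

Lemma smooth_derive1 f : smooth f -> smooth (derive1 f).
Proof. by move=> sf n x; have := sf n.+1 x; rewrite /derive1n iterSr. Qed.

Lemma smooth_is_derive f x : smooth f -> is_derive (x : R) 1 f ((derive1 f) x).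
Proof. by move=> sf; apply: DeriveDef; [exact: smooth_derivable|rewrite derive1E]. Qed.

Lemma smooth_intro f f' : (forall x, is_derive (x : R) 1 f (f' x)) -> smooth f' -> smooth f.
Proof.
move=> /is_derive_all[df f'E] sf' [|n] x; first exact: df.
by rewrite /derive1n iterSr f'E; exact: sf'.
Qed.

Lemma is_derive_continuous f (x f' : R) : is_derive (x : R) 1 f f' -> {for x, continuous f}.
Proof. by move=> [df _]; apply: differentiable_continuous; exact/derivable1_diffP. Qed.

Lemma smooth_continuous f : smooth f -> continuous f.
Proof. by move=> sf x; exact: is_derive_continuous (smooth_is_derive x sf). Qed.

Lemma smooth_measurable f : smooth f -> measurable_fun setT f.
Proof. by move=> sf; apply: continuous_measurable_fun; exact: smooth_continuous. Qed.

(** Differentiating a product yields sums of products, so the class fed to [smooth_coind] has to be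
    closed under both operations. *)
Inductive smooth_alg : (R -> R) -> Prop :=
| smooth_alg_base f : smooth f -> smooth_alg f
| smooth_alg_add f g : smooth_alg f -> smooth_alg g -> smooth_alg (fun x => f x + g x)
| smooth_alg_mul f g : smooth_alg f -> smooth_alg g -> smooth_alg (fun x => f x * g x).

Lemma smooth_alg_smooth f : smooth_alg f -> smooth f.
Proof.
apply: smooth_coind => {}f; elim=> {f}[f sf|f g _ [f' df sf] _ [g' dg sg]|f g sf0 [f' df sf] sg0 [g' dg sg]].
- exists (derive1 f); first by move=> x; exact: smooth_is_derive.
  exact/smooth_alg_base/smooth_derive1.
- exists (fun x => f' x + g' x); last exact: smooth_alg_add.
  by move=> x; apply: is_deriveD.
- exists (fun x => f x * g' x + g x * f' x); last first.
    by apply: smooth_alg_add; exact: smooth_alg_mul.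
  by move=> x; apply: is_deriveM.
Qed.

Lemma smoothD f g : smooth f -> smooth g -> smooth (fun x => f x + g x).
Proof. by move=> sf sg; apply: smooth_alg_smooth; apply: smooth_alg_add; exact: smooth_alg_base. Qed.

Lemma smoothM f g : smooth f -> smooth g -> smooth (fun x => f x * g x).
Proof. by move=> sf sg; apply: smooth_alg_smooth; apply: smooth_alg_mul; exact: smooth_alg_base. Qed.

Lemma smooth_cst (c : R) : smooth (fun=> c).
Proof.
apply: (@smooth_coind (fun f => exists c, f = fun=> c)); last by exists c.
move=> _ [d ->]; exists (fun=> 0); last by exists 0.
by move=> x; exact: is_derive_cst.
Qed.

Lemma smooth_id : smooth (fun x : R => x).
Proof. by apply: (@smooth_intro _ (fun=> 1) _ (@smooth_cst 1)) => x; exact: is_derive_id. Qed.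

Lemma smoothZ (c : R) f : smooth f -> smooth (fun x => c * f x).
Proof. move=> sf. exact (smoothM (@smooth_cst c) sf). Qed.

Lemma smoothN f : smooth f -> smooth (fun x => - f x).
Proof. by move=> sf; have := smoothZ (c := -1) sf; under eq_fun do rewrite mulN1r. Qed.

Lemma smoothB f g : smooth f -> smooth g -> smooth (fun x => f x - g x).
Proof. by move=> sf sg; exact: (smoothD sf (smoothN sg)). Qed.

Lemma is_derive_affine (a b x : R) : is_derive (x : R) 1 (fun y => a * y + b) a.
Proof.
have h : is_derive (x : R) 1 (fun y => a * y + b) (a * 1 + x * 0 + 0).
  by apply: is_deriveD; apply: is_deriveM.
by apply: is_derive_eq h _; rewrite mulr1 mulr0 !addr0.
Qed.

Lemma is_derive_comp_affine f (a b x d : R) : is_derive (a * x + b) 1 f d ->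
  is_derive (x : R) 1 (fun y => f (a * y + b)) (a * d).
Proof.
move=> fd; have := @is_derive1_comp R f (fun y => a * y + b) x d a fd (is_derive_affine a b x).
by rewrite mulrC.
Qed.

Lemma smooth_affine f (a b : R) : smooth f -> smooth (fun x => f (a * x + b)).
Proof.
move=> sf; apply: (@smooth_coind (fun h => exists2 g, smooth g & exists c, h = fun x => c * g (a * x + b))).
  move=> _ [g sg [c ->]]; exists (fun x => c * (a * (derive1 g) (a * x + b))).
    move=> x; have h : is_derive (x : R) 1 (fun x => c * g (a * x + b))
        (c * (a * (derive1 g) (a * x + b)) + g (a * x + b) * 0).
      apply: is_deriveM; apply: is_derive_comp_affine; exact: smooth_is_derive.
    by apply: is_derive_eq h _; rewrite mulr0 addr0.
  exists (derive1 g); first exact: smooth_derive1.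
  by exists (c * a); apply/funext => x; rewrite mulrA.
by exists f => //; exists 1; apply/funext => x; rewrite mul1r.
Qed.

Lemma smooth_sin_cos : smooth (@sin R) /\ smooth (@cos R).
Proof.
pose P h := exists a b : R, h = fun x => a * sin x + b * cos x.
have hP : forall h, P h -> smooth h.
  apply: smooth_coind => _ [a [b ->]].
  exists (fun x => (- b) * sin x + a * cos x); last by exists (- b), a.
  move=> x; have h : is_derive (x : R) 1 (fun x => a * sin x + b * cos x)
      (a * cos x + sin x * 0 + (b * (- sin x) + cos x * 0)).
    by apply: is_deriveD; apply: is_deriveM.
  by apply: is_derive_eq h _; rewrite !mulr0 !addr0 mulrN mulNr addrC.
split; apply: hP.
- by exists 1, 0; apply/funext => x; rewrite mul1r mul0r addr0.
- by exists 0, 1; apply/funext => x; rewrite mul1r mul0r add0r.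
Qed.

Lemma smooth_cosM (h : R) : smooth (fun x => cos (h * x)).
Proof. by have := smooth_affine (a := h) (b := 0) smooth_sin_cos.2; under eq_fun do rewrite addr0. Qed.

Lemma smooth_sinM (h : R) : smooth (fun x => sin (h * x)).
Proof. by have := smooth_affine (a := h) (b := 0) smooth_sin_cos.1; under eq_fun do rewrite addr0. Qed.

(** * A smooth bump and a smooth step *)

(** [flat 0] is the classical function e^(-1/x), flat at 0; the negative powers of [x] are there
    because differentiation produces them. *)
Definition flat (n : nat) (x : R) : R := if 0 < x then x^-1 ^+ n * expR (- x^-1) else 0.

(** The Taylor term of order [n + 2] of the exponential at [x^-1] dominates [x^-1 ^+ n] with a
    factor [x ^+ 2] to spare, which is what differentiability at 0 asks for. *)
Lemma flat_le n x : `|flat n x| <= n.+2`!%:R * x ^+ 2.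
Proof.
rewrite /flat; case: ltP => [x0|_]; last by rewrite normr0 mulr_ge0// sqr_ge0.
rewrite gtr0_norm; last by rewrite mulr_gt0 ?exprn_gt0 ?invr_gt0 ?expR_gt0.
have xV0 : 0 <= x^-1 by rewrite invr_ge0 ltW.
rewrite expRN ler_pdivrMr ?expR_gt0//.
have := expR_ge1Dxn n.+1 xV0; set e := expR _; set F := n.+2`!%:R => h.
have F0 : 0 < F by rewrite ltr0n fact_gt0.
have {}h : x^-1 ^+ n.+2 <= F * e.
  rewrite mulrC -ler_pdivrMr//; lra.
have -> : x^-1 ^+ n = x ^+ 2 * x^-1 ^+ n.+2.
  have -> : x^-1 ^+ n.+2 = x^-1 ^+ n * x^-1 ^+ 2 by rewrite -exprD addn2.
  by rewrite mulrCA -[x ^+ 2 * _]exprMn divff ?gt_eqF// expr1n mulr1.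
by rewrite [leRHS]mulrAC [leLHS]mulrC ler_wpM2r// sqr_ge0.
Qed.

Lemma is_derive0_quadratic f C : f 0 = 0 -> (forall x, `|f x| <= C * x ^+ 2) ->
  is_derive (0 : R) 1 f 0.
Proof.
move=> f0 fC.
have h : (fun h => h^-1 *: (f (h *: 1 + 0) - f 0)) @ (0 : R)^' --> (0 : R).
  apply/cvgr0Pnorm_le => e e0.
  have C0 : 0 <= C by have := le_trans (normr_ge0 _) (fC 1); rewrite expr1n mulr1.
  have d0 : 0 < e / (C + 1) by rewrite divr_gt0// ltr_wpDl.
  near=> h.
  have h0 : h != 0 by near: h; exact: nbhs_dnbhs_neq.
  rewrite f0 subr0 addr0 normrZ normfV [_ *: 1]mulr1.
  rewrite ler_pdivrMl ?normr_gt0// (le_trans (fC h))//.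
  rewrite (_ : h ^+ 2 = `|h| * `|h|); last by rewrite -normrM -expr2 ger0_norm ?sqr_ge0.
  rewrite mulrCA ler_wpM2l//.
  have : `|h| <= e / (C + 1) by near: h; exact: dnbhs0_le.
  rewrite ler_pdivlMr ?ltr_wpDl//; have := normr_ge0 h; nra.
split; first by apply/cvg_ex; exists 0; exact: h.
by apply: cvg_lim => //; exact: h.
Unshelve. all: by end_near.
Qed.

Lemma is_derive_flat n (x : R) : is_derive x 1 (flat n) (flat n.+2 x - n%:R * flat n.+1 x).
Proof.
have [x0|x0|->] := ltgtP x 0.
- apply: (@near_eq_is_derive _ R^o R^o (fun=> 0)).
    near=> y; rewrite /flat ltNge ltW//=; near: y; exact: lt_nbhsl.
  have -> : flat n.+2 x - n%:R * flat n.+1 x = 0.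
    by rewrite /flat ltNge ltW//= mulr0 subr0.
  exact: is_derive_cst.
- apply: (@near_eq_is_derive _ R^o R^o (fun y : R => y^-1 ^+ n * expR (- y^-1))).
    near=> y; rewrite /flat ifT//; near: y; exact: lt_nbhsr.
  have xN0 : x != 0 by rewrite gt_eqF.
  have dV : is_derive x 1 (fun y : R => y^-1) (- x ^- 2 * 1).
    exact: (@is_deriveV _ (fun y => y) x 1 1 xN0 (is_derive_id _ _)).
  have dN : is_derive x 1 (fun y : R => - y^-1) (- (- x ^- 2 * 1)) by exact: is_deriveN.
  have dE : is_derive x 1 (fun y : R => expR (- y^-1)) (expR (- x^-1) * - (- x ^- 2 * 1)).
    exact: (@is_derive1_comp _ expR (fun y => - y^-1)).
  have dX : is_derive x 1 (fun y : R => y^-1 ^+ n) (n%:R * x^-1 ^+ n.-1 * (- x ^- 2 * 1)).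
    elim: (n) => [|m IH].
      by rewrite !mul0r; exact: is_derive_cst.
    have h := is_deriveM dV IH.
    rewrite (_ : (fun y => _) = (fun y => y^-1 * y^-1 ^+ m)); last first.
      by apply/funext => y; rewrite exprS.
    apply: is_derive_eq h _; rewrite /GRing.scale/=.
    by case: m {IH} => [|m]; rewrite -?natr1 ?exprS /=; ring.
  have h := is_deriveM dX dE.
  apply: is_derive_eq h _.
  rewrite /flat x0 /GRing.scale/= -exprVn.
  by case: n {dX} => [|n]; rewrite /= ?exprS; ring.
- have -> : flat n.+2 0 - n%:R * flat n.+1 0 = 0 :> R by rewrite /flat ltxx mulr0 subr0.
  apply: (@is_derive0_quadratic _ n.+2`!%:R); first by rewrite /flat ltxx.
  exact: flat_le.
Unshelve. all: by end_near.
Qed.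

(** The shape [f - c * g] is that of the derivative in [is_derive_flat], so this span is closed
    under differentiation. *)
Inductive flat_span : (R -> R) -> Prop :=
| flat_span_base n : flat_span (flat n)
| flat_span_comb f g c : flat_span f -> flat_span g -> flat_span (fun x => f x - c * g x).

Lemma smooth_flat : smooth (flat 0).
Proof.
suff h : forall f, flat_span f -> smooth f by exact/h/flat_span_base.
apply: smooth_coind => f; elim=> {f}[n|f g c _ [f' df sf] _ [g' dg sg]].
- exists (fun x => flat n.+2 x - n%:R * flat n.+1 x).
    by move=> x; exact: is_derive_flat.
  by apply: flat_span_comb; exact: flat_span_base.
- exists (fun x => f' x - c * g' x); last exact: flat_span_comb.
  move=> x; have h : is_derive (x : R) 1 (fun x => f x - c * g x) (f' x - (c * g' x + g x * 0)).
    by apply: is_deriveB; apply: is_deriveM.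
  by apply: is_derive_eq h _; rewrite mulr0 addr0.
Qed.

Definition bump (x : R) : R := flat 0 x * flat 0 (1 - x).

Lemma flat0_gt0 x : 0 < x -> 0 < flat 0 x.
Proof. by move=> x0; rewrite /flat x0 expr0 mul1r expR_gt0. Qed.
Lemma flat0_ge0 x : 0 <= flat 0 x.
Proof. by rewrite /flat; case: ifP => // _; rewrite expr0 mul1r expR_ge0. Qed.
Lemma flat0_le1 x : flat 0 x <= 1.
Proof.
rewrite /flat; case: ltP => // x0; rewrite expr0 mul1r expRN invf_le1 ?expR_gt0//.
by rewrite ltW// pexpR_gt1// invr_gt0.
Qed.
Lemma flat0_0 x : x <= 0 -> flat 0 x = 0.
Proof. by rewrite /flat ltNge => ->. Qed.

Lemma smooth_bump : smooth bump.
Proof.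
apply: smoothM; first exact: smooth_flat.
have := smooth_affine (a := -1) (b := 1) smooth_flat.
by under eq_fun do rewrite mulN1r addrC.
Qed.
Lemma bump_ge0 x : 0 <= bump x.
Proof. by rewrite mulr_ge0 ?flat0_ge0. Qed.
Lemma bump_le1 x : bump x <= 1.
Proof. by rewrite mulr_ile1 ?flat0_ge0 ?flat0_le1. Qed.
Lemma bump_0 x : x <= 0 \/ 1 <= x -> bump x = 0.
Proof.
by case=> h; rewrite /bump; [rewrite (flat0_0 h) mul0r|rewrite [flat 0 (1 - x)]flat0_0 ?mulr0// subr_le0].
Qed.

Lemma RL1_bump : RL1 bump.
Proof.
apply: (@RL1_dom _ _ (\1_`[0, 1])); last exact: RL1_indic.
- exact: smooth_measurable smooth_bump.
- move=> x; rewrite ger0_norm ?bump_ge0// indicE.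
  have [|] := boolP (x \in `[0, 1]%classic); first by rewrite bump_le1.
  rewrite notin_setE/= in_itv/= => h; rewrite bump_0//.
  by have [|x0] := leP x 0; [left|right; rewrite leNgt; apply/negP => x1; apply: h; rewrite !ltW].
Qed.


(** * Smooth functions of compact support *)

(** Compact support in quantitative form. The radius [L] may be negative, hence the [|L|] in several
    proofs. *)
Definition csupp f := exists L : R, forall x, L < `|x| -> f x = 0.

Lemma is_derive_near0 f (x : R) : smooth f -> (\forall y \near x, f y = 0) -> derive1 f x = 0.
Proof.
move=> sf fx; have [_ <-] := smooth_is_derive x sf.
rewrite (@near_eq_derive _ R^o R^o f (fun=> 0))//.
exact: derive_cst.
Qed.

Lemma derive1_eq0_out f (a b : R) : smooth f -> (forall x, x < a \/ b < x -> f x = 0) ->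
  forall x, x < a \/ b < x -> derive1 f x = 0.
Proof.
move=> sf f0 x [h|h]; apply: is_derive_near0 => //; near=> y; apply: f0.
- by left; near: y; exact: lt_nbhsl.
- by right; near: y; exact: lt_nbhsr.
Unshelve. all: by end_near.
Qed.

Lemma csupp_ab f L : (forall x, L < `|x| -> f x = 0) -> forall x, x < - L \/ L < x -> f x = 0.
Proof. by move=> f0 x h; apply: f0 ; rewrite ltr_normr; case: h => h; apply/orP; [right|left]; lra. Qed.

Lemma csupp_derive1 f : smooth f -> csupp f -> csupp (derive1 f).
Proof.
move=> sf [L f0]; exists L => x xL.
apply: (derive1_eq0_out sf (csupp_ab f0)).
by move: xL; rewrite ltr_normr => /orP[]h; [right|left; lra].
Qed.

Lemma csupp_bounded f : smooth f -> csupp f -> exists2 M : R, 0 < M & forall x, `|f x| <= M.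
Proof.
move=> sf [L f0].
have cf : {within `[- `|L|, `|L|], continuous (fun x => `|f x|)}.
  apply: continuous_subspaceT => x; apply: continuous_comp; last exact: norm_continuous.
  exact: smooth_continuous.
have [|c _ hc] := @EVT_max _ (fun x => `|f x|) (- `|L|) `|L| _ cf.
  by rewrite (le_trans (y := 0))// oppr_le0.
exists (`|f c| + 1); first by rewrite ltr_wpDl.
move=> x; have [xL|xL] := leP `|x| `|L|.
  by rewrite (le_trans (hc x _)) ?lerDl// in_itv/= -ler_norml.
by rewrite f0 ?normr0 ?addr_ge0// (le_lt_trans (ler_norm _) xL).
Qed.

Lemma RL1_csupp f : smooth f -> csupp f -> RL1 f.
Proof.
move=> sf cf; have [M M0 fM] := csupp_bounded sf cf.
case: cf => L f0.
apply: (@RL1_dom _ _ (fun x => M * \1_`[- L, L] x)); last exact/RL1Zl/RL1_indic.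
- exact: smooth_measurable.
- move=> x; rewrite indicE; have [h|] := boolP (x \in `[- L, L]%classic).
    by rewrite mulr1.
  rewrite notin_setE/= in_itv/= -ler_norml => /negP; rewrite -ltNge => h.
  by rewrite f0// normr0 mulr0.
Qed.

Lemma RInt_derive1 f : smooth f -> csupp f -> RInt (derive1 f) = 0.
Proof.
move=> sf cf; have sf' := smooth_derive1 sf; have ctf := smooth_continuous sf.
have [L f0] := cf.
pose K := `|L| + 1.
have LK x : K <= `|x| -> f x = 0.
  by move=> h; apply: f0; rewrite (le_lt_trans (ler_norm L))// (lt_le_trans _ h)// ltrDl.
have K0 : 0 < K by rewrite ltr_wpDl.
have -> : RInt (derive1 f) = Rintegral (@lebesgue_measure R) `[- K, K] (derive1 f).
  rewrite RInt_restrict; congr RInt; apply/funext => x; rewrite patchE.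
  case: ifPn => //; rewrite notin_setE/= in_itv/= -ler_norml => /negP; rewrite -ltNge => h.
  apply: (derive1_eq0_out sf (csupp_ab f0)).
  have : L < `|x| by rewrite (le_lt_trans (ler_norm L))// (lt_trans _ h)// ltrDl.
  by rewrite ltr_normr => /orP[]h'; [right|left; lra].
rewrite /Rintegral (@continuous_FTC2 _ (derive1 f) f).
- by rewrite -EFinB /= !LK ?subrr// ?normrN ger0_norm// ltW.
- by rewrite gtrN.
- by apply: continuous_subspaceT => x; exact: smooth_continuous.
- split.
  + by move=> x _; exact: smooth_derivable.
  + by apply: cvg_at_right_filter; exact: ctf.
  + by apply: cvg_at_left_filter; exact: ctf.
- by [].
Qed.

(** By monotonicity of [flat 0], both factors of [bump] are at least [flat 0 (1 / 4)] on
    [[1/4, 3/4]]. *)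
Lemma RInt_bump_gt0 : 0 < RInt bump.
Proof.
have m0 : 0 < flat 0 (1 / 4) * flat 0 (1 / 4) :> R by rewrite mulr_gt0// flat0_gt0.
apply: (@lt_le_trans _ _ (RInt (fun x => (flat 0 (1 / 4) * flat 0 (1 / 4)) * \1_`[1 / 4, 3 / 4] x))).
  rewrite RIntZl; last exact: RL1_indic.
  rewrite RInt_indic; lra.
apply: RInt_le; [exact/RL1Zl/RL1_indic|exact: RL1_bump|move=> x].
have flat_nd (u v : R) : 0 < u -> u <= v -> flat 0 u <= flat 0 v.
  move=> u0 uv; rewrite /flat u0 (lt_le_trans u0 uv) !expr0 !mul1r ler_expR lerN2.
  by rewrite lef_pV2// posrE// (lt_le_trans u0).
rewrite indicE; have [|_] := boolP (x \in `[1 / 4, 3 / 4]%classic).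
  rewrite inE/= in_itv/= => /andP[x1 x2]; rewrite mulr1 /bump.
  by apply: ler_pM; rewrite ?flat0_ge0//; apply: flat_nd; lra.
by rewrite mulr0 bump_ge0.
Qed.

(** The normalized primitive of [bump] passes smoothly from 0 on the negative axis to 1 beyond 1.
    Differences of its translates will give partitions of unity, products will give plateaus. *)
Definition step (x : R) : R :=
  (RInt bump)^-1 * Rintegral (@lebesgue_measure R) `]-oo, x] bump.

Lemma smooth_step : smooth step.
Proof.
apply: (@smooth_intro _ (fun x => (RInt bump)^-1 * bump x) _ (@smoothZ _ _ smooth_bump)).
move=> x.
have ib : (@lebesgue_measure R).-integrable `]-oo, (x + 1)] (EFin \o bump).
  by apply: (integrableS measurableT) => //; exact: RL1_bump.
have [] := @continuous_FTC1 R bump (BInfty R true) x (x + 1) _ ib _ (smooth_continuous smooth_bump (x := x)).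
- by rewrite ltrDl.
- by rewrite ltNyr.
move=> d1 d2.
have d : is_derive x 1 (fun x => Rintegral (@lebesgue_measure R) `]-oo, x] bump) (bump x).
  by apply: (DeriveDef d1); rewrite -derive1E; exact d2.
have h := is_deriveM (is_derive_cst ((RInt bump)^-1) x 1) d.
by apply: is_derive_eq h _; rewrite /GRing.scale/= mulr0 addr0.
Qed.

Lemma stepE x : step x = (RInt bump)^-1 * RInt (bump \_ `]-oo, x]).
Proof. by rewrite /step RInt_restrict. Qed.

Lemma step_0 x : x <= 0 -> step x = 0.
Proof.
move=> x0; rewrite stepE (_ : _ \_ _ = fun=> 0) ?RInt0 ?mulr0//; apply/funext => y.
rewrite patchE; case: ifPn => //; rewrite inE/= in_itv/= => yx.
by rewrite bump_0//; left; exact: le_trans x0.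
Qed.

Lemma step_1 x : 1 <= x -> step x = 1.
Proof.
move=> x1; rewrite stepE (_ : _ \_ _ = bump) ?mulVf ?gt_eqF ?RInt_bump_gt0//; apply/funext => y.
rewrite patchE; case: ifPn => //; rewrite notin_setE/= in_itv/= => /negP; rewrite -ltNge => yx.
by rewrite bump_0//; right; rewrite ltW// (le_lt_trans x1).
Qed.

End Smooth.

(** * Fourier transforms of test functions *)

Section TestFunctions.
Variable R : realType.
Implicit Types (f : R -> R) (phi chi : R -> R) (U : set R).

Definition tf phi := smooth phi /\ csupp phi.

Lemma test_fun_in U (K : set R) phi : smooth phi -> compact K ->
  (forall x, ~ K x -> phi x = 0) -> K `<=` U -> test_fun U phi.
Proof.
move=> sphi cK phi0 KU.
have cl : closed K by apply: compact_closed => //; exact: Rhausdorff.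
have sK : supp phi `<=` K.
  apply: (subset_trans (B := closure K)); last by rewrite -(closure_id K).1.
  apply: closure_subset => x /= /eqP; apply: contra_notP; exact: phi0.
split => //; split; last exact: subset_trans KU.
exact: (subclosed_compact (@closed_closure _ _) cK sK).
Qed.

Lemma test_fun_itv U phi (a b : R) : smooth phi ->
  (forall x, x < a \/ b < x -> phi x = 0) -> `[a, b] `<=` U -> test_fun U phi.
Proof.
move=> sphi phi0 abU; apply: (@test_fun_in _ `[a, b]) => //; first exact: segment_compact.
move=> x /=; rewrite in_itv/= => /negP; rewrite negb_and -!ltNge => /orP h.
exact: phi0.
Qed.

Lemma test_fun_supp U phi x : test_fun U phi -> phi x != 0 -> supp phi x.
Proof. by move=> _ h; apply: subset_closure. Qed.

Lemma test_funS U V phi : U `<=` V -> test_fun U phi -> test_fun V phi.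
Proof. by move=> UV [s [c h]]; split => //; split => //; exact: subset_trans UV. Qed.

Lemma test_fun_tf U phi : test_fun U phi -> tf phi.
Proof.
move=> [sphi [cphi _]]; split => //.
have /compact_bounded[M [_ hM]] := cphi.
exists (M + 1) => x xM; apply/eqP/negP => /negP h.
have : supp phi x by exact: subset_closure.
move=> /(hM (M + 1)); rewrite ltrDl ltr01 => /(_ isT) /= h2.
by move: xM; rewrite ltNge h2.
Qed.

Lemma test_funM U phi f : test_fun U phi -> smooth f -> test_fun U (fun x => phi x * f x).
Proof.
move=> [sphi [cphi h]] sf; have sm := smoothM sphi sf.
apply: (test_fun_in sm cphi) => // x nx; have -> : phi x = 0; last by rewrite mul0r.
apply/eqP/negP => /negP h2; apply: nx; exact: subset_closure.
Qed.

Lemma tf_test_fun phi : tf phi -> test_fun setT phi.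
Proof.
move=> [sphi [L phi0]]; apply: (@test_fun_itv _ _ (- L) L) => //.
exact: csupp_ab.
Qed.

Lemma tf_itv phi (a b : R) : smooth phi -> (forall x, x < a \/ b < x -> phi x = 0) -> tf phi.
Proof. by move=> sphi phi0; apply: (@test_fun_tf setT); exact: (test_fun_itv sphi phi0). Qed.

Lemma tfM phi f : tf phi -> smooth f -> tf (fun x => phi x * f x).
Proof.
move=> [sphi [L phi0]] sf; split; first exact: smoothM.
by exists L => x xL; rewrite phi0// mul0r.
Qed.

Lemma tf_derive1 phi : tf phi -> tf (derive1 phi).
Proof. by move=> [s c]; split; [exact: smooth_derive1|exact: csupp_derive1]. Qed.

Lemma tf_measurable phi : tf phi -> measurable_fun setT phi.
Proof. by move=> [s _]; exact: smooth_measurable. Qed.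

Lemma RL1_tf phi : tf phi -> RL1 phi.
Proof. by move=> [s c]; exact: RL1_csupp. Qed.

Lemma tf_bounded phi : tf phi -> exists2 M : R, 0 < M & forall x, `|phi x| <= M.
Proof. by move=> [s c]; exact: csupp_bounded. Qed.

Lemma CL1_tf phi (h : R -> R) : tf phi -> measurable_fun setT h ->
  CL1 (fun x => (phi x)%:C * cis (h x)).
Proof.
move=> tphi mh; apply: (CL1Mb (M := 2)).
- exact/CL1C/RL1_tf.
- exact: cmeas_cis.
- by move=> x; exact: n1_cis.
Qed.

Lemma fourierE phi t : fourier phi t = CInt (fun x => (phi x)%:C * cis (- (t * x))).
Proof.
rewrite /fourier -/(CInt _); congr CInt; apply/funext => x.
rewrite mulrC; congr (_ * _).
have -> : - ('i * (t * x)%:C) = 0 +i* (- (t * x)).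
  by apply: complex_ext; rewrite !cE /=; ring.
by rewrite /cexp /= expR0 !mul1r.
Qed.

Lemma CL1_fourier_integrand phi t : tf phi ->
  CL1 (fun x => (phi x)%:C * cis (- (t * x))).
Proof.
move=> tphi; apply: (CL1_tf (h := fun x => - (t * x))) => //.
by apply: measurable_funN; exact: measurable_funM.
Qed.

Lemma fourierD phi chi t : tf phi -> tf chi ->
  fourier (fun x => phi x + chi x) t = fourier phi t + fourier chi t.
Proof.
move=> h1 h2; rewrite !fourierE -CIntD; [|exact: CL1_fourier_integrand..].
by congr CInt; apply/funext => x; rewrite -mulrDl -rmorphD.
Qed.

Lemma fourier_mod phi (h t : R) :
  CInt (fun x => (phi x)%:C * cis (h * x) * cis (- (t * x))) = fourier phi (t - h).
Proof.
rewrite fourierE; congr CInt; apply/funext => x; rewrite -mulrA -cisD; congr (_ * cis _).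
by rewrite mulrBl opprB addrC.
Qed.

(** Test functions are real, so multiplication by [cis (h * x)] has to be split into two admissible
    parts; together they translate the transform by [h]. *)
Lemma fourier_cos_sin phi (h t : R) : tf phi ->
  fourier (fun x => phi x * cos (h * x)) t + 'i * fourier (fun x => phi x * sin (h * x)) t =
  fourier phi (t - h).
Proof.
move=> tphi; have t1 := tfM tphi (@smooth_cosM R h); have t2 := tfM tphi (@smooth_sinM R h).
rewrite -fourier_mod !fourierE -CIntZl; last exact: CL1_fourier_integrand.
rewrite -CIntD; [|exact: CL1_fourier_integrand|exact/CL1Zl/CL1_fourier_integrand].
congr CInt; apply/funext => x; rewrite mulrA -mulrDl; congr (_ * _).
by apply: complex_ext; rewrite !cE /=; ring.
Qed.

Lemma fourier_shift phi (t0 t : R) : tf phi ->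
  fourier (fun x => phi (x - t0)) t = cis (- (t * t0)) * fourier phi t.
Proof.
move=> tphi; rewrite !fourierE -CIntZl; last exact: CL1_fourier_integrand.
rewrite -[RHS](CInt_shift (- t0)); last exact/CL1Zl/CL1_fourier_integrand.
congr CInt; apply/funext => x; rewrite mulrCA -cisD; congr (_ * cis _); ring.
Qed.

Lemma fourier_scale phi (l t : R) : 0 < l -> tf phi ->
  fourier (fun x => phi (l * x)) t = (l^-1)%:C * fourier phi (l^-1 * t).
Proof.
move=> l0 tphi; rewrite !fourierE.
have ln0 : l != 0 by rewrite gt_eqF.
have := CInt_affine 0 ln0 (CL1_fourier_integrand (l^-1 * t) tphi).
rewrite gtr0_norm// => <-; congr CInt; apply/funext => x; rewrite addr0.
by congr (_ * cis (- _)); rewrite mulrACA mulVf// mul1r.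
Qed.

(** Integration by parts, in the form that the derivatives of [phi * cos] and [phi * sin] have
    integral 0. *)
Lemma fourier_derive1 phi t : tf phi ->
  fourier (derive1 phi) t = 'i * t%:C * fourier phi t.
Proof.
move=> tphi; have td := tf_derive1 tphi.
have t1 := tfM tphi (@smooth_cosM R t); have t2 := tfM tphi (@smooth_sinM R t).
have dc x : is_derive (x : R) 1 (fun x => cos (t * x)) (- t * sin (t * x)).
  have := @is_derive_comp_affine R cos t 0 x (- sin (t * x + 0)) (is_derive_cos _).
  by rewrite addr0 mulrN mulNr; under eq_fun do rewrite addr0.
have ds x : is_derive (x : R) 1 (fun x => sin (t * x)) (t * cos (t * x)).
  have := @is_derive_comp_affine R sin t 0 x (cos (t * x + 0)) (is_derive_sin _).
  by rewrite addr0; under eq_fun do rewrite addr0.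
have e1 : derive1 (fun x => phi x * cos (t * x)) =
    fun x => derive1 phi x * cos (t * x) - t * (phi x * sin (t * x)).
  have [_ ->] := is_derive_all (fun x => is_deriveM (smooth_is_derive x tphi.1) (dc x)).
  by apply/funext => x; rewrite /GRing.scale/=; ring.
have e2 : derive1 (fun x => phi x * sin (t * x)) =
    fun x => derive1 phi x * sin (t * x) + t * (phi x * cos (t * x)).
  have [_ ->] := is_derive_all (fun x => is_deriveM (smooth_is_derive x tphi.1) (ds x)).
  by apply/funext => x; rewrite /GRing.scale/=; ring.
have i1 : RL1 (fun x => derive1 phi x * cos (t * x)) by exact/RL1_tf/tfM/smooth_cosM.
have i2 : RL1 (fun x => derive1 phi x * sin (t * x)) by exact/RL1_tf/tfM/smooth_sinM.
have := RInt_derive1 t1.1 t1.2; have := RInt_derive1 t2.1 t2.2.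
rewrite e1 e2 RIntB//; last exact/RL1Zl/RL1_tf.
rewrite RIntD//; last exact/RL1Zl/RL1_tf.
rewrite !RIntZl; [|exact: RL1_tf..].
move=> h2 h1.
have E (f : R -> R) : tf f -> CInt (fun x => (f x)%:C * cis (- (t * x))) =
    (RInt (fun x => f x * cos (t * x))) +i* (- RInt (fun x => f x * sin (t * x))).
  move=> tff; apply: complex_ext.
  - by rewrite ReCInt -[RHS]/(RInt _); congr RInt; apply/funext => x; rewrite !cE /= cosN; ring.
  - rewrite ImCInt -[RHS]/(- RInt _) -mulN1r -RIntZl; last exact/RL1_tf/tfM/smooth_sinM.
    congr RInt; apply/funext => x; rewrite !cE /= sinN; ring.
have alg (D1 D2 C S : R) : D2 + t * C = 0 -> D1 - t * S = 0 ->
    D1 +i* (- D2) = 'i * t%:C * (C +i* (- S)).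
  move=> q1 q2.
  by apply: complex_ext; rewrite !cE !xE; lra.
by rewrite !fourierE !E//; exact: alg.
Qed.

Lemma fourier_bound phi (a b A t : R) : a <= b -> measurable_fun setT phi ->
  (forall x, x < a \/ b < x -> phi x = 0) -> (forall x, `|phi x| <= A) ->
  n1 (fourier phi t) <= 2 * A * (b - a).
Proof.
move=> ab mphi phi0 phiA; rewrite fourierE.
rewrite -RInt_indic// -RIntZl; last exact: RL1_indic.
apply: n1_CInt_dom; last exact/RL1Zl/RL1_indic.
- apply: cmeasM; first exact: cmeasC.
  by apply: cmeas_cis; apply: measurable_funN; exact: measurable_funM.
- move=> x; rewrite n1CM indicE.
  have [_|] := boolP (x \in `[a, b]%classic).
    by rewrite mulr1 mulrC ler_pM// ?n1_ge0// n1_cis.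
  rewrite notin_setE/= in_itv/= => /negP; rewrite negb_and -!ltNge => /orP h.
  by rewrite phi0// normr0 mul0r mulr0.
Qed.

(** The bounds for the transforms of [phi] and of [e ^+ 2] times its second derivative are added.
    The scale [e] is free: it is 1 for a fixed test function, and the cutting scale for localized
    pieces. *)
Lemma fourier_decay phi (a b A B e t : R) : a <= b -> smooth phi ->
  (forall x, x < a \/ b < x -> phi x = 0) -> (forall x, `|phi x| <= A) ->
  (forall x, `|derive1 (derive1 phi) x| <= B) ->
  n1 (fourier phi t) * (1 + (e * t) ^+ 2) <= 2 * (A + e ^+ 2 * B) * (b - a).
Proof.
move=> ab sphi phi0 phiA phiB.
have tphi : tf phi by exact: tf_itv phi0.
have h1 := fourier_bound t ab (smooth_measurable sphi) phi0 phiA.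
have sphi1 := smooth_derive1 sphi.
have phi1 := derive1_eq0_out sphi phi0.
have h2 := fourier_bound t ab (smooth_measurable (smooth_derive1 sphi1))
  (derive1_eq0_out sphi1 phi1) phiB.
have E : n1 (fourier (derive1 (derive1 phi)) t) = t ^+ 2 * n1 (fourier phi t).
  rewrite !fourier_derive1//; last exact: tf_derive1.
  have -> : 'i * t%:C * ('i * t%:C * fourier phi t) = (- (t ^+ 2))%:C * fourier phi t.
    by apply: complex_ext; rewrite !cE /=; ring.
  by rewrite n1CM normrN ger0_norm// sqr_ge0.
rewrite E in h2.
have e2 : 0 <= e ^+ 2 by exact: sqr_ge0.
rewrite mulrDr mulr1 exprMn mulrCA [_ * t ^+ 2]mulrC.
have := ler_wpM2l e2 h2; lra.
Qed.

Definition weight (x : R) : R := (1 + x ^+ 2)^-1.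

Lemma weight_gt0 x : 0 < weight x.
Proof. by rewrite invr_gt0 ltr_pwDl// sqr_ge0. Qed.

Lemma continuous_weight : continuous weight.
Proof. exact: (@continuous_oneDsqrV R). Qed.

Lemma measurable_weight : measurable_fun setT weight.
Proof. by apply: continuous_measurable_fun; exact: continuous_weight. Qed.

Lemma RL1_weight : RL1 weight.
Proof.
apply/integrableP; split; first by apply/measurable_EFinP; exact: measurable_weight.
rewrite (_ : (fun x => `|_|%E) = fun x => (weight x)%:E); last first.
  by apply/funext => x; rewrite /= gtr0_norm// weight_gt0.
rewrite ge0_symfun_integralT//; last 3 first.
- by move=> x; exact/ltW/weight_gt0.
- exact: continuous_weight.
- by move=> x; rewrite /weight /= sqrrN.
have -> : [set x : R | 0 <= x] = `[0, +oo[%classic.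
  by apply/seteqP; split => x /=; rewrite in_itv/= andbT.
have := @integral0y_oneDsqr R; rewrite /oneDsqr => ->.
by rewrite -EFinM ltry.
Qed.

Lemma RInt_weight_ge0 : 0 <= RInt weight.
Proof. by apply: RInt_ge0 => x; exact/ltW/weight_gt0. Qed.

Lemma fourier_weight phi : tf phi ->
  exists2 C : R, 0 < C & forall t, n1 (fourier phi t) <= C * weight t.
Proof.
move=> tphi; have [L phi0] := tphi.2.
have [A A0 phiA] := tf_bounded tphi.
have [B B0 phiB] := tf_bounded (tf_derive1 (tf_derive1 tphi)).
have phi0' x : x < - `|L| \/ `|L| < x -> phi x = 0.
  move=> h; apply: (csupp_ab phi0); have := ler_norm L; have := ler_norm (- L).
  by rewrite normrN; case: h => h; [left|right]; lra.
exists (2 * (A + 1 ^+ 2 * B) * (`|L| - - `|L|) + 1).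
  by rewrite ltr_wpDl// !mulr_ge0//; have := normr_ge0 L; rewrite ?expr1n; lra.
move=> t; rewrite ler_pdivlMr ?ltr_pwDl ?sqr_ge0//.
have := @fourier_decay phi _ _ A B 1 t _ tphi.1 phi0' phiA phiB.
rewrite mul1r => h; rewrite (le_trans (h _))//; first by have := normr_ge0 L; lra.
by rewrite lerDl.
Qed.

Lemma cmeas_fourier phi : tf phi -> cmeas (fun t => fourier phi t).
Proof.
move=> tphi.
rewrite (_ : (fun t => _) = fun t => CInt (fun x => (phi x)%:C *
  (fun z : R * R => cis (- (z.1 * z.2))) (t, x))); last by apply/funext => t; rewrite fourierE.
apply: (@cmeas_kernel R (fun x => (phi x)%:C) (fun z : R * R => cis (- (z.1 * z.2))) 2).
- exact/CL1C/RL1_tf.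
- apply: cmeas_cis; apply: measurable_funN; apply: measurable_funM.
  + exact: measurable_fst.
  + exact: measurable_snd.
- by move=> z; exact: n1_cis.
Qed.

Lemma CL1_fourier phi : tf phi -> CL1 (fun t => fourier phi t).
Proof.
move=> tphi; have [C _ h] := fourier_weight tphi.
apply: (CL1_dom (cmeas_fourier tphi) h); exact/RL1Zl/RL1_weight.
Qed.

(** [fourier_decay] is integrated against the weight dilated by [e], whose integral is
    [e^-1 * RInt weight]. *)
Lemma fourier_L1 phi (a b A B e : R) : 0 < e -> a <= b -> smooth phi ->
  (forall x, x < a \/ b < x -> phi x = 0) -> (forall x, `|phi x| <= A) ->
  (forall x, `|derive1 (derive1 phi) x| <= B) ->
  RInt (fun t => n1 (fourier phi t)) <= 2 * (A + e ^+ 2 * B) * (b - a) * (e^-1 * RInt weight).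
Proof.
move=> e0 ab sphi phi0 phiA phiB.
have tphi : tf phi by exact: tf_itv phi0.
have en0 : e != 0 by rewrite gt_eqF.
have wa := RL1_affine 0 en0 RL1_weight.
rewrite -[e^-1](gtr0_norm (x := e^-1)) ?invr_gt0// normfV -(RInt_affine 0 en0 RL1_weight).
rewrite -RIntZl//; apply: RInt_le.
- exact/RL1_n1/CL1_fourier.
- exact: RL1Zl.
- move=> t; rewrite addr0 ler_pdivlMr ?ltr_pwDl ?sqr_ge0//; exact: fourier_decay.
Qed.

End TestFunctions.

(** * Correlations of test functions and their Fourier transforms *)

Section Autocorrelation.
Variable R : realType.
Implicit Types (chi f : R -> R).

Definition corr chi f (x : R) : R := RInt (fun y => chi y * f (y + x)).

Lemma is_derive_corr chi f : tf chi -> tf f ->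
  forall x, is_derive (x : R) 1 (corr chi f) (corr chi (derive1 f) x).
Proof.
move=> tchi tff x.
have [M M0 fM] := tf_bounded (tf_derive1 tff).
have tfs (g : R -> R) z : tf g -> tf (fun y => chi y * g (y + z)).
  move=> tg; apply: tfM => //.
  by have := @smooth_affine _ _ 1 z tg.1; under eq_fun do rewrite mul1r.
pose F (z y : R) := chi y * f (y + z).
have dF z y : is_derive (z : R) 1 (F ^~ y) (chi y * derive1 f (y + z)).
  have h1 : is_derive (1 * z + y) 1 f (derive1 f (y + z)).
    by rewrite mul1r addrC; exact: smooth_is_derive tff.1.
  have h2 := is_derive_comp_affine h1.
  have h3 := is_deriveM (is_derive_cst (chi y) z 1) h2.
  rewrite (_ : F ^~ y = (cst (chi y)) \* (fun z => f (1 * z + y))); last first.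
    by apply/funext => w; rewrite /F /= mul1r addrC.
  apply: is_derive_eq h3 _.
  by rewrite /GRing.scale/= mulr0 addr0 mul1r.
have d1 z y : partial1of2 F z y = chi y * derive1 f (y + z).
  by rewrite /partial1of2; have [_ ->] := is_derive_all (fun z => dF z y).
have Ix : `]x - 1, x + 1[%classic x by rewrite /= in_itv/=; apply/andP; split; lra.
have iF z : `]x - 1, x + 1[%classic z -> (@lebesgue_measure R).-integrable setT (EFin \o F z).
  by move=> _; exact: (RL1_tf (tfs f z tff)).
have derF z y : `]x - 1, x + 1[%classic z -> setT y -> derivable (F ^~ y) z 1.
  by move=> _ _; have [] := dF z y.
have G0 y : 0 <= M * `|chi y| by rewrite mulr_ge0// ltW.
have iG : (@lebesgue_measure R).-integrable setT (EFin \o (fun y => M * `|chi y|)).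
  exact: (RL1Zl M (RL1_norm (RL1_tf tchi))).
have GF z y : `]x - 1, x + 1[%classic z -> setT y -> `|partial1of2 F z y| <= M * `|chi y|.
  by move=> _ _; rewrite d1 normrM mulrC ler_wpM2r.
apply: DeriveDef; first exact: (derivable_under_integral measurableT Ix iF derF G0 iG GF).
rewrite -derive1E.
have := differentiation_under_integral measurableT Ix iF derF G0 iG GF.
rewrite /corr /RInt => ->; congr Rintegral; apply/funext => y; exact: d1.
Qed.

Lemma smooth_corr chi f : tf chi -> tf f -> smooth (corr chi f).
Proof.
move=> tchi tff.
apply: (@smooth_coind R (fun h => exists2 g, tf g & h = corr chi g)); last by exists f.
move=> _ [g tg ->]; exists (corr chi (derive1 g)); first exact: is_derive_corr.
by exists (derive1 g) => //; exact: tf_derive1.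
Qed.

Lemma corr_out chi f (l x : R) : (forall x, l < `|x| -> chi x = 0) -> (forall x, l < `|x| -> f x = 0) ->
  2 * l < `|x| -> corr chi f x = 0.
Proof.
move=> chi0 f0 lx; rewrite /corr -[RHS](RInt0 R); congr RInt; apply/funext => y.
have [yl|yl] := leP `|y| l; last by rewrite chi0// mul0r.
rewrite f0 ?mulr0//.
have := ler_normB (y + x) y; rewrite [y + x]addrC addrK addrC; lra.
Qed.

Lemma tf_corr chi f (l : R) : tf chi -> tf f ->
  (forall x, l < `|x| -> chi x = 0) -> (forall x, l < `|x| -> f x = 0) -> tf (corr chi f).
Proof.
move=> tchi tff chi0 f0; split; first exact: smooth_corr.
by exists (2 * l) => x; exact: corr_out.
Qed.

(** An autocorrelation is the convolution of [chi] with its reflection, so its transform is a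
    squared modulus. The indicator of [[- (2 * l), 2 * l]], outside which the autocorrelation
    vanishes, supplies the integrable outer factor for the exchange of integrals. *)
Lemma fourier_corr chi (l t : R) : tf chi -> (forall x, l < `|x| -> chi x = 0) ->
  fourier (corr chi chi) t =
  ((complex.Re (fourier chi t)) ^+ 2 + (complex.Im (fourier chi t)) ^+ 2)%:C.
Proof.
move=> tchi chi0.
have [M M0 chiM] := tf_bounded tchi.
have mchi := tf_measurable tchi.
have tsh (z : R) : tf (fun y => chi y * chi (y + z)).
  by apply: tfM => //; have := @smooth_affine _ _ 1 z tchi.1; under eq_fun do rewrite mul1r.
pose c (z : R * R) : R[i] := (chi (z.2 + z.1))%:C * cis (- (t * z.1)).
have mc : cmeas c.
  apply: cmeasM.
    apply: cmeasC; apply: measurableT_comp => //; apply: measurable_funD.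
    - exact: measurable_snd.
    - exact: measurable_fst.
  apply: cmeas_cis; apply: measurable_funN; apply: measurable_funM => //; exact: measurable_fst.
have cM z : n1 (c z) <= M * 2.
  by rewrite /c n1CM ler_pM ?n1_ge0 ?n1_cis.
pose a : R -> R[i] := fun x => (\1_`[- (2 * l), 2 * l] x)%:C.
have ia : CL1 a by apply: CL1C; exact: RL1_indic.
have ib : CL1 (fun y => (chi y)%:C) by exact/CL1C/RL1_tf.
have notin (x : R) : x \notin `[- (2 * l), 2 * l]%classic -> 2 * l < `|x|.
  by rewrite notin_setE/= in_itv/= -ler_norml => /negP; rewrite -ltNge.
have := CFubini_kernel ia ib mc cM.
have -> : CInt (fun x => a x * CInt (fun y => (chi y)%:C * c (x, y))) = fourier (corr chi chi) t.
  rewrite fourierE; congr CInt; apply/funext => x.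
  have -> : CInt (fun y => (chi y)%:C * c (x, y)) = (corr chi chi x)%:C * cis (- (t * x)).
    rewrite -CIntC -CIntZr; last by apply: CL1C; exact: RL1_tf.
    by congr CInt; apply/funext => y; rewrite /c /= mulrA -rmorphM.
  rewrite /a indicE; have [_|/notin h] := boolP (x \in _); first by rewrite mul1r.
  by rewrite mul0r (corr_out chi0 chi0)// mul0r.
move=> ->.
have inner y : (chi y)%:C * CInt (fun x => a x * c (x, y)) =
    fourier chi t * ((chi y)%:C * cis (t * y)).
  have [yl|yl] := leP `|y| l; last by rewrite chi0// !mul0r mulr0.
  rewrite mulrCA; congr (_ * _).
  rewrite fourierE mulrC -CIntZl; last exact: CL1_fourier_integrand.
  rewrite -[RHS](CInt_shift y); last exact/CL1Zl/CL1_fourier_integrand.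
  congr CInt; apply/funext => x.
  rewrite /a /c /= indicE [x + y]addrC.
  have [_|/notin h] := boolP (x \in _).
    rewrite mul1r mulrCA -cisD; congr (_ * cis _); ring.
  rewrite mul0r chi0 ?mul0r ?mulr0//.
  have := ler_normB (y + x) y; rewrite [y + x]addrC addrK addrC; lra.
under [X in CInt X]eq_fun do rewrite inner.
have mt : measurable_fun setT (fun y : R => t * y) by exact: measurable_funM.
rewrite CIntZl; last exact: CL1_tf.
have -> : CInt (fun y => (chi y)%:C * cis (t * y)) =
    complex.Re (fourier chi t) +i* (- complex.Im (fourier chi t)).
  rewrite fourierE; apply: complex_ext => /=.
  - congr Rintegral; apply/funext => y; rewrite !mul0r !subr0 cosN; ring.
  - rewrite -[LHS]/(RInt _) -[X in - X]/(RInt _) -mulN1r -RIntZl.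
      by congr RInt; apply/funext => y; rewrite !mul0r !addr0 sinN; ring.
    exact: RL1_Im (CL1_fourier_integrand t tchi).
by apply: complex_ext; rewrite !cE /=; ring.
Qed.

End Autocorrelation.

(** * Boundedness and limits from averages *)

Section RealTauberian.
Variable R : realType.
Local Notation mu := (@lebesgue_measure R).
Implicit Types (r k f g : R -> R).

Lemma RL1_shift f (b : R) : RL1 f -> RL1 (fun x => f (x + b)).
Proof. by move=> f1; have := RL1_affine b (oner_neq0 R) f1; under eq_fun do rewrite mul1r. Qed.

Lemma RInt_shift f (b : R) : RL1 f -> RInt (fun x => f (x + b)) = RInt f.
Proof.
move=> f1; have := RInt_affine b (oner_neq0 R) f1; under eq_fun do rewrite mul1r.
by rewrite normr1 invr1 mul1r.
Qed.

Lemma RInt_shiftE f g (b : R) : RL1 f -> (forall x, g x = f (x + b)) ->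
  RL1 g /\ RInt g = RInt f.
Proof.
by move=> f1 /funext ->; split; [exact: RL1_shift|exact: RInt_shift].
Qed.

Lemma RL1_flip f : RL1 f -> RL1 (fun x => f (- x)).
Proof.
have n10 : (-1 : R) != 0 by rewrite oppr_eq0 oner_neq0.
by move=> f1; have := RL1_affine 0 n10 f1; under eq_fun do rewrite mulN1r addr0.
Qed.

Lemma RInt_flip f : RL1 f -> RInt (fun x => f (- x)) = RInt f.
Proof.
have n10 : (-1 : R) != 0 by rewrite oppr_eq0 oner_neq0.
move=> f1; have := RInt_affine 0 n10 f1; under eq_fun do rewrite mulN1r addr0.
by rewrite normrN normr1 invr1 mul1r.
Qed.

Lemma RInt_fatou (f_ : nat -> R -> R) f (B : R) :
  (forall n, RL1 (f_ n)) -> (forall n x, 0 <= f_ n x) ->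
  (forall x, f_ ^~ x @ \oo --> f x) -> (forall n, RInt (f_ n) <= B) -> RL1 f.
Proof.
move=> f1 f0 ff fB.
have mf n := RL1_meas (f1 n).
have mf' : measurable_fun setT f.
  by apply: (measurable_fun_cvg (h := f_)) => // x _; exact: ff.
have fge0 x : 0 <= f x.
  have h := ff x; rewrite -(cvg_lim _ h)//; apply: limr_ge; first by apply/cvg_ex; eexists; exact: h.
  exact: nearW.
apply/integrableP; split; first exact/measurable_EFinP.
apply: (@le_lt_trans _ _ B%:E); last by rewrite ltry.
have E x : limn_einf (fun n => (f_ n x)%:E) = (f x)%:E.
  have h : (fun n => (f_ n x)%:E) @ \oo --> (f x)%:E.
    by apply: cvg_EFin; [exact: nearW|exact: ff].
  rewrite is_cvg_limn_einfE; last by apply/cvg_ex; eexists; exact: h.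
  exact: cvg_lim h.
rewrite (_ : (fun x => `|_|%E) = (fun x => limn_einf (fun n => (f_ n x)%:E))); last first.
  by apply/funext => x; rewrite E /= ger0_norm.
apply: (le_trans (@fatou _ _ _ mu setT measurableT (fun n x => (f_ n x)%:E) _ _)).
- by move=> n; apply: (measurable_EFinP _ _).2; exact: mf.
- by move=> n x _; rewrite lee_fin.
rewrite limn_einf_lim; apply: lime_le; first exact: is_cvg_einfs.
apply: nearW => n; apply: (@le_trans _ _ (\int[mu]_x (f_ n x)%:E)%E).
  by apply: ereal_inf_lbound; exists n => /=.
by rewrite -RIntE// lee_fin.
Qed.

Lemma RL1_big f (a : R) : RL1 f -> RL1 (fun x => f x * \1_[set y | a < `|y|] x).
Proof.
move=> f1.
rewrite (_ : (fun x => f x * _) = fun x => \1_[set y : R | a < `|y|] x * f x); last first.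
  by apply/funext => x; rewrite mulrC.
apply: (@RL1M _ f (\1_[set y : R | a < `|y|]) 1 f1).
- apply: measurable_indic; have -> : [set y : R | a < `|y|] = (fun y : R => `|y|) @^-1` `]a, +oo[.
    by apply/seteqP; split => x /=; rewrite in_itv/= andbT.
  by rewrite -[X in measurable X]setTI; apply: normr_measurable.
- by move=> x; rewrite indicE; case: (_ \in _); rewrite /= ?normr1 ?normr0.
Qed.

Lemma RInt_tail f : RL1 f ->
  (fun a => RInt (fun x => f x * \1_[set y | a < `|y|] x)) @ +oo --> (0 : R).
Proof.
move=> f1; rewrite -(RInt0 R).
apply: (@RInt_cvg_pinfty _ _ _ (fun x => `|f x|)).
- by move=> a; apply: RL1_meas; exact: RL1_big.
- exact: RL1_norm.
- by move=> a x; rewrite indicE normrM; case: (_ \in _); rewrite /= ?normr1 ?normr0 ?mulr1 ?mulr0.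
- move=> x; apply: cvg_near_cst; near=> a.
  rewrite indicE memNset ?mulr0//=.
  by apply/negP; rewrite -leNgt; near: a; exact: nbhs_pinfty_ge.
Unshelve. all: by end_near.
Qed.

Let const_ge0 (C M a kk m : R) : 0 <= C -> 0 <= M -> 0 <= a -> 0 < kk -> 0 <= m ->
  0 <= C + M * ((1 + a) * kk + m).
Proof.
move=> C0 M0 a0 kk0 m0; apply: addr_ge0 => //; apply: mulr_ge0 => //.
by apply: addr_ge0 => //; apply: mulr_ge0; [exact: addr_ge0|exact: ltW].
Qed.

(** The average of [r] about [y + a] is compared with [r y]. To the right of [y] the one-sided bound
    keeps [r] above [r y] minus a linear loss; to the left, where only the a priori bound of size
    [Q] is available, the kernel has little mass. The gain is the factor 1/4 in front of [Q], which
    lets the estimate improve the a priori bound. *)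
Lemma kernel_step r k (M C Q e a y : R) :
  0 <= M -> 0 <= Q -> 0 <= a -> 0 <= e <= 1 ->
  (forall x z, x <= z -> r x - M * (1 + (z - x)) <= r z) ->
  (forall x, 0 <= k x) -> RL1 k -> RL1 (fun x => `|x| * k x) ->
  (forall h, RL1 (fun x => r (x + h) * k x)) ->
  (forall h, RInt (fun x => r (x + h) * k x) <= C) -> 0 <= C ->
  (forall x, - (Q * (1 + e * `|x|)) <= r x) ->
  16 * RInt (fun x => (1 + `|x|) * k x * \1_[set z | a < `|z|] x) <= RInt k ->
  0 < RInt k ->
  r y <= 2 / RInt k * (C + M * ((1 + a) * RInt k + RInt (fun x => `|x| * k x))) +
         Q * (1 + e * `|y|) / 4.
Proof.
move=> M0 Q0 a0 /andP[e0 e1] rM k0 k1 k2 rk rkC C0 rQ.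
set T := RInt (fun x => _ * _ * _); set kk := RInt k; set m1 := RInt _ => Tk kk0.
have m10 : 0 <= m1 by apply: RInt_ge0 => x; rewrite mulr_ge0.
have ey : 0 <= e * `|y| by rewrite mulr_ge0.
have Qy : 0 <= Q * (1 + e * `|y|) by rewrite mulr_ge0// addr_ge0.
have [ry|ry] := leP (r y) 0.
  apply: (le_trans ry); apply: addr_ge0; last by rewrite divr_ge0.
  rewrite mulr_ge0//; first by rewrite divr_ge0// ltW.
  exact: const_ge0.
have ik : RL1 (fun x => (1 + `|x|) * k x).
  by have := RL1D k1 k2; under eq_fun do rewrite -{1}[k _]mul1r -mulrDl.
have iu := RL1_big a ik.
pose u x := (1 + `|x|) * k x * \1_[set z : R | a < `|z|] x.
(* On the tail the term with [u] cancels [r y * k x] and pays for the a priori bound, because there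
   [1 + e * |x + (y + a)| <= 2 * (1 + e * |y|) * (1 + |x|)]. *)
have pw x : r y * k x - (r y + 2 * (Q * (1 + e * `|y|))) * u x
    - M * ((1 + a) * k x) - M * (`|x| * k x) <= r (x + (y + a)) * k x.
  clear T kk m1 Tk kk0 m10; have kx := k0 x; have nx := normr_ge0 x.
  have [xa|xa] := leP (- a) x.
    have := rM y (x + (y + a)); rewrite (_ : x + (y + a) - y = x + a); last by ring.
    have yle : y <= x + (y + a) by lra.
    move=> /(_ yle) h.
    have u0 : 0 <= u x by rewrite mulr_ge0 ?mulr_ge0 ?addr_ge0// indicE; case: (_ \in _).
    have h2 : 0 <= (r y + 2 * (Q * (1 + e * `|y|))) * u x.
      by apply: mulr_ge0 => //; apply: addr_ge0; [exact: ltW|exact: mulr_ge0].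
    have h3 : r y - M * (1 + (x + a)) >= r y - M * (1 + a + `|x|).
      by rewrite lerD2l lerN2 ler_wpM2l//; have := ler_norm x; lra.
    have h4 := ler_wpM2r kx (le_trans h3 h).
    rewrite mulrBl in h4; lra.
  have xa' : a < `|x| by rewrite ltr_normr; apply/orP; right; lra.
  have uE : u x = (1 + `|x|) * k x by rewrite /u indicE mem_set ?mulr1.
  have h1 := rQ (x + (y + a)).
  have h2 : 1 + e * `|x + (y + a)| <= (1 + e * `|y|) * (2 * (1 + `|x|)).
    have := ler_normD x (y + a); have := ler_normD y a; rewrite (ger0_norm a0) => n2 n3.
    have n4 : `|x + (y + a)| <= `|y| + 2 * `|x| by lra.
    have n5 := ler_wpM2l e0 n4.
    have n6 : e * (2 * `|x|) <= 2 * `|x| by rewrite ler_piMl// mulr_ge0.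
    have n7 : 0 <= e * `|y| * (2 * `|x|) by rewrite mulr_ge0// mulr_ge0.
    lra.
  have h3 := ler_wpM2l Q0 h2.
  have h4 : - (Q * (1 + e * `|y|) * (2 * (1 + `|x|))) <= r (x + (y + a)) by lra.
  have h5 := ler_wpM2r kx h4.
  rewrite uE.
  have q1 : 0 <= r y * (`|x| * k x) by rewrite !mulr_ge0// ltW.
  have q2 : 0 <= M * ((1 + a) * k x) by rewrite !mulr_ge0// addr_ge0.
  have q3 : 0 <= M * (`|x| * k x) by rewrite !mulr_ge0.
  lra.
have i1 := RL1Zl (r y) k1.
have i2 := RL1Zl (r y + 2 * (Q * (1 + e * `|y|))) iu.
have i3 := RL1Zl M (RL1Zl (1 + a) k1).
have i4 := RL1Zl M k2.
have := RInt_le (RL1B (RL1B (RL1B i1 i2) i3) i4) (rk (y + a)) pw.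
rewrite (RIntB (RL1B (RL1B i1 i2) i3) i4) (RIntB (RL1B i1 i2) i3) (RIntB i1 i2).
rewrite (RIntZl _ k1) (RIntZl _ iu) (RIntZl _ (RL1Zl (1 + a) k1)) (RIntZl _ k1) (RIntZl _ k2).
rewrite -/kk -/m1 -/T => h; clearbody T kk m1.
have {}h := le_trans h (rkC (y + a)).
set Q' := Q * (1 + e * `|y|) in Qy h *.
set D := C + M * ((1 + a) * kk + m1).
have hD : r y * kk - (r y + 2 * Q') * T <= D by rewrite /D; lra.
have h2 : (r y + 2 * Q') * T <= (r y + 2 * Q') * (kk / 16).
  apply: ler_wpM2l; last by move: Tk; clear; lra.
  by apply: addr_ge0; [exact: ltW|exact: mulr_ge0].
have h3 : r y * kk * (15 / 16) <= D + Q' * kk / 8 by lra.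
have D0 : 0 <= D.
  exact: const_ge0.
have h4 : r y * kk <= 2 * D + Q' * kk / 4.
  have : 0 <= Q' * kk by rewrite mulr_ge0// ltW.
  lra.
rewrite -(ler_pM2r kk0) mulrDl (le_trans h4)// lerD//.
- by have -> : 2 / kk * D * kk = 2 * D by field; rewrite gt_eqF.
- by rewrite mulrAC.
Qed.

(* With [Q] the supremum of [`|r x| / (1 + e * `|x|)], [kernel_step] for [r] and its reflection gives
   [`|r x| <= D + Q * (1 + e * `|x|) / 4], hence [Q <= 2 * D] with [D] independent of [e]; let [e -> 0]. *)
Lemma kernel_bounded r k (M C : R) : 0 <= M ->
  (forall x, x < 0 -> r x = 0) ->
  (forall x z, x <= z -> r x - M * (1 + (z - x)) <= r z) ->
  (forall x, 0 <= k x) -> RL1 k -> RL1 (fun x => `|x| * k x) -> 0 < RInt k ->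
  (forall h, RL1 (fun x => r x * k (x - h))) ->
  (forall h, `|RInt (fun x => r x * k (x - h))| <= C) ->
  exists B, forall x, `|r x| <= B.
Proof.
move=> M0 r0 rM k0 k1 k2 kk0 rk rkC.
have sh h : RL1 (fun x => r (x + h) * k x) /\
    RInt (fun x => r (x + h) * k x) = RInt (fun x => r x * k (x - h)).
  by apply: (RInt_shiftE (b := h)) => // x; rewrite addrK.
have C0 : 0 <= C by rewrite (le_trans _ (rkC 0)).
have ik : RL1 (fun x => (1 + `|x|) * k x).
  by have := RL1D k1 k2; under eq_fun do rewrite -{1}[k _]mul1r -mulrDl.
have [a a0 aT] : exists2 a : R, 0 <= a &
    16 * RInt (fun x => (1 + `|x|) * k x * \1_[set z | a < `|z|] x) <= RInt k.
  have e0 : 0 < RInt k / 16 by rewrite divr_gt0.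
  have /cvgr0Pnorm_le /(_ _ e0) h1 := RInt_tail ik.
  have h2 : \forall a \near +oo, (0 : R) <= a by exact: nbhs_pinfty_ge.
  have [a [/= q1 q2]] := filter_ex (filterI h1 h2).
  by exists a => //; have := ler_norm (RInt (fun x => (1 + `|x|) * k x * \1_[set z | a < `|z|] x)); lra.
set D := 2 / RInt k * (C + M * ((1 + a) * RInt k + RInt (fun x => `|x| * k x))).
have D0 : 0 <= D.
  have m10 : 0 <= RInt (fun x => `|x| * k x) by apply: RInt_ge0 => x; rewrite mulr_ge0.
  rewrite mulr_ge0//; first by rewrite divr_ge0// ltW.
  exact: const_ge0.
have up Q e : 0 <= Q -> 0 <= e <= 1 -> (forall x, - (Q * (1 + e * `|x|)) <= r x) ->
    forall y, r y <= D + Q * (1 + e * `|y|) / 4.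
  move=> Q0 e01 rQ y; apply: kernel_step => //.
  - by move=> h; have [] := sh h.
  - by move=> h; have [_ ->] := sh h; rewrite (le_trans (ler_norm _)).
have dn Q e : 0 <= Q -> 0 <= e <= 1 -> (forall x, r x <= Q * (1 + e * `|x|)) ->
    forall y, - r y <= D + Q * (1 + e * `|y|) / 4.
  move=> Q0 e01 rQ y.
  have kf := RL1_flip k1; have k2f := RL1_flip k2.
  have ikf := RL1_flip (RL1_big a ik).
  have E1 := RInt_flip k1; have E2 := RInt_flip k2.
  have E3 := RInt_flip (RL1_big a ik).
  have N1 : (fun x : R => `|- x| * k (- x)) = (fun x => `|x| * k (- x)).
    by apply/funext => x; rewrite normrN.
  have N2 : (fun x : R => (1 + `|- x|) * k (- x) * \1_[set z : R | a < `|z|] (- x)) =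
            (fun x => (1 + `|x|) * k (- x) * \1_[set z | a < `|z|] x).
    apply/funext => x; rewrite normrN !indicE; congr (_ * (_ : bool)%:R).
    by apply/idP/idP; rewrite !inE /= normrN.
  have := @kernel_step (fun x => - r (- x)) (fun x => k (- x)) M C Q e a (- y) M0 Q0 a0 e01.
  rewrite E1 -N1 E2 -N2 E3 -/D opprK normrN; apply => //.
  - by move=> x z xz; have := rM (- z) (- x); rewrite lerN2 opprK => /(_ xz); rewrite [- x + z]addrC; lra.
  - move=> h; have [h1 _] := sh (- h); have := RL1_flip h1.
    by move=> /(RL1Zl (-1)); under eq_fun do rewrite mulN1r -mulNr -opprD.
  - move=> h; have [h1 h2] := sh (- h); have h3 := RL1_flip h1; have h4 := RInt_flip h1.
    have -> : RInt (fun x => - r (- (x + h)) * k (- x)) = - RInt (fun x => r (x - h) * k x).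
      rewrite -h4 -mulN1r -RIntZl//; congr RInt; apply/funext => x.
      by rewrite mulN1r -mulNr -opprD.
    rewrite h2 (le_trans (ler_norm _))// normrN; exact: rkC.
  - by move=> x; rewrite lerN2 -[`|x|]normrN.
(* A linear a priori bound makes the supremum below finite: its lower half comes from comparison
   with the point -1, where [r] vanishes, its upper half from one application of [up] with
   [e = 1]. *)
clearbody D; have low x : - (2 * M * (1 + 1 * `|x|)) <= r x.
  have [x0|x0] := leP 0 x.
    have := rM (-1) x; rewrite r0 ?ltrN10// ger0_norm// => h.
    have : -1 <= x by rewrite (le_trans _ x0)// lerN10.
    move=> /h; nra.
  by rewrite r0// oppr_le0 mulr_ge0 ?mulr_ge0 ?addr_ge0// mul1r.
have M20 : 0 <= 2 * M by rewrite mulr_ge0.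
have up1 := up (2 * M) 1 M20 _ low.
have lin x : `|r x| <= (D + 2 * M) * (1 + `|x|).
  have h1 : r x <= D + 2 * M * (1 + 1 * `|x|) / 4 by apply: up1; rewrite ler01 lexx.
  have h2 := low x; have nx := normr_ge0 x; rewrite mul1r in h1 h2.
  have q1 : 0 <= M * `|x| by rewrite mulr_ge0.
  have q2 : 0 <= D * `|x| by rewrite mulr_ge0.
  rewrite ler_norml; apply/andP; split; lra.
exists (2 * D) => y.
suff key e : 0 < e <= 1 -> `|r y| <= 2 * D * (1 + e * `|y|).
  apply/ler_addgt0Pr => d d0.
  have q0 : 0 < 2 * D * `|y| + 1 + d by rewrite ltr_wpDl// addr_ge0// mulr_ge0// mulr_ge0.
  (* This witness for [e] satisfies [2 * D * e * |y| <= d]. *)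
  have q1 : 0 < d / (2 * D * `|y| + 1 + d) <= 1.
    rewrite divr_gt0//= ler_pdivrMr// mul1r lerDr addr_ge0//; by rewrite mulr_ge0// mulr_ge0.
  have := key _ q1; rewrite mulrDr mulr1 => h; rewrite (le_trans h)// lerD2l.
  rewrite mulrCA mulrAC ler_pdivrMr// ler_wpM2l//; first exact: ltW.
  lra.
move=> /andP[e0 e1].
pose S := [set `|r x| / (1 + e * `|x|) | x in [set: R]].
have pos (x : R) : 0 < 1 + e * `|x| by rewrite ltr_pwDl// mulr_ge0// ltW.
have supS : has_sup S.
  split; first by exists (`|r 0| / (1 + e * `|0 : R|)); exists 0.
  exists ((D + 2 * M) / e) => _ [x _ <-].
  rewrite ler_pdivrMr// (le_trans (lin x))// -mulrA ler_wpM2l ?addr_ge0//.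
  rewrite mulrDr mulr1 mulKf ?gt_eqF// lerD2r -[X in X <= _]invr1 lef_pV2// posrE.
  by [].
have Q0 : 0 <= sup S.
  by apply: (le_trans _ (ub_le_sup supS.2 (ex_intro2 _ _ 0 I erefl))); rewrite divr_ge0// ltW.
have rQ x : `|r x| <= sup S * (1 + e * `|x|).
  by rewrite -ler_pdivrMr//; apply: ub_le_sup; [exact: supS.2|exists x].
have e01 : 0 <= e <= 1 by rewrite e1 ltW.
have hup := up _ _ Q0 e01 (fun x => proj1 (andP (etrans (esym (ler_norml _ _)) (rQ x)))).
have hdn := dn _ _ Q0 e01 (fun x => proj2 (andP (etrans (esym (ler_norml _ _)) (rQ x)))).
have QD : sup S <= 2 * D.
  suff : sup S <= D + sup S / 4 by lra.
  apply: ge_sup; first exact: supS.1.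
  move=> _ [x _ <-]; rewrite ler_pdivrMr//.
  have h1 := hup x; have h2 := hdn x.
  have : `|r x| <= D + sup S * (1 + e * `|x|) / 4 by rewrite ler_norml; apply/andP; split; lra.
  move=> /le_trans; apply; rewrite mulrDl lerD//.
    by rewrite ler_peMr// lerDl mulr_ge0// ltW.
  by rewrite mulrAC.
by rewrite (le_trans (rQ y))// ler_wpM2r// ltW.
Qed.

(** Adding the equally damped function [M * (2 + |x|)] on the half line makes the integrands
    nonnegative with bounded integrals, so Fatou's lemma makes the undamped integrand integrable.
    Only then is there a majorant for passing to the limit in the bound. *)
Lemma kernel_limit r k (M C : R) : 0 <= M -> measurable_fun setT r ->
  (forall x, x < 0 -> r x = 0) -> (forall x, - (M * (2 + `|x|)) <= r x) ->
  (forall x, 0 <= k x) -> RL1 k -> RL1 (fun x => `|x| * k x) ->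
  (forall s, 0 < s -> RL1 (fun x => r x * expR (- (s * x)) * k x)) ->
  (\forall s \near 0^'+, `|RInt (fun x => r x * expR (- (s * x)) * k x)| <= C) ->
  RL1 (fun x => r x * k x) /\ `|RInt (fun x => r x * k x)| <= C.
Proof.
move=> M0 mr r0 rM k0 k1 k2 rk [d /= d0 hC].
have mk := RL1_meas k1.
have mexp s : measurable_fun setT (fun x : R => expR (- (s * x))).
  by apply: measurableT_comp => //; apply: measurable_funN; exact: measurable_funM.
(* The offset 2 keeps every term strictly below [d]. *)
pose s_ (n : nat) : R := d / n.+2%:R.
have s0 n : 0 < s_ n by rewrite divr_gt0// ltr0n.
have sd n : s_ n < d by rewrite ltr_pdivrMr ?ltr0n// ltr_pMr// ltr1n.
have s_cvg : s_ @ \oo --> (0 : R).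
  rewrite -(mulr0 d); apply: cvgMr.
  have := @cvg_harmonic R; rewrite -(cvg_shiftS (@harmonic R)); exact.
have bnd n : `|RInt (fun x => r x * expR (- (s_ n * x)) * k x)| <= C.
  apply: hC => //=; first by rewrite sub0r normrN gtr0_norm.
have ecvg x : (fun n => expR (- (s_ n * x))) @ \oo --> (1 : R).
  rewrite -expR0; apply: continuous_cvg; first exact: continuous_expR.
  rewrite -oppr0 -(mul0r x); apply: cvgN; exact: cvgMl.
have cv (u v x : R) : (fun n => u * expR (- (s_ n * x)) * v) @ \oo --> u * v.
  have h : (fun n => u * expR (- (s_ n * x)) * v) @ \oo --> u * 1 * v.
    by apply: cvgM; [apply: cvgM; [exact: cvg_cst|exact: ecvg]|exact: cvg_cst].
  by rewrite mulr1 in h.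
have eind (s x : R) : 0 < s -> 0 <= x -> expR (- (s * x)) <= 1.
  by move=> s1 x0; rewrite -expR0 ler_expR oppr_le0 mulr_ge0// ltW.
pose pos : R -> R := \1_(`[0, +oo[%classic : set R).
have mpos : measurable_fun setT pos by exact: measurable_indic.
have posE x : pos x = if 0 <= x then 1 else 0.
  rewrite /pos indicE (_ : (x \in _) = (0 <= x)); first by case: ifP.
  by apply/idP/idP; rewrite ?inE/= in_itv/= andbT.
have i3 : RL1 (fun x => M * (2 * k x + `|x| * k x)).
  by apply/RL1Zl/RL1D => //; exact: RL1Zl.
have wn n : RL1 (fun x => M * (2 + `|x|) * pos x * expR (- (s_ n * x)) * k x).
  apply: (RL1_dom _ _ i3).
    do 3 (apply: measurable_funM => //).
    by apply: measurable_funM => //; apply: measurable_funD => //; exact: measurableT_comp.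
  move=> x; rewrite posE; have [x0|x0] := leP 0 x; last first.
    rewrite mulr0 !mul0r normr0 mulr_ge0// addr_ge0// mulr_ge0//.
  rewrite mulr1 ger0_norm; last by rewrite !mulr_ge0 ?expR_ge0 ?addr_ge0.
  rewrite -mulrDl mulrA ler_wpM2r// ler_piMr ?eind// mulr_ge0// addr_ge0//.
pose p n x := r x * expR (- (s_ n * x)) * k x + M * (2 + `|x|) * pos x * expR (- (s_ n * x)) * k x.
have p0 n x : 0 <= p n x.
  rewrite /p -!mulrDl !mulr_ge0 ?expR_ge0// posE; have [x0|x0] := leP 0 x.
    by rewrite mulr1; have := rM x; lra.
  by rewrite r0// mulr0 addr0.
have ip n : RL1 (p n) by apply: RL1D; [exact: rk|exact: wn].
have pB n : RInt (p n) <= C + RInt (fun x => M * (2 * k x + `|x| * k x)).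
  rewrite RIntD; [|exact: rk|exact: wn].
  apply: lerD; first by rewrite (le_trans (ler_norm _)).
  apply: RInt_le => // x; rewrite posE; have [x0|x0] := leP 0 x; last first.
    by rewrite mulr0 !mul0r mulr_ge0// addr_ge0// mulr_ge0.
  by rewrite mulr1 -mulrDl mulrA ler_wpM2r// ler_piMr ?eind// mulr_ge0// addr_ge0.
have pcvg x : p ^~ x @ \oo --> r x * k x + M * (2 + `|x|) * pos x * k x.
  rewrite /p; apply: cvgD.
  - exact: cv.
  - exact: cv.
have ilim := RInt_fatou ip p0 pcvg pB.
have ipos : RL1 (fun x => M * (2 + `|x|) * pos x * k x).
  apply: (RL1_dom _ _ i3).
    do 2 (apply: measurable_funM => //).
    by apply: measurable_funM => //; apply: measurable_funD => //; exact: measurableT_comp.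
  move=> x; rewrite posE; have [x0|x0] := leP 0 x; last first.
    by rewrite mulr0 !mul0r normr0 mulr_ge0// addr_ge0// mulr_ge0.
  rewrite mulr1 ger0_norm; last by rewrite !mulr_ge0 ?addr_ge0.
  by rewrite -mulrDl mulrA.
have irk : RL1 (fun x => r x * k x).
  by have := RL1B ilim ipos; under eq_fun do rewrite addrK.
split => //.
have h : (fun n => RInt (fun x => r x * expR (- (s_ n * x)) * k x)) @ \oo --> RInt (fun x => r x * k x).
  apply: (RInt_cvg_seq (g := fun x => `|r x * k x|)).
  - by move=> n; apply: RL1_meas; exact: rk.
  - exact: RL1_norm.
  - move=> n x; rewrite mulrAC normrM; have [x0|x0] := leP 0 x.
      by rewrite ler_piMr// gtr0_norm ?expR_gt0// eind.
    by rewrite r0// mul0r normr0 mul0r.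
  - by move=> x; exact: cv.
have /cvg_norm h2 := h.
rewrite -(cvg_lim _ h2)//; apply: limr_le; first by apply/cvg_ex; eexists; exact: h2.
exact: nearW.
Unshelve. all: by end_near.
Qed.

(* If [`|r y|] is not small, slow decrease keeps [r] away from [0] on a one-sided neighbourhood of [y]
   of fixed length, on which the rescaled kernels concentrate. *)
Lemma tauberian_limit r k (B : R) : measurable_fun setT r -> (forall x, `|r x| <= B) ->
  (forall e, 0 < e -> exists2 d : R, 0 < d & exists x0, forall x h, x0 <= x -> 0 <= h <= d ->
     - e <= r (x + h) - r x) ->
  (forall x, 0 <= k x) -> RL1 k -> 0 < RInt k ->
  (forall l, 0 < l -> (fun h => RInt (fun x => r x * k (l * (x - h)))) @ +oo --> (0 : R)) ->
  r @ +oo --> (0 : R).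
Proof.
move=> mr rB sd k0 k1 kk0 lim.
have B0 : 0 <= B by rewrite (le_trans _ (rB 0)).
have mk := RL1_meas k1.
apply/cvgr0Pnorm_le => e3 e30.
(* One [e] for slow decrease, one for the tail of the kernel, one for the limit of the averages. *)
have [e e0 e3E] : exists2 e : R, 0 < e & 3 * e = e3.
  by exists (e3 / 3); [rewrite divr_gt0|rewrite mulrC divfK].
have [d d0 [x0 hd]] := sd e e0.
have eB0 : 0 < 2 * B + e by rewrite ltr_wpDl// mulr_ge0.
(* With this fraction of the mass, the tail, where only the bound [B] is known, costs at most
   [e]. *)
have [e' e'0 e'E] : exists2 e' : R, 0 < e' & (2 * B + e) * e' = e.
  by exists (e / (2 * B + e)); [rewrite divr_gt0|rewrite mulrC divfK ?gt_eqF].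
have e'k : 0 < e' * RInt k by rewrite mulr_gt0.
have [a a0 aT] : exists2 a : R, 0 < a & RInt (fun x => k x * \1_[set z | a < `|z|] x) <= e' * RInt k.
  have /cvgr0Pnorm_le /(_ _ e'k) h1 := RInt_tail k1.
  have h2 : \forall a \near +oo, (0 : R) < a by exact: nbhs_pinfty_gt.
  have [a [/= q1 q2]] := filter_ex (filterI h1 h2).
  by exists a => //; rewrite (le_trans (ler_norm _)).
(* Dilation by [l] brings the window [|x| <= a], which carries all but the fraction [e'] of the
   mass, to [|x| <= d / 2]. *)
pose l := 2 * a / d; have l0 : 0 < l by rewrite divr_gt0// mulr_gt0.
have ln0 : l != 0 by rewrite gt_eqF.
pose w x := k (l * x).
have w1 : RL1 w by have := RL1_affine 0 ln0 k1; rewrite /w; under eq_fun do rewrite addr0.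
have wE : RInt w = l^-1 * RInt k.
  by have := RInt_affine 0 ln0 k1; rewrite gtr0_norm// => <-; congr RInt; apply/funext => x; rewrite addr0.
pose u x := w x * \1_[set z : R | d / 2 < `|z|] x.
have u1 : RL1 u by exact: RL1_big.
have uE : RInt u <= e' * RInt w.
  have h := RInt_affine 0 ln0 (RL1_big a k1).
  have -> : RInt u = l^-1 * RInt (fun x => k x * \1_[set z : R | a < `|z|] x).
    rewrite -[l^-1]gtr0_norm ?invr_gt0// normfV -h; congr RInt; apply/funext => x.
    rewrite /u /w addr0 !indicE; congr (_ * (_ : bool)%:R).
    have E : (d / 2 < `|x|) = (a < `|l * x|).
      rewrite normrM (gtr0_norm l0) /l -ltr_pdivrMl ?divr_gt0 ?mulr_gt0//.
      by congr (_ < _); field; rewrite !gt_eqF.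
    by apply/idP/idP; rewrite !inE /= E.
  by rewrite wE mulrCA ler_wpM2l// invr_ge0 ltW.
have w0 x : 0 <= w x by exact: k0.
have kw0 : 0 < RInt w by rewrite wE mulr_gt0// invr_gt0.
have rw h : RL1 (fun x => r (x + h) * w x).
  apply: (RL1M (M := B)) => //; apply: measurableT_comp => //.
  exact: measurable_funD.
have mw : measurable_fun setT w by exact: RL1_meas.
have AE h : RInt (fun x => r (x + h) * w x) = RInt (fun x => r x * k (l * (x - h))).
  have i1 : RL1 (fun x => r x * k (l * (x - h))).
    apply: (RL1M (M := B)) => //.
    have := RL1_shift (- h) w1; exact.
  suff : RL1 (fun x => r (x + h) * w x) /\
    RInt (fun x => r (x + h) * w x) = RInt (fun x => r x * k (l * (x - h))) by case.
  by apply: (RInt_shiftE (b := h) i1) => x; rewrite addrK.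
have indU x : `|x| <= d / 2 -> u x = 0.
  by move=> h; rewrite /u indicE memNset ?mulr0//=; apply/negP; rewrite -leNgt.
have indL x : d / 2 < `|x| -> u x = w x.
  by move=> h; rewrite /u indicE mem_set ?mulr1.
(* Centring at [y + d / 2] puts the window inside [[y, y + d]], where [r] is at least [r y - e]. For
   the bound from the other side the centre is [y - d / 2]. *)
clearbody u w l; clear aT wE e'k ln0 a0; have up y : x0 <= y -> r y * RInt w <= RInt (fun x => r (x + (y + d / 2)) * w x) + 2 * e * RInt w.
  move=> y0.
  have pw x : r y * w x - e * w x - (2 * B + e) * u x <= r (x + (y + d / 2)) * w x.
    have wx := w0 x; have [xd|xd] := leP `|x| (d / 2).
      have := hd y (x + d / 2) y0; rewrite indU// (_ : y + (x + d / 2) = x + (y + d / 2)); last by ring.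
      have : 0 <= x + d / 2 <= d by move: xd; rewrite ler_norml => /andP[]; lra.
      move=> q /(_ q) h; rewrite mulr0 subr0 -mulrBl ler_wpM2r//; lra.
    rewrite (indL _ xd).
    have := rB y; have := rB (x + (y + d / 2)); rewrite !ler_norml => /andP[q1 q2] /andP[q3 q4].
    have : r y - e - (2 * B + e) <= r (x + (y + d / 2)) by lra.
    move=> /(ler_wpM2r wx); rewrite !mulrBl; lra.
  have i1 := RL1Zl (r y) w1; have i2 := RL1Zl e w1; have i3 := RL1Zl (2 * B + e) u1.
  have := RInt_le (RL1B (RL1B i1 i2) i3) (rw _) pw.
  rewrite (RIntB (RL1B i1 i2) i3) (RIntB i1 i2) !RIntZl//.
  have : (2 * B + e) * RInt u <= e * RInt w.
    apply: (le_trans (ler_wpM2l (ltW eB0) uE)).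
    by rewrite mulrA e'E.
  lra.
have dn y : x0 <= y - d -> - r y * RInt w <= - RInt (fun x => r (x + (y - d / 2)) * w x) + 2 * e * RInt w.
  move=> y0.
  have pw x : r (x + (y - d / 2)) * w x <= r y * w x + e * w x + (2 * B + e) * u x.
    have wx := w0 x; have [xd|xd] := leP `|x| (d / 2).
      have := hd (x + (y - d / 2)) (d / 2 - x); rewrite indU//.
      rewrite (_ : x + (y - d / 2) + (d / 2 - x) = y); last by ring.
      have q : 0 <= d / 2 - x <= d by move: xd; rewrite ler_norml => /andP[]; lra.
      have q' : x0 <= x + (y - d / 2) by move: xd; rewrite ler_norml => /andP[]; lra.
      move=> /(_ q' q) h; rewrite mulr0 addr0 -mulrDl ler_wpM2r//; lra.
    rewrite (indL _ xd).
    have := rB y; have := rB (x + (y - d / 2)); rewrite !ler_norml => /andP[q1 q2] /andP[q3 q4].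
    have : r (x + (y - d / 2)) <= r y + e + (2 * B + e) by lra.
    by move=> /(ler_wpM2r wx); rewrite !mulrDl; lra.
  have i1 := RL1Zl (r y) w1; have i2 := RL1Zl e w1; have i3 := RL1Zl (2 * B + e) u1.
  have := RInt_le (rw _) (RL1D (RL1D i1 i2) i3) pw.
  rewrite (RIntD (RL1D i1 i2) i3) (RIntD i1 i2) !RIntZl//.
  have : (2 * B + e) * RInt u <= e * RInt w.
    apply: (le_trans (ler_wpM2l (ltW eB0) uE)).
    by rewrite mulrA e'E.
  lra.
have ew0 : 0 < e * RInt w by rewrite mulr_gt0.
have /cvgr0Pnorm_le /(_ _ ew0) [N [Nr hN]] := lim l l0.
near=> y.
have y1 : x0 <= y by near: y; apply: nbhs_pinfty_ge; exact: num_real.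
have y2 : x0 <= y - d by rewrite lerBrDr; near: y; apply: nbhs_pinfty_ge; exact: num_real.
have y3 : N < y - d / 2 by rewrite ltrBrDr; near: y; apply: nbhs_pinfty_gt; exact: num_real.
have h1 := up y y1; have h2 := dn y y2.
rewrite AE in h1; rewrite AE in h2.
have y4 : N < y + d / 2 by rewrite (lt_trans y3)//; lra.
have := hN _ y3; have := hN _ y4; rewrite !ler_norml => /andP[q1 q2] /andP[q3 q4].
rewrite -e3E; clear -h1 h2 q1 q2 q3 q4 kw0.
apply/andP; split; rewrite -(ler_pM2r kw0); lra.
Unshelve. all: by end_near.
Qed.

(** * Test functions with nonnegative Fourier transform *)

Lemma exists_bump (l : R) : 0 < l -> exists chi : R -> R,
  [/\ tf chi, forall x, 0 <= chi x, forall x, l / 2 < `|x| -> chi x = 0 & 0 < RInt chi].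
Proof.
move=> l0; have lV0 : 0 < l^-1 by rewrite invr_gt0.
have lVn0 : l^-1 != 0 by rewrite gt_eqF.
have ln0 : l != 0 by rewrite gt_eqF.
exists (fun x => bump (l^-1 * x + 1 / 2)).
have chi0 x : l / 2 < `|x| -> bump (l^-1 * x + 1 / 2) = 0.
  move=> h; apply: bump_0; move: h; rewrite ltr_normr => /orP[h|h]; [right|left].
    have := ltr_pM2l lV0 (l / 2) x; rewrite h mulKf// => /esym q; lra.
  have := ltr_pM2l lV0 (l / 2) (- x); rewrite h mulKf// mulrN => /esym q; lra.
split => //.
- by split; [exact (@smooth_affine R _ l^-1 (1 / 2) (@smooth_bump R))|exists (l / 2)].
- by move=> x; exact: bump_ge0.
- rewrite RInt_affine//; last exact: RL1_bump.
  by rewrite gtr0_norm// invrK mulr_gt0// RInt_bump_gt0.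
Qed.

(** The autocorrelation of a bump supported in [|x| <= l / 2]. Its transform is at most a constant
    times the square of [weight], hence has a finite first moment. It is bounded below for
    [|t| <= l^-1], as the phase [t * x] then stays within 1/2, where the cosine has a positive
    minimum. *)
Lemma exists_kernel (l : R) : 0 < l -> exists phi k : R -> R,
  [/\ tf phi, forall x, l < `|x| -> phi x = 0 & forall t, fourier phi t = (k t)%:C] /\
  [/\ forall t, 0 <= k t, RL1 k, RL1 (fun x => `|x| * k x) & 0 < RInt k].
Proof.
move=> l0; have [chi [tchi chi_ge0 chi0 chi_gt0]] := exists_bump l0.
have lV0 : 0 < l^-1 by rewrite invr_gt0.
pose k t := complex.Re (fourier chi t) ^+ 2 + complex.Im (fourier chi t) ^+ 2.
have kE t : k t = complex.Re (fourier chi t) ^+ 2 + complex.Im (fourier chi t) ^+ 2 by [].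
clearbody k; have [C C0 hC] := fourier_weight tchi.
have k_ge0 (t : R) : 0 <= k t by rewrite kE addr_ge0// sqr_ge0.
have kw (t : R) : k t <= 2 * (C * weight t) ^+ 2.
  have h1 := le_trans (n1_Re _) (hC t); have h2 := le_trans (n1_Im _) (hC t).
  have w0 : 0 <= C * weight t by rewrite mulr_ge0 ?ltW ?weight_gt0.
  have sq (u v : R) : `|u| <= v -> u ^+ 2 <= v ^+ 2.
    by move=> uv; rewrite -(ger0_norm (sqr_ge0 u)) normrX lerXn2r ?nnegrE// (le_trans _ uv).
  rewrite kE mulr2n mulrDl mul1r; exact: lerD (sq _ _ h1) (sq _ _ h2).
have mk : measurable_fun setT k.
  rewrite (funext kE); have [m1 m2] := cmeas_fourier tchi.
  by apply: measurable_funD; exact: measurable_funX.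
have w1 (t : R) : weight t <= 1.
  by rewrite invf_le1 ?ltr_pwDl ?sqr_ge0// lerDl sqr_ge0.
have w2 (t : R) : `|t| * weight t <= 1.
  rewrite ler_pdivrMr ?ltr_pwDl ?sqr_ge0// mul1r.
  have h : `|t| ^+ 2 = t ^+ 2 by rewrite -normrX ger0_norm// sqr_ge0.
  have := sqr_ge0 (`|t| - 1); have := normr_ge0 t; rewrite -h; nra.
have k1 : RL1 k.
  apply: (@RL1_dom _ _ (fun t => 2 * C ^+ 2 * weight t)) => //; last exact/RL1Zl/RL1_weight.
  move=> t; rewrite ger0_norm// (le_trans (kw t))// exprMn mulrA.
  apply: ler_wpM2l; first by rewrite mulr_ge0// sqr_ge0.
  by rewrite expr2 ler_piMl// ltW// weight_gt0.
have k2 : RL1 (fun t => `|t| * k t).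
  apply: (@RL1_dom _ _ (fun t => 2 * C ^+ 2 * weight t)); last exact/RL1Zl/RL1_weight.
    by apply: measurable_funM => //; exact: measurableT_comp.
  move=> t; rewrite normrM normr_id (ger0_norm (k_ge0 t)).
  rewrite (le_trans (ler_wpM2l (normr_ge0 t) (kw t)))// exprMn.
  have -> : `|t| * (2 * (C ^+ 2 * weight t ^+ 2)) = (2 * C ^+ 2 * weight t) * (`|t| * weight t) by ring.
  apply: ler_piMr; last exact: w2.
  by apply: mulr_ge0; [rewrite mulr_ge0// sqr_ge0|exact/ltW/weight_gt0].
exists (corr chi chi), k; split; split => //.
- exact (tf_corr tchi tchi chi0 chi0).
- by move=> x lx; apply: (corr_out chi0 chi0); rewrite mulrC divfK.
- by move=> t; rewrite (fourier_corr t tchi chi0) kE.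
have [c c0 hc] : exists2 c : R, 0 < c & forall y, `|y| <= 1 / 2 -> c <= cos y.
  have [|c cI hc] := @EVT_min R (@cos R) (- (1 / 2)) (1 / 2) _ (continuous_subspaceT (@continuous_cos R)).
    lra.
  exists (cos c); last by move=> y yI; apply: hc; rewrite in_itv/= -ler_norml.
  apply: cos_gt0_pihalf; have := pihalf_ge1 R; move: cI; rewrite in_itv/= => /andP[q1 q2] q3.
  by apply/andP; split; lra.
have kI (t : R) : `|t| <= l^-1 -> (c * RInt chi) ^+ 2 <= k t.
  move=> tl.
  have h : c * RInt chi <= complex.Re (fourier chi t).
    rewrite fourierE ReCInt -RIntZl; last exact: RL1_tf.
    apply: RInt_le.
    - exact/RL1Zl/RL1_tf.
    - exact: RL1_Re (CL1_fourier_integrand t tchi).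
    move=> x; rewrite !cE ?mul0r ?subr0 /= ?cosN mulrC.
    have [xl|xl] := leP `|x| (l / 2); last by rewrite chi0// !mul0r.
    rewrite ler_wpM2l// hc// normrM.
    apply: (le_trans (ler_pM (normr_ge0 _) (normr_ge0 _) tl xl)).
    by rewrite mulrA mulVf ?gt_eqF.
  have q0 : 0 <= c * RInt chi by rewrite mulr_ge0 ?ltW.
  apply: (@le_trans _ _ (complex.Re (fourier chi t) ^+ 2)).
    by rewrite lerXn2r// nnegrE (le_trans q0).
  by rewrite kE lerDl sqr_ge0.
apply: (@lt_le_trans _ _ (RInt (fun t => (c * RInt chi) ^+ 2 * \1_`[- l^-1, l^-1] t))).
  rewrite RIntZl; last exact: RL1_indic.
  rewrite RInt_indic ?mulr_gt0 ?exprn_gt0 ?mulr_gt0//; lra.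
apply: RInt_le => //; first exact/RL1Zl/RL1_indic.
move=> t; rewrite indicE; have [|_] := boolP (t \in `[- l^-1, l^-1]%classic); last by rewrite mulr0.
by rewrite inE/= in_itv/= -ler_norml mulr1 => /kI.
Qed.

End RealTauberian.

(** * Laplace transforms *)

Section LaplaceTransform.
Variable R : realType.
Local Notation mu := (@lebesgue_measure R).
Implicit Types (u p : R -> R[i]).

(** Absolute convergence for every [s > 0], as opposed to the improper integrals of the statement.
    Vanishing on the negative axis is required at every point, so that pointwise majorants can be
    used. *)
Definition laplaceable u := [/\ cmeas u, forall x : R, x < 0 -> u x = 0 &
  forall s : R, 0 < s -> CL1 (fun x => u x * (expR (- (s * x)))%:C)].

Definition lap u (s t : R) : R[i] :=
  CInt (fun x => u x * (expR (- (s * x)))%:C * cis (- (t * x))).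

Lemma measurable_expRN (s : R) : measurable_fun setT (fun x : R => expR (- (s * x))).
Proof. by apply: measurableT_comp => //; apply: measurable_funN; exact: measurable_funM. Qed.

Lemma measurable_mulN (t : R) : measurable_fun setT (fun x : R => - (t * x)).
Proof. by apply: measurable_funN; exact: measurable_funM. Qed.

Lemma CL1_lap u s t : laplaceable u -> 0 < s ->
  CL1 (fun x => u x * (expR (- (s * x)))%:C * cis (- (t * x))).
Proof.
move=> [_ _ gu] s0; apply: (CL1Mb (M := 2)) (gu s s0) _ _.
- by apply: cmeas_cis; exact: measurable_mulN.
- by move=> x; exact: n1_cis.
Qed.

Let cker (z : R * R) : R[i] := cis (- (z.1 * z.2)).

Let cmeas_cker : cmeas cker.
Proof.
apply: cmeas_cis; apply: measurable_funN; apply: measurable_funM.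
- exact: measurable_fst.
- exact: measurable_snd.
Qed.

Lemma cmeas_lap u s : laplaceable u -> 0 < s -> cmeas (lap u s).
Proof.
move=> [_ _ gu] s0.
exact: (cmeas_kernel (gu s s0) cmeas_cker (fun z => n1_cis _)).
Qed.

Lemma n1_lap u s t : laplaceable u -> 0 < s ->
  n1 (lap u s t) <= 2 * RInt (fun x => n1 (u x * (expR (- (s * x)))%:C)).
Proof.
move=> [_ _ gu] s0.
exact: (n1_CInt_kernel t (gu s s0) cmeas_cker (fun z => n1_cis _)).
Qed.

Lemma CL1_lap_tf u s (f : R -> R[i]) : laplaceable u -> 0 < s -> CL1 f ->
  CL1 (fun t => lap u s t * f t).
Proof.
move=> gu s0 f1; under eq_fun do rewrite mulrC.
apply: (CL1Mb (M := 2 * RInt (fun x => n1 (u x * (expR (- (s * x)))%:C)))) f1 _ _.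
- exact: cmeas_lap.
- by move=> t; exact: n1_lap.
Qed.

(** The modulation by [h] becomes a translation of the transform, so that one test function,
    modulated, yields the convolution at every point. *)
Lemma lap_pairing u s phi (h : R) : laplaceable u -> 0 < s -> tf phi ->
  CInt (fun t => lap u s t * ((phi t)%:C * cis (h * t))) =
  CInt (fun x => u x * (expR (- (s * x)))%:C * fourier phi (x - h)).
Proof.
move=> [mu0 _ gu] s0 tphi.
have mh : measurable_fun setT (fun x : R => h * x) by exact: measurable_funM.
have := CFubini_kernel (CL1_tf tphi mh) (gu s s0) cmeas_cker (fun z => n1_cis _).
under [X in CInt X = _]eq_fun do rewrite mulrC.
move=> ->; congr CInt; apply/funext => x; congr (_ * _).
rewrite -fourier_mod; congr CInt; apply/funext => t.
by rewrite /cker /= [t * x]mulrC.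
Qed.

(** * The transform of the half line *)

Definition heaviside (x : R) : R[i] := if 0 <= x then 1 else 0.

(** Squaring [1 + y <= expR y] at [y = s / 2 * x] dominates the exponential by a dilated
    [weight]. *)
Lemma RL1_exp (s : R) : 0 < s -> RL1 (fun x => if 0 <= x then expR (- (s * x)) else 0).
Proof.
move=> s0; have sn0 : s / 2 != 0 by rewrite mulf_neq0 ?gt_eqF.
apply: (RL1_dom _ _ (RL1_affine 0 sn0 (RL1_weight R))).
  apply: measurable_fun_if => //.
  - exact: measurable_fun_ler.
  - by apply: measurable_funTS; exact: measurable_expRN.
move=> x; case: ifP => [x0|_]; last by rewrite normr0 ltW// weight_gt0.
rewrite ger0_norm ?expR_ge0// addr0 expRN lef_pV2 ?posrE ?expR_gt0 ?ltr_pwDl ?sqr_ge0//.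
have -> : s * x = s / 2 * x + s / 2 * x by field.
have h0 : 0 <= s / 2 * x by rewrite mulr_ge0// divr_ge0// ltW.
have h1 := expR_ge1Dx (s / 2 * x); rewrite expRD.
move: (s / 2 * x) h0 h1 => y y0 h; have := ler_pM _ _ h h.
by rewrite addr_ge0// => /(_ isT isT); apply: le_trans; rewrite mulrDl mul1r mulrDr mulr1 -expr2 addrA lerD2r; lra.
Qed.

Lemma laplaceable_heaviside : laplaceable heaviside.
Proof.
split.
- have -> : heaviside = fun x => ((\1_(`[0, +oo[%classic : set R) x : R))%:C.
    apply/funext => x; rewrite /heaviside indicE (_ : (x \in _) = (0 <= x)); first by case: ifP.
    by apply/idP/idP; rewrite ?inE/= in_itv/= andbT.
  by apply: cmeasC; exact: measurable_indic.
- by move=> x; rewrite ltNge /heaviside => /negbTE ->.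
- move=> s s0; have -> : (fun x => heaviside x * (expR (- (s * x)))%:C) =
      fun x => (if 0 <= x then expR (- (s * x)) else 0)%:C.
    by apply/funext => x; rewrite /heaviside; case: ifP => _; rewrite ?mul1r ?mul0r.
  exact/CL1C/RL1_exp.
Qed.

Lemma RInt_FTC f (a b : R) : a < b -> smooth f -> RInt ((derive1 f) \_ `[a, b[) = f b - f a.
Proof.
move=> ab sf.
have cf : {within `[a, b], continuous (derive1 f)}.
  by apply: continuous_subspaceT => x; apply: smooth_continuous; exact: smooth_derive1.
have i1 : mu.-integrable `[a, b] (EFin \o derive1 f).
  by apply: continuous_compact_integrable => //; exact: segment_compact.
rewrite -RInt_restrict Rintegral_itv_bndo_bndc; last first.
  by apply: integrableS i1 => // x /=; rewrite !in_itv/= => /andP[-> /ltW ->].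
rewrite /Rintegral (@continuous_FTC2 _ (derive1 f) f)//.
split.
- by move=> x _; exact: smooth_derivable.
- by apply: cvg_at_right_filter; exact: smooth_continuous.
- by apply: cvg_at_left_filter; exact: smooth_continuous.
Qed.

Lemma is_derive_expN (s x : R) : is_derive x 1 (fun x : R => expR (- (s * x))) (- s * expR (- (s * x))).
Proof.
have := @is_derive_comp_affine R expR (- s) 0 x (expR (- s * x + 0)) (is_derive_expR _).
have -> : (fun y : R => expR (- s * y + 0)) = (fun y => expR (- (s * y))).
  by apply/funext => y; rewrite addr0 mulNr.
by rewrite addr0 [in expR (- s * x)]mulNr.
Qed.

Lemma is_derive_cosM (t x : R) : is_derive x 1 (fun x : R => cos (t * x)) (- t * sin (t * x)).
Proof.
have := @is_derive_comp_affine R cos t 0 x (- sin (t * x + 0)) (is_derive_cos _).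
by rewrite addr0 mulrN mulNr; under eq_fun do rewrite addr0.
Qed.

Lemma is_derive_sinM (t x : R) : is_derive x 1 (fun x : R => sin (t * x)) (t * cos (t * x)).
Proof.
have := @is_derive_comp_affine R sin t 0 x (cos (t * x + 0)) (is_derive_sin _).
by rewrite addr0; under eq_fun do rewrite addr0.
Qed.

Lemma smooth_expN (s : R) : smooth (fun x : R => expR (- (s * x))).
Proof.
apply: (@smooth_coind R (fun f => exists c, f = fun x => c * expR (- (s * x)))); last first.
  by exists 1; apply/funext => x; rewrite mul1r.
move=> _ [c ->]; exists (fun x => (c * - s) * expR (- (s * x))); last by exists (c * - s).
move=> x; have h := is_deriveM (is_derive_cst c x 1) (is_derive_expN s x).
by apply: is_derive_eq h _; rewrite /GRing.scale/= mulr0 addr0 mulrA.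
Qed.

(** No improper integral is evaluated. Subtracting the translate by 1 leaves the integral of [w]
    over [[0, 1[], found by the fundamental theorem, and multiplies the transform by [1 - w 1],
    nonzero because [w 1] has modulus [expR (- s) < 1]. *)
Lemma lap_heaviside (s t : R) : 0 < s -> lap heaviside s t = (s +i* t)^-1.
Proof.
move=> s0.
pose w x : R[i] := (expR (- (s * x)))%:C * cis (- (t * x)).
have lE : lap heaviside s t = CInt (fun x => heaviside x * w x).
  by congr CInt; apply/funext => x; rewrite mulrA.
have i1 : CL1 (fun x => heaviside x * w x).
  by have := CL1_lap t laplaceable_heaviside s0; under eq_fun do rewrite -mulrA.
have wD x : w (x + 1) = w 1 * w x.
  rewrite /w !mulrDr opprD expRD rmorphM /= opprD cisD; ring.
have i2 : CL1 (fun x => heaviside (x - 1) * w x).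
  have := CL1_shift (-1) (CL1Zl (w 1) i1).
  under eq_fun do rewrite mulrCA -wD subrK; exact.
have e2 : CInt (fun x => heaviside (x - 1) * w x) = w 1 * lap heaviside s t.
  rewrite lE -CIntZl// -[RHS](CInt_shift (-1)); last exact: CL1Zl.
  by congr CInt; apply/funext => x; rewrite [RHS]mulrCA -wD subrK.
have e1 : (s +i* t) * CInt (fun x => heaviside x * w x - heaviside (x - 1) * w x) = 1 - w 1.
  have Rw x : complex.Re (w x) = expR (- (s * x)) * cos (t * x).
    by rewrite !cE mul0r subr0 /= cosN.
  have Iw x : complex.Im (w x) = - (expR (- (s * x)) * sin (t * x)).
    by rewrite !cE mul0r addr0 /= sinN mulrN.
  pose A := RInt ((fun x => expR (- (s * x)) * cos (t * x)) \_ `[0, 1[).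
  pose B := RInt ((fun x => expR (- (s * x)) * sin (t * x)) \_ `[0, 1[).
  have hvE x : heaviside x - heaviside (x - 1) = if x \in `[0, 1[%classic then 1 else 0.
    rewrite /heaviside subr_ge0 (_ : (x \in _) = (0 <= x < 1)); last first.
      by apply/idP/idP; rewrite ?inE/= in_itv.
    have [x0|x0] /= := leP 0 x; have [x1|x1] //= := leP 1 x; rewrite ?subrr ?subr0//.
    by move: (lt_le_trans x0 (le_trans ler01 x1)); rewrite ltxx.
  have iA : RL1 ((fun x => expR (- (s * x)) * cos (t * x)) \_ `[0, 1[).
    have [h _] := CL1B i1 i2; apply: eq_integrable h => // ? _.
    rewrite /= patchE -mulrBl hvE; case: ifP => _; rewrite ?mul0r// mul1r Rw//.
  have iB : RL1 ((fun x => expR (- (s * x)) * sin (t * x)) \_ `[0, 1[).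
    have [_ h] := CL1B i1 i2; have := RL1Zl (-1) h.
    apply: eq_integrable => // ? _.
    rewrite /= patchE -mulrBl hvE; case: ifP => _; last by rewrite mul0r mulr0.
    by rewrite mul1r Iw mulN1r opprK.
  have JE : CInt (fun x => heaviside x * w x - heaviside (x - 1) * w x) = A +i* (- B).
    apply: complex_ext.
    - rewrite ReCInt -[RHS]/A; congr RInt; apply/funext => x.
      by rewrite patchE -mulrBl hvE; case: ifP => _; rewrite ?mul0r// mul1r Rw//.
    - transitivity (-1 * B); last by rewrite mulN1r.
      rewrite ImCInt -(RIntZl (-1) iB); congr RInt; apply/funext => x.
      rewrite patchE -mulrBl hvE; case: ifP => _; last by rewrite mul0r mulr0.
      by rewrite mul1r Iw mulN1r.
  have q1 : s * A + t * B = 1 - expR (- s) * cos t.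
    have sm : smooth (fun x => - (expR (- (s * x)) * cos (t * x))).
      by apply: smoothN; apply: smoothM; [exact: smooth_expN|exact: smooth_cosM].
    have := RInt_FTC ltr01 sm; rewrite !mulr1 !mulr0 oppr0 expR0 cos0 mulr1 opprK addrC => <-.
    rewrite -(RIntZl s iA) -(RIntZl t iB) -RIntD; [|exact: RL1Zl..].
    congr RInt; apply/funext => x; rewrite !patchE; case: ifP => _; last by rewrite !mulr0 addr0.
    have [_ ->] := is_derive_all (fun x => is_deriveN (is_deriveM (is_derive_expN s x) (is_derive_cosM t x))).
    by rewrite /GRing.scale/=; ring.
  have q2 : t * A - s * B = expR (- s) * sin t.
    have sm : smooth (fun x => (expR (- (s * x)) * sin (t * x))).
      by apply: smoothM; [exact: smooth_expN|exact: smooth_sinM].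
    have := RInt_FTC ltr01 sm; rewrite !mulr1 !mulr0 oppr0 expR0 sin0 mulr0 subr0 => <-.
    rewrite -(RIntZl t iA) -(RIntZl s iB) -RIntB; [|exact: RL1Zl..].
    congr RInt; apply/funext => x; rewrite !patchE; case: ifP => _; last by rewrite !mulr0 subr0.
    have [_ ->] := is_derive_all (fun x => is_deriveM (is_derive_expN s x) (is_derive_sinM t x)).
    by rewrite /GRing.scale/=; ring.
  have R1 : complex.Re (1 : R[i]) = 1 by [].
  have I1 : complex.Im (1 : R[i]) = 0 by [].
  rewrite JE; move: q1 q2; clearbody A B => q1 q2; apply: complex_ext.
  - rewrite [RHS]ReB Rw R1 !mulr1 [LHS]ReM !xE; lra.
  - rewrite [RHS]ImB Iw I1 !mulr1 [LHS]ImM !xE; lra.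
rewrite (CIntB i1 i2) e2 -lE in e1.
have w1 : 1 - w 1 != 0.
  rewrite subr_eq0; apply/eqP => /(congr1 (fun z => complex.Re z ^+ 2 + complex.Im z ^+ 2)).
  rewrite !cE !mul0r subr0 addr0 /= expr0n addr0 expr1n !mulr1 cosN sinN.
  rewrite !exprMn sqrrN -mulrDr cos2Dsin2 mulr1 => /esym/eqP.
  have := expR_gt0 (- s); have : expR (- s) < 1 by rewrite expR_lt1 oppr_lt0.
  by rewrite sqrf_eq1 => h1 h2 /orP[]/eqP h; lra.
have sn0 : s +i* t != 0.
  by rewrite eq_complex /= negb_and gt_eqF.
apply: (mulfI sn0); rewrite divff//; apply: (mulIf w1); rewrite mul1r -[RHS]e1; ring.
Qed.

(** * Primitives and division of the transform *)

Definition prim u (x : R) : R[i] := cint `[0, x] u.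

Lemma cint_itv (f : R -> R[i]) (a b : R) : cint `[a, b] f = CInt (fun v => f v * (\1_`[a, b] v)%:C).
Proof.
apply: complex_ext.
- rewrite ReCInt /cint /= RInt_restrict; congr RInt; apply/funext => v.
  by rewrite patchE indicE !cE mulr0 subr0; case: ifP; rewrite ?mulr1 ?mulr0.
- rewrite ImCInt /cint /= RInt_restrict; congr RInt; apply/funext => v.
  by rewrite patchE indicE !cE mulr0 add0r; case: ifP; rewrite ?mulr1 ?mulr0.
Qed.

Lemma primE u x : prim u x = CInt (fun v => u v * (\1_`[0, x] v)%:C).
Proof. exact: cint_itv. Qed.

Lemma prim_lt0 u x : x < 0 -> prim u x = 0.
Proof.
move=> x0; rewrite primE -[RHS](CInt0 R); congr CInt; apply/funext => v.
rewrite indicE memNset ?mulr0//= in_itv/= => /andP[v0 vx].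
by move: (le_lt_trans (le_trans v0 vx) x0); rewrite ltxx.
Qed.

(** In the damped primitive, half of the damping at [x] is kept as an integrable factor; the other
    half is split into damping of [u] at [v] and [expR (- (s / 2 * (x - v)))], which is at most 1
    for [0 <= v <= x]. This gives the shape needed for the exchange of integrals, with this function
    as kernel. *)
Let pker (s : R) (z : R * R) : R[i] :=
  (\1_[set z : R * R | 0 <= z.2 <= z.1] z * expR (- (s / 2 * (z.1 - z.2))))%:C.

Let pker_le1 s z : 0 < s -> n1 (pker s z) <= 1.
Proof.
move=> s0; rewrite /pker n1C normrM (ger0_norm (expR_ge0 _)) indicE.
have [|_] := boolP (z \in _); last by rewrite normr0 mul0r.
rewrite inE/= => /andP[z0 z1]; rewrite normr1 mul1r -expR0 ler_expR oppr_le0.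
by rewrite mulr_ge0 ?divr_ge0 ?subr_ge0// ltW.
Qed.

Let cmeas_pker s : cmeas (pker s).
Proof.
apply: cmeasC; apply: measurable_funM.
- apply: measurable_indic.
  rewrite -[X in measurable X]setTI.
  rewrite (_ : [set z : R * R | _] = (fun z : R * R => (0 <= z.2) && (z.2 <= z.1)) @^-1` [set true]); last first.
    by apply/seteqP; split => z /=.
  have m : measurable_fun setT (fun z : R * R => (0 <= z.2) && (z.2 <= z.1)).
    apply: measurable_and.
    + by apply: measurable_fun_ler => //; exact: measurable_snd.
    + by apply: measurable_fun_ler; [exact: measurable_snd|exact: measurable_fst].
  exact: m.
- apply: measurableT_comp => //; apply: measurable_funN; apply: measurable_funM => //.
  by apply: measurable_funB; [exact: measurable_fst|exact: measurable_snd].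
Qed.

Let half (s x : R) : R[i] := if 0 <= x then (expR (- (s / 2 * x)))%:C else 0.

Let halfE s x : half s x = heaviside x * (expR (- (s / 2 * x)))%:C.
Proof. by rewrite /half /heaviside; case: ifP; rewrite ?mul1r ?mul0r. Qed.

Let hgt (s : R) : 0 < s -> 0 < s / 2.
Proof. by move=> s0; rewrite divr_gt0. Qed.

Let CL1_half s : 0 < s -> CL1 (half s).
Proof.
move=> s0; have [_ _ h] := laplaceable_heaviside; have := h (s / 2) (hgt s0).
by rewrite (_ : half s = fun x => heaviside x * (expR (- (s / 2 * x)))%:C)//; apply/funext => x; rewrite halfE.
Qed.

Let cmeas_expR (c : R) : cmeas (fun x : R => (expR (c * x))%:C).
Proof. by apply: cmeasC; apply: measurableT_comp => //; exact: measurable_funM. Qed.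

Lemma laplaceable_CL1_itv u x : laplaceable u -> CL1 (fun v => u v * (\1_`[0, x] v)%:C).
Proof.
move=> [mu0 _ gu]; have h := gu 1 ltr01.
have := @CL1Mb R _ (fun v => (expR v * \1_`[0, x] v)%:C) (expR x) h _ _.
have -> : (fun v => u v * (expR (- (1 * v)))%:C * (expR v * \1_`[0, x] v)%:C) =
          (fun v => u v * (\1_`[0, x] v)%:C).
  apply/funext => v; rewrite mul1r -mulrA -rmorphM /= mulrA -expRD addNr expR0 mul1r//.
apply.
- by apply: cmeasC; apply: measurable_funM => //; exact: measurable_indic.
- move=> v; rewrite n1C normrM (ger0_norm (expR_ge0 _)) indicE.
  have [|_] := boolP (v \in _); last by rewrite normr0 mulr0 expR_ge0.
  by rewrite inE/= in_itv/= => /andP[_ vx]; rewrite normr1 mulr1 ler_expR.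
Qed.

Let prim_kernel u s x : 0 < s -> laplaceable u ->
  prim u x * (expR (- (s * x)))%:C =
  half s x * CInt (fun v => u v * (expR (- (s / 2 * v)))%:C * pker s (x, v)).
Proof.
move=> s0 gu; have [x0|x0] := leP 0 x; last first.
  by rewrite prim_lt0// mul0r /half leNgt x0 mul0r.
rewrite primE /half x0.
have -> : expR (- (s * x)) = expR (- (s / 2 * x)) * expR (- (s / 2 * x)).
  by rewrite -expRD; congr expR; field.
rewrite rmorphM /= mulrA mulrC; congr (_ * _).
rewrite -CIntZr; last exact: laplaceable_CL1_itv.
congr CInt; apply/funext => v; rewrite -[LHS]mulrA -[RHS]mulrA; congr (_ * _).
rewrite /pker -!rmorphM /=; congr (_%:C).
have -> : (\1_[set z : R * R | 0 <= z.2 <= z.1] (x, v) : R) = \1_`[0, x] v.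
  by rewrite !indicE; congr (_%:R); apply/idP/idP; rewrite !inE/= in_itv.
rewrite mulrCA; congr (_ * _); rewrite -expRD; congr expR; ring.
Qed.

Lemma laplaceable_prim u : laplaceable u -> laplaceable (prim u).
Proof.
move=> gu; have [mu0 _ iu] := gu.
have C s : 0 < s -> CL1 (fun x => prim u x * (expR (- (s * x)))%:C).
  move=> s0; have ib := iu (s / 2) (hgt s0).
  rewrite (_ : (fun _ => _) = fun x => half s x * CInt (fun v => u v * (expR (- (s / 2 * v)))%:C * pker s (x, v))); last first.
    by apply/funext => x; rewrite prim_kernel.
  apply: CL1Mb (CL1_half s0) _ _.
  - exact: cmeas_kernel ib (cmeas_pker s) (fun z => pker_le1 z s0).
  - by move=> x; exact: n1_CInt_kernel ib (cmeas_pker s) (fun z => pker_le1 z s0).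
split => //; last by move=> x; exact: prim_lt0.
have := cmeasM (CL1_meas (C 1 ltr01)) (cmeas_expR 1).
rewrite (_ : (fun _ => _ * _) = prim u)//; apply/funext => x.
by rewrite -mulrA -rmorphM /= -expRD addNr expR0 mulr1.
Qed.

(** A primitive is a convolution with [heaviside]: once the integrals are exchanged, the inner one
    is the transform of [heaviside] translated by [v], and the translation restores the other half
    of the damping and the phase at [v]. *)
Lemma lap_prim u s t : laplaceable u -> 0 < s -> lap (prim u) s t = lap u s t / (s +i* t).
Proof.
move=> gu s0; have [mu0 u0 iu] := gu; have ib := iu (s / 2) (hgt s0).
have ia : CL1 (fun x => half s x * cis (- (t * x))).
  apply: (CL1Mb (M := 2)) (CL1_half s0) _ (fun x => n1_cis _).
  by apply: cmeas_cis; exact: measurable_mulN.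
have -> : lap (prim u) s t = CInt (fun x => half s x * cis (- (t * x)) *
   CInt (fun v => u v * (expR (- (s / 2 * v)))%:C * pker s (x, v))).
  by rewrite /lap; congr CInt; apply/funext => x; rewrite prim_kernel// mulrAC.
rewrite (CFubini_kernel ia ib (cmeas_pker s) (fun z => pker_le1 z s0)).
rewrite -lap_heaviside// -CIntZr; last exact: CL1_lap.
congr CInt; apply/funext => v; have [v0|v0] := ltP v 0; first by rewrite u0// !mul0r.
have -> : expR (- (s * v)) = expR (- (s / 2 * v)) * expR (- (s / 2 * v)).
  by rewrite -expRD; congr expR; field.
rewrite rmorphM /= !mulrA -[RHS]mulrA -[in RHS]mulrA; congr (_ * _).
have il := CL1_lap t laplaceable_heaviside s0.
rewrite [RHS]mulrA /lap -(CIntZl _ il) -(CInt_shift (- v) (CL1Zl _ il)).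
congr CInt; apply/funext => x.
have -> : half s x * cis (- (t * x)) * pker s (x, v) =
  heaviside (x - v) * (expR (- (s / 2 * x)) * expR (- (s / 2 * (x - v))))%:C * cis (- (t * x)).
  rewrite /pker /half /heaviside subr_ge0 indicE.
  have [xv|xv] := leP v x.
    by rewrite (le_trans v0 xv) mem_set/= ?v0// mul1r !rmorphM /=; ring.
  rewrite memNset/=; last by move=> /andP[_]; rewrite leNgt xv.
  by rewrite !(mul0r, mulr0).
have -> : - (t * x) = - (t * v) + - (t * (x - v)) by ring.
rewrite cisD -expRD.
have -> : - (s / 2 * x) + - (s / 2 * (x - v)) = - (s / 2 * v) + - (s * (x - v)) by field.
rewrite expRD rmorphM /=; ring.
Qed.

Lemma laplaceable_cis u (t0 : R) : laplaceable u -> laplaceable (fun x => u x * cis (t0 * x)).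
Proof.
move=> [mu0 u0 gu]; have mt : cmeas (fun x : R => cis (t0 * x)).
  by apply: cmeas_cis; exact: measurable_funM.
split.
- exact: cmeasM.
- by move=> x /u0 ->; rewrite mul0r.
- move=> s s0; have := CL1Mb (gu s s0) mt (fun x => n1_cis _).
  by under eq_fun do rewrite mulrAC.
Qed.

Lemma lap_cis u (t0 s t : R) : lap (fun x => u x * cis (t0 * x)) s t = lap u s (t - t0).
Proof.
rewrite /lap; congr CInt; apply/funext => x.
rewrite (_ : - ((t - t0) * x) = t0 * x + - (t * x)); last by ring.
by rewrite cisD; ring.
Qed.

(** The function J_t of the overview at [t = t0]. Multiplying it by [cis (t0 * x)] will move its
    transform back to the frequency [t0]. *)
Definition prim_at (t0 : R) u (x : R) : R[i] := prim (fun v => u v * cis (- t0 * v)) x.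

Lemma laplaceable_prim_at t0 u : laplaceable u -> laplaceable (prim_at t0 u).
Proof. by move=> gu; apply: laplaceable_prim; exact: laplaceable_cis. Qed.

Lemma lap_prim_at t0 u s t : laplaceable u -> 0 < s ->
  lap (fun x => prim_at t0 u x * cis (t0 * x)) s t = lap u s t / (s +i* (t - t0)).
Proof.
move=> gu s0; rewrite lap_cis lap_prim//; last exact: laplaceable_cis.
by rewrite lap_cis opprK subrK.
Qed.

(** Integration by parts against the primitive, carried out on the transform side: the transform of
    [p] is multiplied back by [s + i (t - t0)], and the factor [t - t0] is absorbed by the test
    function. The term with [s] is meant to fade as [s] tends to 0. *)
Lemma lap_pairing_div t0 u p s phi (h : R) : laplaceable u -> laplaceable p -> 0 < s -> tf phi ->
  (forall t, lap p s t = lap u s t / (s +i* (t - t0))) ->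
  CInt (fun x => u x * (expR (- (s * x)))%:C * fourier phi (x - h)) =
  s%:C * CInt (fun x => p x * (expR (- (s * x)))%:C * fourier phi (x - h)) +
  'i * CInt (fun x => p x * (expR (- (s * x)))%:C * fourier (fun t => phi t * (t - t0)) (x - h)).
Proof.
move=> gu gp s0 tphi pu.
have sm : smooth (fun t : R => t - t0).
  by have := smooth_affine (a := 1) (b := - t0) (@smooth_id R); under eq_fun do rewrite mul1r.
have tphi' := tfM tphi sm.
have mh : measurable_fun setT (fun x : R => h * x) by exact: measurable_funM.
have f1 := CL1_tf tphi mh; have f2 := CL1_tf tphi' mh.
rewrite -!lap_pairing//.
rewrite -CIntZl; last exact: CL1_lap_tf.
rewrite -CIntZl; last exact: CL1_lap_tf.
rewrite -CIntD; [|exact/CL1Zl/CL1_lap_tf|exact/CL1Zl/CL1_lap_tf].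
congr CInt; apply/funext => t.
have uE : lap u s t = lap p s t * (s +i* (t - t0)).
  by rewrite pu divfK// eq_complex /= negb_and gt_eqF.
rewrite uE -!mulrA rmorphM /=.
have -> : s +i* (t - t0) = s%:C + 'i * (t - t0)%:C.
  by apply: complex_ext; rewrite ?cE ?xE; ring.
ring.
Qed.

End LaplaceTransform.

(** * Bounds from pseudomeasure boundary values *)

Section PairingBounds.
Variable R : realType.
Local Notation mu := (@lebesgue_measure R).
Implicit Types (u p : R -> R[i]) (phi : R -> R).

Lemma ccvg_near (F : set_system R) (FF : Filter F) (f g : R -> R[i]) l :
  (\forall x \near F, f x = g x) -> ccvg F f l -> ccvg F g l.
Proof.
move=> fg [h1 h2]; split.
- by apply: cvg_trans h1; apply: near_eq_cvg; apply: filterS fg => x ->.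
- by apply: cvg_trans h2; apply: near_eq_cvg; apply: filterS fg => x ->.
Qed.

Lemma n1_normc (z : R[i]) (M : R) : `|z| <= M%:C -> n1 z <= 2 * M.
Proof.
move=> zM; have zM1 := le_trans (normc_ge_Re z) zM.
have zM2 : `|complex.Im z|%:C <= M%:C.
  apply: le_trans zM; rewrite normc_def lecR -sqrtr_sqr ler_wsqrtr// lerDr.
  exact: sqr_ge0.
by move: zM1 zM2; rewrite !lecR /n1; lra.
Qed.

(** * One-sided bounds from slow decrease *)

Definition sdec (f : R -> R) : Prop := forall e : R, 0 < e ->
  exists2 d : R, 0 < d & exists x0, forall x h : R, x0 <= x -> 0 <= h <= d -> - e <= f (x + h) - f x.

Definition onesided (f : R -> R) (M X : R) : Prop :=
  forall x z : R, X <= x -> x <= z -> f x - M * (1 + (z - x)) <= f z.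

(** Slow decrease with [e = 1] is chained over steps of length [d], each losing at most 1; about
    [1 + (z - x) / d] steps lead from [x] to [z]. *)
Lemma sdec_onesided f : sdec f -> exists M X : R, [/\ 0 <= M, 0 <= X & onesided f M X].
Proof.
move=> /(_ 1 ltr01)[d d0 [x0 hd]].
exists (1 + d^-1), (Num.max 0 x0); split.
- by rewrite addr_ge0// invr_ge0 ltW.
- by rewrite le_max lexx.
have chain (n : nat) x z : Num.max 0 x0 <= x -> x <= z -> z - x <= n%:R * d -> f x - n%:R <= f z.
  elim: n x => [|n IH] x; rewrite ge_max => /andP[q0 q1] xz h.
    have -> : x = z by apply/le_anti; rewrite xz; move: h; rewrite mul0r subr_le0.
    by rewrite subr0.
  have [zd|zd] := leP (z - x) d.
    have := hd x (z - x) q1; rewrite zd subr_ge0 xz [x + _]addrC subrK => /(_ isT).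
    by have := ler0n R n; rewrite -natr1; lra.
  have := IH (x + d); rewrite ge_max -natr1 => h1.
  have : f (x + d) - n%:R <= f z by apply: h1; [apply/andP; split| |]; move: h; rewrite -?natr1; lra.
  by have := hd x d q1; rewrite ltW// lexx => /(_ isT); lra.
move=> x z Xx xz; have y0 : 0 <= (z - x) / d by rewrite divr_ge0 ?subr_ge0// ltW.
have /andP[t1 t2] := Num.Theory.truncn_itv y0.
have := chain (Num.truncn ((z - x) / d)).+1 x z Xx xz.
rewrite -ler_pdivrMr// ltW// => /(_ isT); apply: le_trans.
rewrite lerB//; move: t1; rewrite -natr1 mulrC; set T := (_%:R : R) => t1.
have q0 : 0 <= z - x by rewrite subr_ge0.
have q1 : 0 < d^-1 by rewrite invr_gt0.
by rewrite mulrDl mul1r !mulrDr mulr1; lra.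
Qed.

(** Multiplication by a cosine or a sine keeps the support inside [V], so the boundary values of
    both parts of the modulated test function are available and can be recombined. *)
Lemma pairing_cvg p V psi phi (h : R) : laplaceable p -> bounded_cfun psi ->
  (forall phi, test_fun V phi ->
     ccvg 0^'+ (fun s => CInt (fun t => lap p s t * (phi t)%:C)) (inv_fourier_pairing psi phi)) ->
  test_fun V phi ->
  ccvg 0^'+ (fun s => CInt (fun x => p x * (expR (- (s * x)))%:C * fourier phi (x - h)))
    (((2 * pi)^-1)%:C * CInt (fun x => psi x * fourier phi (- x - h))).
Proof.
move=> gp [mpsi [M psiM]] H tV; have tphi := test_fun_tf tV.
have tc := test_funM tV (@smooth_cosM R h); have ts := test_funM tV (@smooth_sinM R h).
have tc' := test_fun_tf tc; have ts' := test_fun_tf ts.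
have ci chi : tf chi -> CL1 (fun x => psi x * fourier chi (- x)).
  move=> tchi; under eq_fun do rewrite mulrC -[- _]add0r.
  apply: (CL1Mb (M := 2 * M)) (CL1_flip 0 (CL1_fourier tchi)) mpsi _.
  by move=> x; exact: n1_normc.
have F0 : Filter (0 : R)^'+ by exact: at_right_proper_filter.
have := ccvgD F0 (H _ tc) (ccvgM F0 (ccvg_cst F0 'i) (H _ ts)).
rewrite /inv_fourier_pairing mulrCA -mulrDr.
rewrite -![cint setT _]/(CInt _) -(CIntZl 'i (ci _ ts')).
rewrite -(CIntD (ci _ tc') (CL1Zl 'i (ci _ ts'))).
have -> : (fun x => psi x * fourier (fun x0 => phi x0 * cos (h * x0)) (- x) +
     'i * (psi x * fourier (fun x0 => phi x0 * sin (h * x0)) (- x))) =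
   (fun x => psi x * fourier phi (- x - h)).
  by apply/funext => x; rewrite -fourier_cos_sin// mulrDr mulrCA.
apply: ccvg_near; near=> s.
have s0 : 0 < s by [].
have mh : measurable_fun setT (fun x : R => h * x) by exact: measurable_funM.
rewrite -lap_pairing// -CIntZl; last by apply: CL1_lap_tf => //; exact/CL1C/RL1_tf.
rewrite -CIntD; last 2 first.
- by apply: CL1_lap_tf => //; exact/CL1C/RL1_tf.
- by apply/CL1Zl; apply: CL1_lap_tf => //; exact/CL1C/RL1_tf.
congr CInt; apply/funext => t.
rewrite mulrCA -mulrDr; congr (_ * _).
by rewrite /cis; apply: complex_ext; rewrite ?cE ?xE; ring.
Unshelve. all: by end_near. Qed.

(** The limit is bounded by a bound of [psi] times the L1-norm of the transform, which no
    translation changes. Hence [C] is the same for all [h], while the admissible range of [s] varies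
    with [h]. *)
Lemma pairing_bounded p V psi phi : laplaceable p -> bounded_cfun psi ->
  (forall phi, test_fun V phi ->
     ccvg 0^'+ (fun s => CInt (fun t => lap p s t * (phi t)%:C)) (inv_fourier_pairing psi phi)) ->
  test_fun V phi -> exists C : R, forall h : R, \forall s \near 0^'+,
    n1 (CInt (fun x => p x * (expR (- (s * x)))%:C * fourier phi (x - h))) <= C.
Proof.
move=> gp bpsi H tV; have tphi := test_fun_tf tV; have [mpsi [M psiM]] := bpsi.
pose L := (2 * pi)^-1 * (2 * M * RInt (fun x => n1 (fourier phi x))).
exists (L + 1) => h; have /ccvg_n1P := pairing_cvg h gp bpsi H tV.
move=> /(_ 1 ltr01); apply: filterS => s hs.
set z := CInt _ in hs *; set l := (_ * _) in hs.
have -> : z = (z - l) + l by rewrite subrK.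
rewrite (le_trans (n1D _ _))// addrC lerD//.
rewrite /l n1CM ger0_norm ?invr_ge0 ?mulr_ge0 ?pi_ge0//.
apply: ler_wpM2l; first by rewrite invr_ge0 mulr_ge0 ?pi_ge0.
have c0 := CL1_fourier tphi; have c1 := CL1_flip (- h) c0.
have -> : (fun x => psi x * fourier phi (- x - h)) = (fun x => psi x * fourier phi (- h - x)).
  by apply/funext => x; rewrite addrC.
have <- : RInt (fun x => n1 (fourier phi (- h - x))) = RInt (fun x => n1 (fourier phi x)).
  have := RInt_flip (RL1_n1 (CL1_shift (- h) c0)).
  have := RInt_shift (- h) (RL1_n1 c0) => <- <-.
  by congr RInt; apply/funext => x; rewrite addrC.
rewrite -RIntZl; last exact: RL1_n1.
apply: n1_CInt_dom; last exact/RL1Zl/RL1_n1.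
- exact: cmeasM (CL1_meas c1).
- move=> x; rewrite (le_trans (n1M _ _))// ler_wpM2r ?n1_ge0//; exact: n1_normc.
Qed.

Lemma tf_shift phi (b : R) : tf phi -> tf (fun t => phi (t - b)).
Proof.
move=> [sphi [L hL]]; split.
  by have := @smooth_affine R _ 1 (- b) sphi; under eq_fun do rewrite mul1r.
by exists (L + `|b|) => x h; apply: hL; have := ler_normB (x - b) (- b); rewrite opprK subrK normrN; lra.
Qed.

Lemma RL1_head (r : R -> R) (X : R) :
  RL1 (fun x => r x * expR (- (1 * x))) -> RL1 (fun x => r x * \1_`[0, X] x).
Proof.
move=> ri; have := @RL1M R _ (fun x => expR x * \1_`[0, X] x) (expR X) ri _ _.
have -> : (fun x => expR x * \1_`[0, X] x * (r x * expR (- (1 * x)))) = (fun x => r x * \1_`[0, X] x).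
  apply/funext => x; rewrite mul1r mulrACA expRN; have := expR_gt0 x => h; field.
  by rewrite gt_eqF.
apply.
- by apply: measurable_funM => //; exact: measurable_indic.
- move=> v; rewrite normrM (ger0_norm (expR_ge0 _)) indicE.
  have [|_] := boolP (v \in _); last by rewrite normr0 mulr0 expR_ge0.
  by rewrite inE/= in_itv/= => /andP[_ vx]; rewrite normr1 mulr1 ler_expR.
Qed.

(* Truncating at [X] replaces [r] by a function with the one-sided condition on the whole line;
   the discarded part is integrable, so it changes the convolutions by a bounded amount. *)
Lemma onesided_bounded (r k : R -> R) (M X C K : R) : 0 <= M -> 0 <= X -> measurable_fun setT r ->
  (forall x : R, x < 0 -> r x = 0) -> (forall s : R, 0 < s -> RL1 (fun x => r x * expR (- (s * x)))) ->
  onesided r M X ->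
  (forall x, 0 <= k x) -> (forall x, k x <= K) -> RL1 k -> RL1 (fun x => `|x| * k x) -> 0 < RInt k ->
  (forall h : R, \forall s \near 0^'+, `|RInt (fun x => r x * expR (- (s * x)) * k (x - h))| <= C) ->
  exists B, forall x, X <= x -> `|r x| <= B.
Proof.
move=> M0 X0 mr rn ri os k0 kK k1 k2 kk hC.
have K0 : 0 <= K by exact: le_trans (k0 0) (kK 0).
pose r0 x := r x * \1_`[0, X] x.
have ir0 : RL1 r0 by exact/RL1_head/ri.
pose r1 x := if X < x then r x else 0.
have r1E x : r1 x = r x - r0 x.
  rewrite /r1 /r0 indicE; have [x0|x0] := ltP x 0.
    by rewrite rn// mul0r subrr if_same.
  have [xX|xX] := ltP X x; first by rewrite memNset/= ?mulr0 ?subr0// in_itv/= x0/= leNgt xX.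
  by rewrite mem_set/= ?mulr1 ?subrr// in_itv/= x0.
have mr1 : measurable_fun setT r1.
  by rewrite (_ : r1 = fun x => r x - r0 x) ?(funext r1E)//; apply: measurable_funB => //; exact: RL1_meas ir0.
(* The truncation creates a jump at [X], which costs [|r X|]. *)
pose M' := M + `|r X|.
have M'0 : 0 <= M' by rewrite addr_ge0.
have rX := ler_norm (- r X); rewrite normrN in rX.
have r1n x : x < 0 -> r1 x = 0 by move=> x0; rewrite /r1 ltNge (le_trans (ltW x0)).
have os1 x z : x <= z -> r1 x - M' * (1 + (z - x)) <= r1 z.
  move=> xz; have q0 : 0 <= z - x by rewrite subr_ge0.
  have q1 : 0 <= `|r X| * (z - x) by rewrite mulr_ge0.
  have q2 : 0 <= M * (z - x) by rewrite mulr_ge0.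
  rewrite /r1; have [xX|xX] := ltP X x.
    rewrite (lt_le_trans xX xz); have := os x z (ltW xX) xz.
    by have := normr_ge0 (r X); rewrite /M'; lra.
  have [zX|zX] := ltP X z.
    have := os X z (lexx _) (ltW zX); have q3 : M * (z - X) <= M * (z - x) by rewrite ler_wpM2l// lerB.
    by have := normr_ge0 (r X); rewrite /M'; lra.
  by rewrite sub0r oppr_le0 mulr_ge0// addr_ge0.
(* The 2 arises from comparison with the point -1, where [r1] vanishes. *)
have lb x : - (M' * (2 + `|x|)) <= r1 x.
  have [x1|x1] := leP (-1) x.
    have := os1 _ _ x1; rewrite [r1 (-1)]r1n ?ltrN10// sub0r; apply: le_trans.
    by rewrite lerN2 ler_wpM2l//; have := ler_norm x; lra.
  rewrite r1n; last by rewrite (lt_trans x1)// ltrN10.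
  by rewrite oppr_le0 mulr_ge0// addr_ge0.
have kb x : `|k x| <= K by rewrite ger0_norm.
have mk := RL1_meas k1.
have mkh (h : R) : measurable_fun setT (fun x : R => k (x - h)) by exact: RL1_meas (RL1_shift (- h) k1).
have ik (f : R -> R) (h : R) : RL1 f -> RL1 (fun x : R => f x * k (x - h)).
  by move=> f1; under eq_fun do rewrite mulrC; exact: RL1M f1 (mkh h) (fun x => kb _).
have r0e (s x : R) : 0 < s -> `|r0 x * expR (- (s * x))| <= `|r0 x|.
  move=> s0; have [x0|x0] := ltP x 0; first by rewrite /r0 rn// !mul0r.
  rewrite normrM ler_piMr// ger0_norm ?expR_ge0// -expR0 ler_expR oppr_le0.
  by rewrite mulr_ge0// ltW.
have ir0e s : 0 < s -> RL1 (fun x => r0 x * expR (- (s * x))).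
  move=> s0; apply: RL1_dom (RL1_norm ir0).
    by apply: measurable_funM; [exact: RL1_meas ir0|exact: measurable_expRN].
  by move=> x; exact: r0e.
have ir1 s : 0 < s -> RL1 (fun x => r1 x * expR (- (s * x))).
  move=> s0; under eq_fun do rewrite r1E mulrBl.
  exact: RL1B (ri _ s0) (ir0e _ s0).
have kl (h : R) : RL1 (fun x : R => r1 x * k (x - h)) /\ `|RInt (fun x => r1 x * k (x - h))| <= C + K * RInt (fun x => `|r0 x|).
  apply: (kernel_limit M'0 mr1 r1n lb (fun x => k0 _) (RL1_shift (- h) k1)).
  - have := RL1D (RL1_shift (- h) k2) (RL1Zl `|h| (RL1_shift (- h) k1)).
    apply: RL1_dom; first by apply: measurable_funM => //; exact: measurableT_comp.
    move=> x; rewrite ger0_norm ?mulr_ge0// -mulrDl ler_wpM2r//.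
    by have := ler_normD (x - h) h; rewrite subrK.
  - by move=> s s0; exact: ik (ir1 _ s0).
  have := hC h; near_simpl => hh; near=> s.
  have s0 : 0 < s by [].
  have -> : (fun x => r1 x * expR (- (s * x)) * k (x - h)) =
    (fun x => r x * expR (- (s * x)) * k (x - h) - r0 x * expR (- (s * x)) * k (x - h)).
    by apply/funext => x; rewrite r1E !mulrBl.
  rewrite (RIntB (ik _ _ (ri _ s0)) (ik _ _ (ir0e _ s0))).
  rewrite (le_trans (ler_normB _ _))// lerD//; first by near: s; exact: hh.
  rewrite -RIntZl; last exact: RL1_norm.
  apply: RInt_dom; last exact/RL1Zl/RL1_norm.
  - by apply: measurable_funM => //; exact: RL1_meas (ir0e _ s0).
  - by move=> x; rewrite normrM mulrC ler_pM// r0e.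
have [B hB] := kernel_bounded M'0 r1n os1 k0 k1 k2 kk (fun h => (kl h).1) (fun h => (kl h).2).
exists (B + `|r X|) => x Xx; have B0 : 0 <= B by exact: le_trans (normr_ge0 _) (hB 0).
have := hB x; rewrite /r1; case: (ltP X x) => [xX h|xX _]; first by rewrite (le_trans h)// lerDl.
have -> : x = X by apply/le_anti; rewrite Xx xX.
by rewrite lerDr.
Unshelve. all: by end_near. Qed.

Definition kbounded p phi := exists C : R, forall h : R, \forall s \near 0^'+,
  n1 (CInt (fun x => p x * (expR (- (s * x)))%:C * fourier phi (x - h))) <= C.

Lemma kernel_onesided_bounded p phi (k : R -> R) (M X : R) : laplaceable p -> 0 <= M -> 0 <= X ->
  onesided (fun x => complex.Re (p x)) M X -> onesided (fun x => complex.Im (p x)) M X ->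
  tf phi -> (forall t, fourier phi t = (k t)%:C) ->
  (forall x, 0 <= k x) -> RL1 k -> RL1 (fun x => `|x| * k x) -> 0 < RInt k ->
  kbounded p phi -> exists B : R, forall x, X <= x -> n1 (p x) <= B.
Proof.
move=> [[mr mi] p0 ip] M0 X0 o1 o2 tphi kE k0 k1 k2 kk [C hC].
have [K K0 hK] := fourier_weight tphi.
have kK x : k x <= K.
  have := hK x; rewrite kE n1C ger0_norm// => h; rewrite (le_trans h)// (ler_piMr (ltW K0))//.
  by rewrite invf_le1 ?ltr_pwDl ?sqr_ge0// lerDl sqr_ge0.
have [B1 h1] : exists B, forall x, X <= x -> `|complex.Re (p x)| <= B.
  apply: (onesided_bounded (C := C) M0 X0 mr _ _ o1 k0 kK k1 k2 kk).
  - by move=> x /p0 ->.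
  - by move=> s /ip /RL1_Re; under eq_fun do rewrite ReM ReC ImC mulr0 subr0.
  move=> h; apply: filterS (hC h) => s; apply: le_trans.
  rewrite (le_trans _ (n1_Re _))// ReCInt le_eqVlt; apply/orP; left; apply/eqP; congr `|RInt _|.
  by apply/funext => x; rewrite kE ReM ReM !ReC !ImC !mulr0 !subr0.
have [B2 h2] : exists B, forall x, X <= x -> `|complex.Im (p x)| <= B.
  apply: (onesided_bounded (C := C) M0 X0 mi _ _ o2 k0 kK k1 k2 kk).
  - by move=> x /p0 ->.
  - by move=> s /ip /RL1_Im; under eq_fun do rewrite ImM ReC ImC mulr0 add0r.
  move=> h; apply: filterS (hC h) => s; apply: le_trans.
  rewrite (le_trans _ (n1_Im _))// ImCInt le_eqVlt; apply/orP; left; apply/eqP; congr `|RInt _|.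
  by apply/funext => x; rewrite kE ImM ImM !ReC !ImC !mulr0 !add0r.
by exists (B1 + B2) => x Xx; rewrite lerD ?h1 ?h2.
Qed.

Lemma open_itv (V : set R) (t0 : R) : open V -> V t0 ->
  exists2 l : R, 0 < l & `[t0 - l, t0 + l] `<=` V.
Proof.
move=> oV Vt; have := open_nbhs_nbhs (conj oV Vt); rewrite nbhs_ballP => -[e /= e0 he].
exists (e / 2); first by rewrite divr_gt0.
move=> x; rewrite /= in_itv/= => /andP[h1 h2]; apply: he.
by rewrite /ball /= ltr_norml; apply/andP; split; lra.
Qed.

(** Carries bounds for the divided transform over to the transform itself; this serves when 0 is an
    exceptional point. *)
Lemma kbounded_div t0 u phi : laplaceable u -> tf phi ->
  kbounded (fun x => prim_at t0 u x * cis (t0 * x)) phi ->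
  kbounded (fun x => prim_at t0 u x * cis (t0 * x)) (fun t => phi t * (t - t0)) ->
  kbounded u phi.
Proof.
move=> gu tphi [C1 h1] [C2 h2]; exists (C1 + C2) => h; near=> s.
have s0 : 0 < s by [].
have s1 : s <= 1 by near: s; apply: nbhs_right_le.
rewrite (lap_pairing_div h gu (laplaceable_cis t0 (laplaceable_prim_at t0 gu)) s0 tphi (fun t => lap_prim_at t0 t gu s0)).
rewrite (le_trans (n1D _ _))// lerD//.
- rewrite n1CM (ger0_norm (ltW s0)) (@le_trans _ _ (1 * C1))//; last by rewrite mul1r.
  by apply: ler_pM; [exact: ltW s0|exact: n1_ge0|exact: s1|near: s; exact: h1].
- rewrite (le_trans (n1M _ _))// (_ : n1 'i = 1) ?mul1r; last by rewrite /n1 ReI ImI normr0 add0r normr1.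
  by near: s; exact: h2.
Unshelve. all: by end_near. Qed.

(** Frequencies near 0 are enough, because the test function with nonnegative transform can be
    supported in an arbitrarily small interval about 0. *)
Lemma sdec_bounded u V : laplaceable u -> sdec (fun x => complex.Re (u x)) -> sdec (fun x => complex.Im (u x)) ->
  open V -> V 0 -> (forall phi, test_fun V phi -> kbounded u phi) ->
  exists X B : R, [/\ 0 <= X, 0 <= B & forall x, X <= x -> n1 (u x) <= B].
Proof.
move=> gu /sdec_onesided[M1 [X1 [M10 X10 o1]]] /sdec_onesided[M2 [X2 [M20 X20 o2]]] oV V0 kb.
pose M := Num.max M1 M2; pose X := Num.max X1 X2.
have os (f : R -> R) M' X' : M' <= M -> X' <= X -> onesided f M' X' -> onesided f M X.
  move=> hM hX o x z Xx xz; apply: le_trans (o x z (le_trans hX Xx) xz).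
  by rewrite lerB// ler_wpM2r// addr_ge0// subr_ge0.
have [l l0 lV] := open_itv oV V0.
have [phi [k [[tphi phi0 phiE] [k0 k1 k2 kk]]]] := exists_kernel l0.
have tV : test_fun V phi.
  apply: (test_fun_itv tphi.1 (a := - l) (b := l)).
    by move=> x h; apply: phi0; rewrite ltr_normr; case: h => h; apply/orP; [right|left]; lra.
  by move: lV; rewrite sub0r add0r.
have M0 : 0 <= M by rewrite le_max M10.
have X0 : 0 <= X by rewrite le_max X10.
have [||B hB] := kernel_onesided_bounded gu M0 X0 _ _ tphi phiE k0 k1 k2 kk (kb _ tV).
- by apply: os o1; rewrite le_max lexx.
- by apply: os o2; rewrite le_max lexx orbT.
by exists X, B; split => //; exact: le_trans (n1_ge0 _) (hB X (lexx X)).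
Qed.

Lemma n1_prim_head u (x X : R) : laplaceable u -> x <= X ->
  n1 (prim u x) <= RInt (fun v => n1 (u v * (\1_`[0, X] v)%:C)).
Proof.
move=> gu xX; rewrite primE; apply: n1_CInt_dom.
- exact: CL1_meas (laplaceable_CL1_itv x gu).
- move=> v; rewrite !n1MC ler_wpM2l ?n1_ge0// !indicE.
  have [|_] := boolP (v \in `[0, x]%classic); last by rewrite normr0.
  rewrite inE/= in_itv/= => /andP[v0 vx].
  by rewrite mem_set//= in_itv/= v0 (le_trans vx).
- exact: RL1_n1 (laplaceable_CL1_itv X gu).
Qed.

Lemma n1_primB u (x z X B : R) : laplaceable u -> 0 <= X -> X <= x -> x <= z ->
  (forall v, X <= v -> n1 (u v) <= B) -> n1 (prim u z - prim u x) <= B * (z - x).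
Proof.
move=> gu X0 Xx xz hB; have cz := laplaceable_CL1_itv z gu; have cx := laplaceable_CL1_itv x gu.
rewrite !primE -CIntB// -RInt_indic// -RIntZl; last exact: RL1_indic.
apply: n1_CInt_dom; [exact: CL1_meas (CL1B cz cx)| |exact/RL1Zl/RL1_indic].
move=> v; rewrite -mulrBr -rmorphB /= n1MC.
have B0 : 0 <= B by exact: le_trans (n1_ge0 _) (hB X (lexx X)).
have [vx|vx] := leP v x.
  rewrite (_ : _ - _ = 0) ?normr0 ?mulr0 ?mulr_ge0// ?indicE//.
  have -> : (v \in `[0, z]%classic) = (v \in `[0, x]%classic); last by rewrite subrr.
  by apply/idP/idP; rewrite !inE/= !in_itv/= => /andP[-> h]//=; lra.
have v0 : 0 <= v by lra.
rewrite (_ : \1_`[0, x] v = 0) ?subr0; last by rewrite indicE memNset//= in_itv/= v0 leNgt vx.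
rewrite !indicE (_ : (v \in `[0, z]%classic) = (v \in `[x, z]%classic)).
  by rewrite normr_nat ler_wpM2r// hB//; lra.
by apply/idP/idP; rewrite !inE/= !in_itv/= => /andP[_ h]; apply/andP; split => //; lra.
Qed.

Lemma fourier_bounded phi : tf phi -> exists2 K : R, 0 < K & forall t, n1 (fourier phi t) <= K.
Proof.
move=> tphi; have [K K0 hK] := fourier_weight tphi; exists K => // t.
rewrite (le_trans (hK t))// (ler_piMr (ltW K0))//.
by rewrite invf_le1 ?ltr_pwDl ?sqr_ge0// lerDl sqr_ge0.
Qed.

Lemma CL1_laplaceable_fourier p s phi (h : R) : laplaceable p -> 0 < s -> tf phi ->
  CL1 (fun x => p x * (expR (- (s * x)))%:C * fourier phi (x - h)).
Proof.
move=> [_ _ ip] s0 tphi; have [K K0 hK] := fourier_bounded tphi.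
apply: CL1Mb (ip _ s0) _ (fun x => hK _).
exact: CL1_meas (CL1_shift (- h) (CL1_fourier tphi)).
Qed.

(** Beyond [X] the function [u] is bounded, so the primitive is Lipschitz there and both of its
    components satisfy the one-sided condition. The test function about 0 is translated to [t0],
    which multiplies its transform by a phase that [cis (t0 * x)] compensates. *)
Lemma prim_at_bounded u V t0 (X B : R) : laplaceable u -> 0 <= X ->
  (forall x, X <= x -> n1 (u x) <= B) -> open V -> V t0 ->
  (forall phi, test_fun V phi -> kbounded (fun x => prim_at t0 u x * cis (t0 * x)) phi) ->
  exists B', forall x, n1 (prim_at t0 u x) <= B'.
Proof.
move=> gu X0 hB oV Vt kb; have B0 : 0 <= B by exact: le_trans (n1_ge0 _) (hB X (lexx X)).
have gv := laplaceable_cis (- t0) gu; have gp := laplaceable_prim_at t0 gu.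
have hv2 x : X <= x -> n1 (u x * cis (- t0 * x)) <= B * 2.
  by move=> Xx; rewrite (le_trans (n1M _ _))// ler_pM ?n1_ge0 ?hB ?n1_cis.
have os (f : R[i] -> R) : (forall z w, `|f z - f w| <= n1 (z - w)) -> onesided (fun x => f (prim_at t0 u x)) (B * 2) X.
  move=> hf x z Xx xz; have := le_trans (hf (prim_at t0 u z) (prim_at t0 u x)) (n1_primB gv X0 Xx xz hv2).
  by rewrite ler_norml => /andP[]; lra.
have [l l0 lV] := open_itv oV Vt.
have [phi [k [[tphi phi0 phiE] [k0 k1 k2 kk]]]] := exists_kernel l0.
have ts := tf_shift t0 tphi.
have tV : test_fun V (fun t => phi (t - t0)).
  apply: (test_fun_itv ts.1 (a := t0 - l) (b := t0 + l)) => //.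
  by move=> x h; apply: phi0; rewrite ltr_normr; case: h => h; apply/orP; [right|left]; lra.
have B2 : 0 <= B * 2 by rewrite mulr_ge0.
have [B' hB'] : exists B', forall x, X <= x -> n1 (prim_at t0 u x) <= B'.
  apply: (kernel_onesided_bounded gp B2 X0 _ _ tphi phiE k0 k1 k2 kk).
  - by apply: os => z w; rewrite -ReB; exact: n1_Re.
  - by apply: os => z w; rewrite -ImB; exact: n1_Im.
  have [C hC] := kb _ tV; exists (C * 2) => h; near=> s.
  have s0 : 0 < s by [].
  have hs : n1 (CInt (fun x => prim_at t0 u x * cis (t0 * x) * (expR (- (s * x)))%:C *
      fourier (fun t => phi (t - t0)) (x - h))) <= C by near: s; exact: hC.
  set z := CInt _ in hs; set w := CInt _.
  (* The phases combine to one that is independent of [x] and leaves the integral. *)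
  have -> : w = z * cis (- (h * t0)).
    rewrite /z -CIntZr; last exact: CL1_laplaceable_fourier (laplaceable_cis t0 gp) s0 ts.
    congr CInt; apply/funext => x; rewrite fourier_shift//.
    have e1 : cis (t0 * x) * cis (- ((x - h) * t0)) * cis (- (h * t0)) = 1.
      by rewrite -!cisD -[RHS]cis0; congr cis; ring.
    transitivity (prim_at t0 u x * (expR (- (s * x)))%:C * fourier phi (x - h) *
      (cis (t0 * x) * cis (- ((x - h) * t0)) * cis (- (h * t0)))); last by ring.
    by rewrite e1 mulr1.
  by rewrite (le_trans (n1M _ _))// ler_pM ?n1_ge0 ?n1_cis.
pose B'' := RInt (fun v => n1 (u v * cis (- t0 * v) * (\1_`[0, X] v)%:C)).
exists (Num.max B' B'') => x; rewrite le_max; have [Xx|xX] := leP X x; first by rewrite hB'.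
by rewrite (n1_prim_head gv (ltW xX)) orbT.
Unshelve. all: by end_near. Qed.

End PairingBounds.

(** * Convolutions with transforms of test functions *)

Section Convolution.
Variable R : realType.
Local Notation mu := (@lebesgue_measure R).
Implicit Types (u p : R -> R[i]) (phi : R -> R).

Definition ubound u (X B : R) := [/\ 0 <= X, 0 <= B & forall x, X <= x -> n1 (u x) <= B].

Definition conv u phi (h : R) : R[i] := CInt (fun x => u x * fourier phi (x - h)).

Definition null u phi : Prop := ccvg +oo (conv u phi) 0.

Lemma ubound_split u X B x : laplaceable u -> ubound u X B ->
  n1 (u x) <= n1 (u x * (\1_`[0, X] x)%:C) + B.
Proof.
move=> [_ u0 _] [X0 B0 hB]; have [x0|x0] := ltP x 0.
  by rewrite u0// n10 addr_ge0 ?n1_ge0.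
have [xX|xX] := leP x X; last by rewrite (le_trans (hB _ (ltW xX)))// lerDr n1_ge0.
by rewrite indicE mem_set/= ?mulr1 ?lerDl// in_itv/= x0.
Qed.

Lemma conv_dom u X B (f : R -> R[i]) (K : R) : laplaceable u -> ubound u X B -> CL1 f ->
  (forall x, n1 (f x) <= K) ->
  RL1 (fun x => n1 (u x * (\1_`[0, X] x)%:C) * K + B * n1 (f x)) /\
  (forall x, n1 (u x * f x) <= n1 (u x * (\1_`[0, X] x)%:C) * K + B * n1 (f x)).
Proof.
move=> gu ub f1 fK; split.
  apply: RL1D; last exact/RL1Zl/RL1_n1.
  by under eq_fun do rewrite mulrC; apply/RL1Zl/RL1_n1; exact: laplaceable_CL1_itv.
move=> x; rewrite (le_trans (n1M _ _))//.
apply: (le_trans (ler_wpM2r (n1_ge0 _) (ubound_split x gu ub))).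
by rewrite mulrDl lerD2r ler_wpM2l ?n1_ge0.
Qed.

Lemma CL1_ubound u X B (f : R -> R[i]) (K : R) : laplaceable u -> ubound u X B -> CL1 f ->
  (forall x, n1 (f x) <= K) -> CL1 (fun x => u x * f x).
Proof.
move=> gu ub f1 fK; have [h1 h2] := conv_dom gu ub f1 fK.
by apply: CL1_dom h2 h1; case: gu => mu0 _ _; exact: cmeasM (CL1_meas f1).
Qed.

Lemma CL1_fourier_shift phi (h : R) : tf phi -> CL1 (fun x => fourier phi (x - h)).
Proof. by move=> tphi; exact: CL1_shift (- h) (CL1_fourier tphi). Qed.

Lemma CL1_conv u X B phi (h : R) : laplaceable u -> ubound u X B -> tf phi ->
  CL1 (fun x => u x * fourier phi (x - h)).
Proof.
move=> gu ub tphi; have [K K0 hK] := fourier_bounded tphi.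
exact: CL1_ubound gu ub (CL1_fourier_shift h tphi) (fun x => hK _).
Qed.

(** With [u] bounded off an integrable head, the undamped integrand has an integrable majorant, and
    dominated convergence removes the damping. *)
Lemma conv_cvg u X B phi (h : R) : laplaceable u -> ubound u X B -> tf phi ->
  ccvg 0^'+ (fun s => CInt (fun x => u x * (expR (- (s * x)))%:C * fourier phi (x - h))) (conv u phi h).
Proof.
move=> gu ub tphi; have [K K0 hK] := fourier_bounded tphi.
have cf := CL1_fourier_shift h tphi.
have [h1 h2] := conv_dom gu ub cf (fun x => hK _).
have F0 : Filter (0 : R)^'+ by exact: at_right_proper_filter.
apply: (CInt_cvg_at_right (f_ := fun s x => u x * (expR (- (s * x)))%:C * fourier phi (x - h)) _ h1).
- move=> s s0; case: gu => mu0 _ _; apply: cmeasM (CL1_meas cf); apply: cmeasM => //.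
  by apply: cmeasC; exact: measurable_expRN.
- move=> s s0 x; apply: le_trans (h2 x); rewrite mulrAC n1MC.
  have [x0|x0] := ltP x 0; first by case: gu => _ -> // _; rewrite mul0r n10 mul0r.
  rewrite ler_piMr ?n1_ge0//.
  by rewrite ger0_norm ?expR_ge0// -expR0 ler_expR oppr_le0 mulr_ge0// ltW.
- move=> x; apply: ccvgM; last exact: ccvg_cst.
  rewrite -[X in ccvg _ _ X]mulr1; apply: ccvgM; first exact: ccvg_cst.
  apply: ccvgC; rewrite -expR0; apply: continuous_cvg; first exact: continuous_expR.
  rewrite -[X in _ --> X]oppr0 -[X in - X](mul0r x); apply: cvgN; apply: cvgMl.
  exact: cvg_at_right_filter.
Qed.

Lemma convD u X B phi chi h : laplaceable u -> ubound u X B -> tf phi -> tf chi ->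
  conv u (fun x => phi x + chi x) h = conv u phi h + conv u chi h.
Proof.
move=> gu ub t1 t2; rewrite /conv -CIntD; [|exact: CL1_conv gu ub _..].
by congr CInt; apply/funext => x; rewrite fourierD// mulrDr.
Qed.

Lemma tf0 : tf (fun=> 0 : R).
Proof. by split; [exact: smooth_cst|exists 0]. Qed.

Lemma tfD phi chi : tf phi -> tf chi -> tf (fun x => phi x + chi x).
Proof.
move=> [s1 [L1 h1]] [s2 [L2 h2]]; split; first exact: smoothD.
by exists (Num.max L1 L2) => x; rewrite gt_max => /andP[/h1-> /h2->]; rewrite addr0.
Qed.

Lemma conv0 u h : conv u (fun=> 0) h = 0.
Proof.
rewrite /conv -[RHS](@CInt0 R); congr CInt; apply/funext => x.
rewrite fourierE -[X in _ * X = _](_ : 0 = _) ?mulr0// -[LHS](@CInt0 R).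
by congr CInt; apply/funext => y; rewrite mul0r.
Qed.

Lemma tf_sum n (f : nat -> R -> R) : (forall k, tf (f k)) -> tf (fun x => \sum_(k < n) f k x).
Proof.
move=> hf; elim: n => [|n IH].
  by under eq_fun do rewrite big_ord0; exact: tf0.
by under eq_fun do rewrite big_ord_recr/=; exact: tfD.
Qed.

Lemma conv_sum u X B n (f : nat -> R -> R) h : laplaceable u -> ubound u X B -> (forall k, tf (f k)) ->
  conv u (fun x => \sum_(k < n) f k x) h = \sum_(k < n) conv u (f k) h.
Proof.
move=> gu ub hf; elim: n => [|n IH].
  by under eq_fun do rewrite big_ord0; rewrite big_ord0 conv0.
under eq_fun do rewrite big_ord_recr/=.
by rewrite (convD _ gu ub (tf_sum n hf) (hf n)) IH big_ord_recr.
Qed.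

Lemma n1_sum n (f : nat -> R[i]) : n1 (\sum_(k < n) f k) <= \sum_(k < n) n1 (f k).
Proof.
elim: n => [|n IH]; first by rewrite !big_ord0 n10.
by rewrite !big_ord_recr/= (le_trans (n1D _ _))// lerD2r.
Qed.

(** For fixed [x] the argument [x - h] tends to minus infinity, and a multiple of the norm of [a]
    dominates. *)
Lemma CInt_shift_cvg0 (a k : R -> R[i]) (K : R) : CL1 a -> cmeas k -> (forall x, n1 (k x) <= K) ->
  ccvg -oo k 0 -> ccvg +oo (fun h => CInt (fun x => a x * k (x - h))) 0.
Proof.
move=> a1 mk kK k0; rewrite -[X in ccvg _ _ X](@CInt0 R).
apply: (CInt_cvg_pinfty (f_ := fun h x => a x * k (x - h)) _ (RL1Zl K (RL1_n1 a1))).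
- move=> h; apply: cmeasM (CL1_meas a1) _; apply: cmeas_comp mk _.
  exact: measurable_funD.
- by move=> h x; rewrite (le_trans (n1M _ _))// mulrC ler_wpM2r ?n1_ge0.
move=> x; rewrite -[X in ccvg _ _ X](mulr0 (a x)); apply: ccvgM; first exact: ccvg_cst.
have xh : x - h @[h --> +oo] --> -oo.
  apply/cvgrNyPlt => M; near=> h; have : x - M < h by near: h; apply: nbhs_pinfty_gt; exact: num_real.
  by lra.
case: k0 => h1 h2; split.
- exact: cvg_comp xh h1.
- exact: cvg_comp xh h2.
Unshelve. all: by end_near. Qed.

Lemma null_eventually u phi : (forall e, 0 < e -> \forall h \near +oo, n1 (conv u phi h) <= e) <-> null u phi.
Proof.
split=> [h|/ccvg_n1P h e /h]; last by under eq_near do rewrite subr0.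
by apply/ccvg_n1P => e /h; under eq_near do rewrite subr0.
Qed.

Lemma null_sum u X B n (f : nat -> R -> R) : laplaceable u -> ubound u X B -> (forall k, tf (f k)) ->
  (forall k, (k < n)%N -> null u (f k)) -> null u (fun x => \sum_(k < n) f k x).
Proof.
move=> gu ub hf hn; rewrite /null (_ : conv u _ = fun h => \sum_(k < n) conv u (f k) h); last first.
  by apply/funext => h; rewrite (conv_sum n h gu ub hf).
elim: n hn => [|n IH] hn.
  by under eq_fun do rewrite big_ord0; exact: ccvg_cst.
under eq_fun do rewrite big_ord_recr/=; rewrite -[X in ccvg _ _ X]addr0.
apply: ccvgD; [apply: IH => k kn|exact: hn].
by apply: hn; exact: ltnW.
Qed.

(** The undamped convolution and the integral against [psi] are limits of the same damped pairing. A
    translation then puts the shift [h] into the argument of [psi], which tends to 0, against a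
    fixed integrable function. *)
Lemma null_pseudofunction u X B V psi phi : laplaceable u -> ubound u X B -> bounded_cfun psi ->
  ccvg +oo psi 0 -> ccvg -oo psi 0 ->
  (forall phi, test_fun V phi ->
     ccvg 0^'+ (fun s => CInt (fun t => lap u s t * (phi t)%:C)) (inv_fourier_pairing psi phi)) ->
  test_fun V phi -> null u phi.
Proof.
move=> gu ub bpsi p1 p2 H tV; have tphi := test_fun_tf tV; have [mpsi [M psiM]] := bpsi.
have F0 : ProperFilter (0 : R)^'+ by exact: at_right_proper_filter.
have cE h : conv u phi h = ((2 * pi)^-1)%:C * CInt (fun x => fourier phi (- x) * psi (x - h)).
  rewrite (ccvg_unique F0 (conv_cvg h gu ub tphi) (pairing_cvg h gu bpsi H tV)).
  congr (_ * _).
  have ci : CL1 (fun x => psi x * fourier phi (- x - h)).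
    under eq_fun do rewrite mulrC [- _ - _]addrC.
    apply: CL1Mb (CL1_flip (- h) (CL1_fourier tphi)) mpsi _ => x.
    exact: n1_normc.
  rewrite -(CInt_shift (- h) ci); congr CInt; apply/funext => x.
  by rewrite mulrC; congr (fourier phi _ * _); ring.
rewrite /null (funext cE).
rewrite -[X in ccvg _ _ X](mulr0 ((2 * pi)^-1)%:C); apply: ccvgM; first exact: ccvg_cst.
apply: (CInt_shift_cvg0 _ mpsi (fun x => n1_normc (psiM x)) p2).
by have := CL1_flip 0 (CL1_fourier tphi); under eq_fun do rewrite sub0r.
Qed.

End Convolution.

(** * Localization and category *)

Section Localization.
Variable R : realType.
Local Notation mu := (@lebesgue_measure R).
Implicit Types (u p : R -> R[i]) (phi : R -> R).

(** The integer translates telescope, so they form a smooth partition of unity. *)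
Definition theta (y : R) : R := step (y + 1) - step y.

Lemma smooth_theta : smooth theta.
Proof.
apply: smoothB; last exact: smooth_step.
by have := @smooth_affine R _ 1 1 (@smooth_step R); under eq_fun do rewrite mul1r.
Qed.

Lemma theta_out y : y < -1 \/ 1 < y -> theta y = 0.
Proof.
rewrite /theta => -[h|h]; last by rewrite !step_1 ?subrr//; lra.
by rewrite !step_0 ?subrr//; lra.
Qed.

Lemma tf_theta : tf theta.
Proof. exact: tf_itv smooth_theta theta_out. Qed.

Lemma sum_theta n (y : R) : \sum_(k < n) theta (y - k%:R) = step (y + 1) - step (y + 1 - n%:R).
Proof.
elim: n => [|n IH]; first by rewrite big_ord0 subr0 subrr.
rewrite big_ord_recr/= IH /theta -natr1; have -> : y - n%:R + 1 = y + 1 - n%:R by ring.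
have -> : y + 1 - (n%:R + 1) = y - n%:R by ring.
by ring.
Qed.

(** The part of [phi] about the node [k * e - L]; the nodes start at the left end of the support. *)
Definition piece phi (L e : R) (k : nat) (x : R) : R := phi x * theta (e^-1 * x + (e^-1 * L - k%:R)).

Lemma smooth_theta_affine (a b : R) : smooth (fun x => theta (a * x + b)).
Proof. exact: smooth_affine smooth_theta. Qed.

Lemma tf_piece phi L e k : tf phi -> tf (piece phi L e k).
Proof. by move=> tphi; exact (tfM tphi (@smooth_theta_affine e^-1 (e^-1 * L - k%:R))). Qed.

Lemma piece_out phi (L e x : R) k : 0 < e -> e < `|x - (k%:R * e - L)| -> piece phi L e k x = 0.
Proof.
move=> e0 h; rewrite /piece theta_out ?mulr0//.
have eV : 0 < e^-1 by rewrite invr_gt0.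
have en0 : e != 0 by rewrite gt_eqF.
have E : e^-1 * x + (e^-1 * L - k%:R) = e^-1 * (x - (k%:R * e - L)) by field.
move: h; rewrite ltr_normr E => /orP[h|h]; [right|left].
- by have := ltr_pM2l eV e (x - (k%:R * e - L)); rewrite mulVf// h.
- have := ltr_pM2l eV e (- (x - (k%:R * e - L))); rewrite mulVf// h mulrN; lra.
Qed.

Lemma piece_sum phi (L e : R) n : 0 < e -> (forall x, L < `|x| -> phi x = 0) ->
  e^-1 * (2 * L) + 1 <= n%:R -> phi = fun x => \sum_(k < n) piece phi L e k x.
Proof.
move=> e0 phi0 hn; apply/funext => x; rewrite -big_distrr/=.
have [xL|xL] := ltP L `|x|; first by rewrite phi0// mul0r.
under eq_bigr do rewrite addrA.
rewrite sum_theta; move: xL; rewrite ler_norml => /andP[h1 h2].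
have eV : 0 < e^-1 by rewrite invr_gt0.
have q1 : 0 <= e^-1 * (x + L) by apply: mulr_ge0; lra.
have q2 : e^-1 * (x + L) <= e^-1 * (2 * L) by apply: ler_wpM2l; lra.
by rewrite -mulrDr step_1 ?step_0 ?subr0 ?mulr1//; lra.
Qed.

(** The regular points of the overview. *)
Definition nullnbhd u (t : R) : Prop :=
  exists V : set R, [/\ open V, V t & forall psi, test_fun V psi -> null u psi].

(** The Lebesgue number of a cover, phrased for all small [e]. The radius [3 * e] leaves room for a
    whole piece of scale [e] whose node is within [e] of [t]. *)
Lemma compact_lebesgue_number (K : set R) (P : set R -> Prop) :
  compact K -> (forall t, K t -> exists V, [/\ open V, V t & P V]) ->
  \forall e \near 0^'+, forall t, K t -> exists V, `[t - 3 * e, t + 3 * e] `<=` V /\ P V.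
Proof.
move=> /compact_near_coveringP cK hP.
have F0 : Filter (0 : R)^'+ by exact: at_right_proper_filter.
apply: (cK R (0 : R)^'+ (fun e t => exists V, `[t - 3 * e, t + 3 * e] `<=` V /\ P V) F0).
move=> t /hP[V [oV Vt PV]].
have := open_nbhs_nbhs (conj oV Vt); rewrite nbhs_ballP => -[r /= r0 hr].
have r2 : 0 < r / 2 by rewrite divr_gt0.
near=> x e; exists V; split => // y; rewrite /= in_itv/= => /andP[h1 h2]; apply: hr.
have xt : `|t - x| < r / 2 by near: x; exact: (nbhsx_ballx t (r / 2) r2).
have er : e < r / 8 by near: e; apply: nbhs_right_lt; rewrite divr_gt0.
move: xt; rewrite /ball/= !ltr_norml => /andP[q1 q2]; apply/andP; split; lra.
Unshelve. all: by end_near. Qed.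

Lemma ceil_nat (y : R) : exists n : nat, y <= n%:R.
Proof.
have [y0|y0] := ltP y 0; first by exists 0%N; exact: ltW.
exists (Num.truncn y).+1; have /andP[_ /ltW] := Num.Theory.truncn_itv y0; exact.
Qed.

Lemma piece_supp phi (L e : R) k t : 0 < e -> piece phi L e k t != 0 ->
  supp phi t /\ `|t - (k%:R * e - L)| <= e.
Proof.
move=> e0 pt; split; last by rewrite leNgt; apply: contra_neqN pt => h; exact: piece_out.
by apply: subset_closure => /=; apply: contra_neq pt; rewrite /piece => ->; rewrite mul0r.
Qed.

(** At a scale below the Lebesgue number of the cover, every nonzero piece of the partition lies in
    a single neighbourhood. *)
Lemma null_of_local u X B phi : laplaceable u -> ubound u X B -> tf phi -> compact (supp phi) ->
  (forall t, supp phi t -> nullnbhd u t) -> null u phi.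
Proof.
move=> gu ub tphi cphi hW; have [_ [L hL]] := tphi.
have := compact_lebesgue_number (P := fun V => forall psi, test_fun V psi -> null u psi) cphi hW.
move=> H; have F0 : ProperFilter (0 : R)^'+ by exact: at_right_proper_filter.
have [e [e0 he]] : exists e : R, 0 < e /\ (forall t, supp phi t ->
    exists V, `[t - 3 * e, t + 3 * e] `<=` V /\ (forall psi, test_fun V psi -> null u psi)).
  by apply: (@filter_ex _ _ F0); near=> e; split => //; near: e; exact: H.
have [n hn] := ceil_nat (e^-1 * (2 * L) + 1).
rewrite (piece_sum e0 hL hn); apply: (null_sum gu ub) => [k|k _]; first exact: tf_piece.
have [[t pt]|np] := pselect (exists t, piece phi L e k t != 0).
  have [st tk] := piece_supp e0 pt; have [V [tV hV]] := he t st; apply: hV.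
  apply: (test_fun_itv (tf_piece L e k tphi).1 (a := k%:R * e - L - e) (b := k%:R * e - L + e)).
    by move=> x h; apply: piece_out => //; rewrite ltr_normr; case: h => h; apply/orP; [right|left]; lra.
  apply: subset_trans tV => x; rewrite /= !in_itv/= => /andP[h1 h2].
  by move: tk; rewrite ler_norml => /andP[q1 q2]; apply/andP; split; lra.
rewrite (_ : piece phi L e k = fun=> 0); last first.
  by apply/funext => x; apply/eqP/negPn/negP => h; apply: np; exists x.
by apply/null_eventually => d d0; near=> h; rewrite conv0 n10 ltW.
Unshelve. all: by end_near. Qed.

(** Intersecting with []-oo, a + n * e[] is what lets the induction run: the next interval is
    disjoint from the part already counted. *)
Lemma measure_disjoint_itv (O : set R) (a e : R) n (bad : pred nat) : open O -> 0 < e ->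
  (forall k, (k < n)%N -> bad k -> `[a + k%:R * e, a + k.+1%:R * e[ `<=` O) ->
  ((\sum_(k < n | bad k) e)%:E <= mu (O `&` `]-oo, (a + n%:R * e)%R[))%E.
Proof.
move=> oO e0; have mO : measurable O by exact: open_measurable.
elim: n => [|n IH] h; first by rewrite big_ord0 measure_ge0.
rewrite big_mkcond big_ord_recr/= -big_mkcond EFinD.
have {}IH := IH (fun k kn => h k (ltnW kn)).
set A := O `&` _ in IH *; set A' := (X in (_ <= mu X)%E).
have mA : measurable A by apply: measurableI.
have mA' : measurable A' by apply: measurableI.
have e' : a + n.+1%:R * e = a + n%:R * e + e by rewrite -natr1; ring.
case: ifPn => [bn|_]; last first.
  rewrite adde0; apply: (le_trans IH); apply: le_measure; rewrite ?inE//.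
  by move=> x [Ox]; rewrite /= in_itv/= => hx; split => //; rewrite /= in_itv/= e'; lra.
have I := h n (ltnSn n) bn.
have Ie : mu `[a + n%:R * e, a + n.+1%:R * e[%classic = e%:E.
  by rewrite lebesgue_measure_itv/= lte_fin e' ltrDl e0 -EFinB; congr EFin; lra.
rewrite -Ie; apply: (le_trans (leeD IH (lexx _))).
rewrite -measureU//; last first.
  by apply/seteqP; split => // x [[_]]; rewrite /= !in_itv/= => h1 /andP[h2 _]; lra.
apply: le_measure; rewrite ?inE//; first exact: measurableU.
move=> x [[Ox]|hx]; first by rewrite /= in_itv/= => hx; split => //; rewrite /= in_itv/= e'; lra.
split; first exact: I.
by move: hx; rewrite /= !in_itv/= => /andP[].
Qed.

Lemma derive1M (f g : R -> R) : smooth f -> smooth g ->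
  derive1 (fun x => f x * g x) = fun x => derive1 f x * g x + f x * derive1 g x.
Proof.
move=> sf sg.
have [_ ->] := is_derive_all (fun x => is_deriveM (smooth_is_derive x sf) (smooth_is_derive x sg)).
by apply/funext => x; rewrite /GRing.scale/=; ring.
Qed.

Lemma derive1D (f g : R -> R) : smooth f -> smooth g ->
  derive1 (fun x => f x + g x) = fun x => derive1 f x + derive1 g x.
Proof.
move=> sf sg.
by have [_ ->] := is_derive_all (fun x => is_deriveD (smooth_is_derive x sf) (smooth_is_derive x sg)).
Qed.

Lemma derive1_affine_comp (f : R -> R) (a b : R) : smooth f ->
  derive1 (fun x => f (a * x + b)) = fun x => a * derive1 f (a * x + b).
Proof.
move=> sf.
by have [_ ->] := is_derive_all (fun x => is_derive_comp_affine (smooth_is_derive (a * x + b) sf)).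
Qed.

Lemma derive2_affine_comp (f : R -> R) (a b : R) : smooth f ->
  derive1 (derive1 (fun x => f (a * x + b))) = fun x => a * a * derive1 (derive1 f) (a * x + b).
Proof.
move=> sf; rewrite derive1_affine_comp//; have sf' := smooth_derive1 sf.
have sa := @smooth_affine R _ a b sf'.
rewrite (derive1M (@smooth_cst R a) sa) (derive1_affine_comp a b sf').
have [_ ->] := is_derive_all (fun x : R => is_derive_cst a x 1).
by apply/funext => x; ring.
Qed.

Lemma derive1_lin (t0 : R) : derive1 (fun x : R => x - t0) = fun=> 1.
Proof.
have [_ h] := is_derive_all (fun x : R => is_derive_affine 1 (- t0) x).
by rewrite -h; congr derive1; apply/funext => x; rewrite mul1r.
Qed.

Lemma smooth_lin (t0 : R) : smooth (fun x : R => x - t0).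
Proof. by have := @smooth_affine R _ 1 (- t0) (@smooth_id R); under eq_fun do rewrite mul1r. Qed.

Lemma derive2_mul3 (f g : R -> R) (t0 : R) : smooth f -> smooth g ->
  derive1 (derive1 (fun x => f x * g x * (x - t0))) = fun x =>
    (derive1 (derive1 f) x * g x + 2 * (derive1 f x * derive1 g x) + f x * derive1 (derive1 g) x) * (x - t0) +
    2 * (derive1 f x * g x + f x * derive1 g x).
Proof.
move=> sf sg; have sl := @smooth_lin t0.
have sf' := smooth_derive1 sf; have sg' := smooth_derive1 sg.
rewrite (derive1M (smoothM sf sg) sl) derive1_lin (derive1M sf sg).
rewrite derive1D; last 2 first.
- exact: (smoothM (smoothD (smoothM sf' sg) (smoothM sf sg')) sl).
- exact: (smoothM (smoothM sf sg) (@smooth_cst R 1)).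
rewrite (derive1M (smoothD (smoothM sf' sg) (smoothM sf sg')) sl) derive1_lin.
rewrite (derive1D (smoothM sf' sg) (smoothM sf sg')) (derive1M sf' sg) (derive1M sf sg').
rewrite (_ : (fun x => f x * g x * 1) = fun x => f x * g x); last by apply/funext => x; rewrite mulr1.
rewrite (derive1M sf sg); apply/funext => x.
move: (derive1 (derive1 f) x) (derive1 (derive1 g) x) (derive1 f x) (derive1 g x) (f x) (g x) => *; ring.
Qed.

(** [lap_pairing_div] in the limit: all three pairings converge, so the term with the factor [s]
    disappears. *)
Lemma conv_prim_at u X B t0 (n : R) phi h : laplaceable u -> ubound u X B -> tf phi -> 0 <= n ->
  (forall x, n1 (prim_at t0 u x) <= n) ->
  conv u phi h = 'i * conv (fun x => prim_at t0 u x * cis (t0 * x)) (fun t => phi t * (t - t0)) h.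
Proof.
move=> gu ub tphi n0 hn; have gp := laplaceable_cis t0 (laplaceable_prim_at t0 gu).
have ubp : ubound (fun x => prim_at t0 u x * cis (t0 * x)) 0 (n * 2).
  split; rewrite ?mulr_ge0// => x _.
  by rewrite (le_trans (n1M _ _))// ler_pM ?n1_ge0 ?n1_cis.
have tl := tfM tphi (@smooth_lin t0).
have F0 : ProperFilter (0 : R)^'+ by exact: at_right_proper_filter.
apply: (ccvg_unique F0 (conv_cvg h gu ub tphi)).
have c1 := conv_cvg h gp ubp tphi; have c2 := conv_cvg h gp ubp tl.
have c0 : ccvg 0^'+ (fun s : R => s%:C) 0.
  by apply: ccvgC; apply: cvg_at_right_filter.
have := ccvgD F0 (ccvgM F0 c0 c1) (ccvgM F0 (ccvg_cst F0 'i) c2); rewrite mul0r add0r.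
apply: ccvg_near; near=> s; have s0 : 0 < s by [].
by rewrite (lap_pairing_div h gu gp s0 tphi (fun t => lap_prim_at t0 t gu s0)).
Unshelve. all: by end_near. Qed.

Lemma n1_conv_le u phi (n h : R) : cmeas u -> (forall x, n1 (u x) <= n) -> tf phi ->
  n1 (conv u phi h) <= n * RInt (fun x => n1 (fourier phi x)).
Proof.
move=> mu0 hn tphi.
have r1 := RL1_n1 (CL1_fourier tphi).
rewrite -(RInt_shift (- h) r1) -RIntZl; last exact: RL1_shift (- h) r1.
apply: n1_CInt_dom.
- exact: cmeasM mu0 (CL1_meas (CL1_fourier_shift h tphi)).
- by move=> x; rewrite (le_trans (n1M _ _))// ler_wpM2r ?n1_ge0.
- exact/RL1Zl/(RL1_shift (- h) r1).
Qed.

(* The factor [t - t0] is of size [e] on the piece, and compensates the loss of [e^-1] in the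
   [L1]-norm of the Fourier transform caused by cutting at scale [e]. *)
Lemma conv_piece_le u X B phi L (n : R) : laplaceable u -> ubound u X B -> tf phi -> 0 <= n ->
  exists2 C : R, 0 <= C & forall (e : R) k t0 h, 0 < e <= 1 -> `|t0 - (k%:R * e - L)| <= e ->
    (forall x, n1 (prim_at t0 u x) <= n) -> n1 (conv u (piece phi L e k) h) <= C * e.
Proof.
move=> gu ub tphi n0.
have bd f : tf f -> exists2 M : R, 0 < M & forall x, [/\ `|f x| <= M, `|derive1 f x| <= M & `|derive1 (derive1 f) x| <= M].
  move=> tff; have [M1 m1 h1] := tf_bounded tff.
  have [M2 m2 h2] := tf_bounded (tf_derive1 tff).
  have [M3 m3 h3] := tf_bounded (tf_derive1 (tf_derive1 tff)).
  exists (M1 + M2 + M3) => [|x]; first by rewrite !addr_gt0.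
  by split; [have := h1 x|have := h2 x|have := h3 x]; lra.
have [A A0 hA] := bd _ tphi; have [T T0 hT] := bd _ tf_theta.
pose W := RInt (@weight R); have W0 : 0 <= W by exact: RInt_weight_ge0.
(* 56 is [2 * (2 + 12) * 2]: the bounds [b1] and [b2] are inserted in [fourier_L1] on an interval of
   length [2 * e]. The factor [n * 2] bounds the primitive times [cis]. *)
exists (n * 2 * (56 * (A * T * W))) => [|e k t0 h /andP[e0 e1] tk hn].
  by rewrite !mulr_ge0// ltW.
set xk := k%:R * e - L in tk.
have tp := tf_piece L e k tphi.
rewrite (conv_prim_at h gu ub tp n0 hn) (le_trans (n1M _ _))//.
rewrite (_ : n1 'i = 1) ?mul1r; last by rewrite /n1 ReI ImI normr0 add0r normr1.
have tl := tfM tp (@smooth_lin t0).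
have gp := laplaceable_cis t0 (laplaceable_prim_at t0 gu).
apply: (le_trans (n1_conv_le h _ _ tl (n := n * 2))).
- by case: gp.
- by move=> x; rewrite (le_trans (n1M _ _))// ler_pM ?n1_ge0 ?n1_cis.
rewrite -[leRHS]mulrA; apply: ler_wpM2l; first by rewrite mulr_ge0.
have out x : x < xk - e \/ xk + e < x -> piece phi L e k x * (x - t0) = 0.
  move=> hx; rewrite piece_out ?mul0r// ltr_normr -/xk.
  by case: hx => hx; apply/orP; [right|left]; lra.
have inn x : ~ (x < xk - e \/ xk + e < x) -> `|x - t0| <= 2 * e.
  move=> /not_orP[/negP + /negP]; rewrite -!leNgt => h1 h2.
  by move: tk; rewrite !ler_norml => /andP[q1 q2]; apply/andP; split; lra.
have AT0 : 0 <= A * T by rewrite mulr_ge0// ltW.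
have out2 := derive1_eq0_out (smooth_derive1 tl.1) (derive1_eq0_out tl.1 out).
have ab : xk - e <= xk + e by lra.
have b1 x : `|piece phi L e k x * (x - t0)| <= A * T * (2 * e).
  have [/out ->|/inn hx] := pselect (x < xk - e \/ xk + e < x).
    by rewrite normr0 !mulr_ge0// ltW.
  rewrite normrM ler_pM// normrM ler_pM//; first by case: (hA x).
  by case: (hT (e^-1 * x + (e^-1 * L - k%:R))).
have eV : 1 <= e^-1 by rewrite invf_ge1.
(* 12 is [8 + 4]: the second derivative of the product is at most [4 * e^-1 ^+ 2] and meets the
   linear factor [2 * e], and the cross term gives [4 * e^-1], all in units of [A * T] and using
   [1 <= e^-1]. *)
have b2 x : `|derive1 (derive1 (fun t => piece phi L e k t * (t - t0))) x| <= A * T * 12 * e^-1.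
  have [/out2 ->|/inn hx] := pselect (x < xk - e \/ xk + e < x).
    by rewrite normr0; apply: mulr_ge0; [exact: mulr_ge0|exact: le_trans ler01 eV].
  have sth := @smooth_theta_affine e^-1 (e^-1 * L - k%:R).
  rewrite (derive2_mul3 t0 tphi.1 sth).
  rewrite (derive2_affine_comp _ _ smooth_theta) (derive1_affine_comp _ _ smooth_theta).
  have [p0 p1 p2] := hA x; have [q0 q1 q2] := hT (e^-1 * x + (e^-1 * L - k%:R)).
  have -> : A * T * 12 * e^-1 = A * T * (8 * e^-1 + 4 * e^-1) by ring.
  move: p0 p1 p2 q0 q1 q2 hx; move: (phi x) (derive1 phi x) (derive1 (derive1 phi) x) (x - t0).
  move: (e^-1 * x + _) => y f0 f1 f2 d; move: (theta y) (derive1 theta y) (derive1 (derive1 theta) y).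
  move=> g0 g1 g2 p0 p1 p2 q0 q1 q2 hd.
  have le1 : e^-1 * e = 1 by rewrite mulVf// gt_eqF.
  have m (a b : R) : `|a| <= A -> `|b| <= T -> `|a * b| <= A * T.
    by move=> *; rewrite normrM ler_pM.
  have l0 : 0 <= e^-1 by exact: le_trans ler01 eV.
  move: (m _ _ p2 q0) (m _ _ p1 q1) (m _ _ p0 q2) (m _ _ p1 q0) (m _ _ p0 q1).
  rewrite (_ : (_ * d + _) = (f2 * g0 + 2 * e^-1 * (f1 * g1) + e^-1 ^+ 2 * (f0 * g2)) * d +
    2 * (f1 * g0 + e^-1 * (f0 * g1))); last by ring.
  move: (f2 * g0) (f1 * g1) (f0 * g2) (f1 * g0) (f0 * g1) (A * T) AT0 => m1 m2 m3 m4 m5 P P0.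
  move: (e^-1) le1 eV l0 => l le1 l1 l0 h1 h2 h3 h4 h5.
  have r1 : `|m1 + 2 * l * m2 + l ^+ 2 * m3| <= P * (4 * l ^+ 2).
    have t1 : `|2 * l * m2| <= 2 * l * P by rewrite normrM ger0_norm ?mulr_ge0// ler_wpM2l// mulr_ge0.
    have t2 : `|l ^+ 2 * m3| <= l ^+ 2 * P by rewrite normrM ger0_norm ?sqr_ge0// ler_wpM2l// sqr_ge0.
    have := ler_normD (m1 + 2 * l * m2) (l ^+ 2 * m3); have := ler_normD m1 (2 * l * m2).
    have w1 : P <= l ^+ 2 * P by rewrite ler_peMl// expr_ge1.
    have w2 : l * P <= l ^+ 2 * P by rewrite ler_wpM2r// expr2 ler_peMl.
    by clear -h1 t1 t2 w1 w2; lra.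
  have r2 : `|m4 + l * m5| <= P * (2 * l).
    have t1 : `|l * m5| <= l * P by rewrite normrM ger0_norm// ler_wpM2l.
    have := ler_normD m4 (l * m5); have w1 : P <= l * P by rewrite ler_peMl.
    by clear -h4 t1 w1; lra.
  rewrite (le_trans (ler_normD _ _))// [leRHS]mulrDr lerD//.
    rewrite normrM (le_trans (ler_pM _ _ r1 hd))//.
    have -> : P * (4 * l ^+ 2) * (2 * e) = P * (8 * l) * (l * e) by ring.
    by rewrite le1 mulr1.
  rewrite normrM ger0_norm// (_ : P * (4 * l) = 2 * (P * (2 * l))); last by ring.
  by rewrite ler_wpM2l.
have := @fourier_L1 R _ (xk - e) (xk + e) _ _ e e0 ab tl.1 out b1 b2.
move=> /le_trans; apply; rewrite -/W.
have en0 : e != 0 by rewrite gt_eqF.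
rewrite le_eqVlt; apply/orP; left; apply/eqP; field.
by [].
Qed.

(** The order of choices matters: the open set [Q], then the scale [e], then the number of pieces
    are fixed before [h] grows. The bad pieces are bounded uniformly in [h], and the good ones,
    being finitely many, are each eventually below the share [d / 2 / N.+1]. *)
Lemma null_of_prim_at_bounded u X B phi (S : set R) (n : R) : laplaceable u -> ubound u X B -> tf phi ->
  compact (supp phi) -> closed S -> mu (S `&` supp phi) = 0%E -> 0 <= n ->
  (forall t, supp phi t -> ~ S t -> nullnbhd u t) ->
  (forall t, S t -> supp phi t -> forall x, n1 (prim_at t u x) <= n) -> null u phi.
Proof.
move=> gu ub tphi cphi cS nS n0 hW hS; have [_ [L hL]] := tphi.
have [C C0 hC] := conv_piece_le L gu ub tphi n0.
have cK : compact (S `&` supp phi) by rewrite setIC; exact: compact_closedI.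
have mK : measurable (S `&` supp phi).
  by apply: closed_measurable; apply: compact_closed => //; exact: norm_hausdorff.
apply/null_eventually => d d0.
have C10 : 0 < C + 1 by rewrite ltr_pwDr.
(* Division by [C + 1], since [C] may be 0. *)
have dC : 0 < d / 2 / (C + 1) by rewrite divr_gt0// divr_gt0.
have [Q [oQ KQ mQ]] : exists Q : set R, [/\ open Q, S `&` supp phi `<=` Q & (mu Q <= (d / 2 / (C + 1))%:E)%E].
  have fK : (mu (S `&` supp phi) < +oo)%E by rewrite nS ltry.
  have [Q [oQ KQ mQ]] := lebesgue_regularity_outer mK fK dC.
  exists Q; split => //.
  have mQ' := open_measurable oQ; rewrite -(setDUK KQ).
  apply: (le_trans (measureU2 _ _ _)) => //; first exact: measurableD.
  rewrite -[leRHS]add0e; apply: leeD; [by rewrite -nS|exact: ltW].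
have H := compact_lebesgue_number (P := fun V => V = Q) cK (fun t Kt => ex_intro _ Q (And3 oQ (KQ t Kt) erefl)).
have F0 : ProperFilter (0 : R)^'+ by exact: at_right_proper_filter.
have [e [e0 e1 he]] : exists e : R, [/\ 0 < e, e <= 1 & (forall t, (S `&` supp phi) t -> `[t - 3 * e, t + 3 * e] `<=` Q)].
  apply: (@filter_ex _ _ F0); near=> e; split => //; first by near: e; exact: nbhs_right_le.
  have h : forall t, (S `&` supp phi) t -> exists V, `[t - 3 * e, t + 3 * e] `<=` V /\ V = Q by near: e; exact: H.
  by move=> t /h[V [tV <-]].
have [N hN] := ceil_nat (e^-1 * (2 * L) + 1).
pose bad k := `[< exists2 t, (S `&` supp phi) t & `|t - (k%:R * e - L)| <= e >].
have ht k := tf_piece L e k tphi.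
have good k : ~~ bad k -> null u (piece phi L e k).
  move=> /asboolPn nb; have tp := tf_test_fun (ht k); have [_ [cp _]] := tp.
  apply: (null_of_local gu ub (ht k) cp) => t pt.
  have sub : supp (piece phi L e k) `<=` supp phi.
    by apply: closure_subset => x /=; apply: contra_neq; rewrite /piece => ->; rewrite mul0r.
  apply: hW; first exact: sub.
  move=> St; apply: nb; exists t; first by split => //; exact: sub.
  have cl := @closed_closed_ball_ R R (k%:R * e - L) e.
  have : closed_ball_ Num.Def.normr (k%:R * e - L) e t; last by rewrite /closed_ball_/= distrC.
  apply: cl; apply: closure_subset pt => x /= px.
  by rewrite /closed_ball_/= distrC; have [] := piece_supp e0 px.
have N0 : 0 < N.+1%:R :> R by rewrite ltr0n.
have ev (k : nat) : \forall h \near +oo, n1 (conv u (piece phi L e k) h) <= C * (if bad k then e else 0) + d / 2 / N.+1%:R.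
  have d20 : 0 < d / 2 / N.+1%:R by rewrite divr_gt0// divr_gt0.
  case: ifPn => [/asboolP[t Kt tk]|/good/null_eventually/(_ _ d20)]; last by rewrite mulr0 add0r.
  near=> h; apply: ler_wpDr; first exact: ltW.
  by apply: (hC _ _ t); [rewrite e0|exact: tk|case: Kt => *; exact: hS].
have ev' : \forall h \near +oo, forall k : 'I_N, n1 (conv u (piece phi L e k) h) <= C * (if bad k then e else 0) + d / 2 / N.+1%:R.
  by apply: filter_forall => k; exact: ev.
near=> h; rewrite (piece_sum e0 hL hN) (conv_sum N h gu ub ht).
apply: (le_trans (@n1_sum R N (fun k => conv u (piece phi L e k) h))).
have hh : forall k : 'I_N, n1 (conv u (piece phi L e k) h) <= C * (if bad k then e else 0) + d / 2 / N.+1%:R by near: h.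
apply: (le_trans (ler_sum _ (fun k _ => hh k))).
rewrite big_split/= -big_distrr/= sumr_const card_ord -big_mkcond/=.
have q1 : \sum_(k < N | bad k) e <= d / 2 / (C + 1).
  rewrite -lee_fin; apply: le_trans mQ.
  (* The pieces overlap, so lengths are counted on the disjoint half-open intervals of length [e]
     centred at the nodes, whence the offset [e / 2]. *)
  apply: le_trans (measure_disjoint_itv (a := - L - e / 2) (bad := bad) oQ e0 _) _; last first.
    by apply: le_measure; rewrite ?inE//; [apply: measurableI => //; exact: open_measurable|exact: open_measurable].
  move=> k _ /asboolP[t Kt tk] x; rewrite /= in_itv/= -[k.+1%:R]natr1 mulrDl mul1r => /andP[w1 w2]; apply: (he t Kt).
  by move: tk; rewrite /= in_itv/= ler_norml; clear -w1 w2 e0 => /andP[w3 w4]; apply/andP; split; lra.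
have q2 : C * (\sum_(k < N | bad k) e) <= d / 2.
  apply: (le_trans (ler_wpM2l C0 q1)).
  rewrite mulrCA ler_piMr//; first by rewrite ltW// divr_gt0.
  by rewrite ler_pdivrMr// mul1r lerDl.
have q3 : d / 2 / N.+1%:R *+ N <= d / 2.
  rewrite -mulr_natr -mulrA ler_piMr//; first by rewrite ltW// divr_gt0.
  by rewrite mulrC ler_pdivrMr// mul1r ler_nat.
by rewrite [leRHS]splitr lerD.
Unshelve. all: by end_near. Qed.

(* Baire category on the closed set [S]: nested intervals centred on [S] avoiding [En 0], ..., [En n]. *)
Lemma baire_interval (S : set R) (En : nat -> set R) : closed S -> S !=set0 ->
  (forall n c, ~ En n c -> exists2 d : R, 0 < d & forall t, `|t - c| < d -> ~ En n t) ->
  (forall t, S t -> exists n, En n t) ->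
  exists n c (r : R), [/\ S c, 0 < r & forall t, S t -> `|t - c| < r -> En n t].
Proof.
move=> cS [s0 Ss0] oE SE; apply: contrapT => nex.
have step n (p : R * R) : exists q : R * R, S p.1 /\ 0 < p.2 ->
   [/\ S q.1, 0 < q.2, q.2 <= n.+1%:R^-1, `|q.1 - p.1| + q.2 < p.2 & forall t, `|t - q.1| <= q.2 -> ~ En n t].
  have [[Sp p0]|np] := pselect (S p.1 /\ 0 < p.2); last by exists p => /np.
  have [t [St tp nE]] : exists t, [/\ S t, `|t - p.1| < p.2 & ~ En n t].
    apply: contrapT => h; apply: nex; exists n, p.1, p.2; split => // t St tp.
    by apply: contrapT => nE; apply: h; exists t.
  have [d d0 hd] := oE n t nE.
  (* The three bounds on the radius make it shrink to 0, avoid [En n], and nest in the previous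
     interval. *)
  exists (t, Num.min n.+1%:R^-1 (Num.min (d / 2) ((p.2 - `|t - p.1|) / 2))) => _ /=.
  have n0 : 0 < n.+1%:R^-1 :> R by rewrite invr_gt0 ltr0n.
  have pp : 0 < (p.2 - `|t - p.1|) / 2 by rewrite divr_gt0// subr_gt0.
  split => //.
  - by rewrite !lt_min n0 pp divr_gt0.
  - by rewrite ge_min lexx.
  - have : Num.min n.+1%:R^-1 (Num.min (d / 2) ((p.2 - `|t - p.1|) / 2)) <= (p.2 - `|t - p.1|) / 2.
      by rewrite !ge_min lexx !orbT.
    lra.
  - move=> x hx; apply: hd; apply: (le_lt_trans hx); rewrite !gt_min; apply/orP; right.
    by apply/orP; left; rewrite ltr_pdivrMr// ltr_pMr// ltr1n.
have {step} /choice[f hf] : forall n, exists f : R * R -> R * R, forall p : R * R, S p.1 /\ 0 < p.2 ->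
   [/\ S (f p).1, 0 < (f p).2, (f p).2 <= n.+1%:R^-1, `|(f p).1 - p.1| + (f p).2 < p.2 & forall t, `|t - (f p).1| <= (f p).2 -> ~ En n t].
  by move=> n; have /choice[f hf] := step n; exists f.
pose q := fix q n := if n is m.+1 then f m (q m) else (s0, 1).
have hq n : S (q n).1 /\ 0 < (q n).2.
  by elim: n => [|n /(hf n)[]//]; split.
have hd n := hf n _ (hq n).
have mono m n : (m <= n)%N -> `|(q n).1 - (q m).1| + (q n).2 <= (q m).2.
  elim: n => [|n IH]; first by rewrite leqn0 => /eqP ->; rewrite subrr normr0 add0r.
  rewrite leq_eqVlt => /orP[/eqP ->|]; first by rewrite subrr normr0 add0r.
  rewrite ltnS => /IH; have [_ _ _ + _] := hd n; rewrite -/(q n.+1) => h1 h2.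
  have := ler_distD (q n).1 (q n.+1).1 (q m).1; lra.
have lr m n : (q n).1 - (q n).2 <= (q m).1 + (q m).2.
  have r0 k : 0 < (q k).2 by case: (hq k).
  have [mn|/ltnW nm] := leqP m n.
    by have := mono _ _ mn; have := ler_norm ((q n).1 - (q m).1); have := r0 n; lra.
  by have := mono _ _ nm; have := ler_norm ((q n).1 - (q m).1); have := r0 m; rewrite distrC; lra.
(* Every left end lies below every right end, so the supremum of the left ends is common to all the
   intervals. *)
pose A := range (fun n => (q n).1 - (q n).2).
have hA : has_sup A.
  split; first by exists ((q 0%N).1 - (q 0%N).2), 0%N.
  by exists ((q 0%N).1 + (q 0%N).2) => _ [n _ <-]; exact: lr.
pose l := sup A.
have lim_in m : `|l - (q m).1| <= (q m).2.
  have h1 : (q m).1 - (q m).2 <= l by apply: sup_upper_bound => //; exists m.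
  have h2 : l <= (q m).1 + (q m).2.
    by apply: ge_sup; [case: hA|move=> _ [n _ <-]; exact: lr].
  by rewrite ler_norml; apply/andP; split; lra.
have Sl : S l.
  apply: contrapT => nS; have oS := closed_openC cS.
  have := open_nbhs_nbhs (conj oS nS : open_nbhs l (~` S)); rewrite nbhs_ballP => -[d /= d0 hd0].
  have [m hm] := ceil_nat d^-1.
  have [Sm _ rm _ _] := hd m; rewrite -/(q m.+1) in Sm rm.
  apply: (hd0 (q m.+1).1) => //=; rewrite /ball/=.
  apply: (le_lt_trans (lim_in m.+1)); apply: (le_lt_trans rm).
  rewrite invf_plt ?posrE ?ltr0n//; apply: (le_lt_trans hm).
  by rewrite ltr_nat.
have [n En_] := SE _ Sl; have [_ _ _ _ h] := hd n.
exact: h (lim_in n.+1) En_.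
Qed.

End Localization.

(** * The Tauberian direction *)

Section Core.
Variable R : realType.
Local Notation mu := (@lebesgue_measure R).
Implicit Types (u p : R -> R[i]) (phi : R -> R) (G : R -> R -> R[i]).

(** Local form of the boundary hypotheses, in which the limiting distribution is replaced by the
    pairing that represents it on [V]. *)
Definition boundary_pairing G (V : set R) (psi : R -> R[i]) : Prop := forall phi, test_fun V phi ->
  ccvg 0^'+ (fun s => CInt (fun x => G s x * (phi x)%:C)) (inv_fourier_pairing psi phi).

Definition pm_at G (t : R) : Prop := exists V psi,
  [/\ open V, V t, bounded_cfun psi & boundary_pairing G V psi].

Definition pf_at G (t : R) : Prop := exists V psi,
  [/\ open V, V t, bounded_cfun psi, ccvg +oo psi 0 /\ ccvg -oo psi 0 & boundary_pairing G V psi].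

Lemma pf_at_pm G t : pf_at G t -> pm_at G t.
Proof. by move=> [V [psi [oV Vt bpsi _ H]]]; exists V, psi. Qed.

Lemma lip_le (f df : R -> R) (K a b : R) : (forall x : R, is_derive x 1 f (df x)) ->
  (forall x, `|df x| <= K) -> `|f a - f b| <= K * `|a - b|.
Proof.
move=> fd df1; wlog ab : a b / a <= b.
  by move=> W; have [/W//|/ltW/W] := leP a b; rewrite distrC [`|a - b|]distrC.
have [|c _ fE] := MVT_segment ab (fun x _ => fd x).
  by apply: continuous_subspaceT => x; apply: is_derive_continuous.
by rewrite distrC fE normrM [`|a - b|]distrC ler_wpM2r.
Qed.

Lemma n1_cisB (a b : R) : n1 (cis a - cis b) <= 2 * `|a - b|.
Proof.
rewrite /n1 !cE /cis !xE.
have h1 : `|cos a - cos b| <= 1 * `|a - b|.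
  by apply: (lip_le (df := fun x => - sin x)) => x; rewrite normrN ler_norml sin_le1 sin_geN1.
have h2 : `|sin a - sin b| <= 1 * `|a - b|.
  by apply: (lip_le (df := cos)) => x; rewrite ler_norml cos_le1 cos_geN1.
lra.
Qed.

(** Provides the continuity in [t], at each fixed [x], on which the category argument rests; the
    constant may grow with [x]. *)
Lemma prim_at_lip u (t c x : R) : laplaceable u ->
  n1 (prim_at t u x - prim_at c u x) <=
  `|t - c| * (2 * `|x| * RInt (fun v => n1 (u v * (\1_`[0, x] v)%:C))).
Proof.
move=> gu; have c1 := laplaceable_CL1_itv x (laplaceable_cis (- t) gu).
have c2 := laplaceable_CL1_itv x (laplaceable_cis (- c) gu).
have c0 := RL1_n1 (laplaceable_CL1_itv x gu).
rewrite /prim_at !primE -CIntB// mulrA -RIntZl//.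
apply: n1_CInt_dom; [exact: CL1_meas (CL1B c1 c2)| |exact: RL1Zl].
move=> v; rewrite -mulrBl -mulrBr mulrAC (le_trans (n1M _ _))// mulrC.
rewrite indicE; have [|_] := boolP (v \in _); last by rewrite mulr0 n10 !mulr0.
rewrite inE/= in_itv/= => /andP[v0 vx].
apply: ler_wpM2r; first exact: n1_ge0.
apply: (le_trans (n1_cisB _ _)).
have -> : - t * v - - c * v = - ((t - c) * v) by ring.
rewrite normrN normrM mulrCA ler_wpM2l// ler_wpM2l//.
by rewrite (ger0_norm v0) (le_trans vx)// ler_norm.
Qed.

Lemma nullnbhd_open u : open [set t | nullnbhd u t].
Proof.
rewrite openE => t [V [oV Vt hV]].
by apply: filterS (open_nbhs_nbhs (conj oV Vt)) => x Vx; exists V.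
Qed.

Lemma nullnbhd_pf u X B t : laplaceable u -> ubound u X B -> pf_at (lap u) t -> nullnbhd u t.
Proof.
move=> gu ub [V [psi [oV Vt bpsi [p1 p2] H]]]; exists V; split => // phi tV.
exact: null_pseudofunction gu ub bpsi p1 p2 H tV.
Qed.

Lemma pm_prim_at u t V psi : laplaceable u ->
  boundary_pairing (fun s x => lap u s x / (s +i* (x - t))) V psi ->
  boundary_pairing (lap (fun x => prim_at t u x * cis (t * x))) V psi.
Proof.
move=> gu H phi tV; apply: ccvg_near (H phi tV); near=> s.
have s0 : 0 < s by [].
by congr CInt; apply/funext => x; rewrite lap_prim_at.
Unshelve. all: by end_near. Qed.

Lemma lap_bounded u : laplaceable u ->
  sdec (fun x => complex.Re (u x)) -> sdec (fun x => complex.Im (u x)) ->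
  (pm_at (lap u) 0 \/ pm_at (fun s x => lap u s x / (s +i* (x - 0))) 0) ->
  exists X B, ubound u X B.
Proof.
move=> gu s1 s2 [|] [V [psi [oV V0 bpsi H]]]; apply: (sdec_bounded gu s1 s2 oV V0) => phi tV.
  exact: pairing_bounded gu bpsi H tV.
have gp := laplaceable_cis 0 (laplaceable_prim_at 0 gu).
have H' := pm_prim_at gu H.
apply: (kbounded_div gu (test_fun_tf tV) (pairing_bounded gp bpsi H' tV)).
exact: (pairing_bounded gp bpsi H' (test_funM tV (@smooth_lin R 0))).
Qed.

Lemma null_everywhere u X B (E : set R) : laplaceable u -> ubound u X B -> closed E -> mu E = 0%E ->
  (forall t, ~ E t -> pf_at (lap u) t) ->
  (forall t, E t -> pm_at (fun s x => lap u s x / (s +i* (x - t))) t) ->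
  forall phi, tf phi -> null u phi.
Proof.
move=> gu ub cE0 nE hpf hpm.
have bE t : E t -> exists n : nat, forall x, n1 (prim_at t u x) <= n%:R.
  move=> Et; have [V [psi [oV Vt bpsi H]]] := hpm t Et.
  have gp := laplaceable_cis t (laplaceable_prim_at t gu); have [X0 B0 hB] := ub.
  have [B' hB'] := prim_at_bounded gu X0 hB oV Vt (fun phi tV => pairing_bounded gp bpsi (pm_prim_at gu H) tV).
  by have [n hn] := ceil_nat B'; exists n => x; exact: le_trans (hB' x) hn.
pose S := ~` [set t | nullnbhd u t].
have cS : closed S by apply: open_closedC; exact: nullnbhd_open.
have SE : S `<=` E.
  by move=> t St; apply: contrapT => nEt; apply: St; exact: nullnbhd_pf gu ub (hpf t nEt).
have S0 : ~ (S !=set0).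
  move=> Sn.
  have [||n [c [r [Sc r0 hr]]]] := @baire_interval _ S (fun n => [set t | forall x, n1 (prim_at t u x) <= n%:R]) cS Sn.
  (* A violation of the bound at a single [x] persists for all [t] near [c]. *)
  - move=> n c /existsNP[x /negP]; rewrite -ltNge => hx.
    set K := 2 * `|x| * RInt (fun v => n1 (u v * (\1_`[0, x] v)%:C)).
    have K0 : 0 <= K by rewrite mulr_ge0 ?mulr_ge0// RInt_ge0// => v; exact: n1_ge0.
    have K1 : 0 < K + 1 by lra.
    exists ((n1 (prim_at c u x) - n%:R) / (K + 1)); first by rewrite divr_gt0// subr_gt0.
    move=> t; rewrite ltr_pdivlMr// => ht /(_ x) hn.
    have := prim_at_lip t c x gu; rewrite -/K => h1.
    have := n1B (prim_at t u x) (prim_at t u x - prim_at c u x).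
    rewrite subKr => h2; have : `|t - c| * K <= `|t - c| * (K + 1) by rewrite ler_wpM2l// lerDl.
    lra.
  - by move=> t /SE/bE.
  apply: Sc; exists (ball c r); split; [exact: ball_open|exact: ballxx|].
  move=> psi tpsi; have [_ [cpsi sub]] := tpsi.
  apply: (null_of_prim_at_bounded (S := S) (n := n%:R) gu ub (test_fun_tf tpsi) cpsi cS) => //.
  - apply/eqP; rewrite eq_le measure_ge0 andbT -nE.
    apply: le_measure; rewrite ?inE.
    + by apply: closed_measurable; apply: closedI => //; exact: closed_closure.
    + exact: closed_measurable.
    + by move=> t [/SE].
  - by move=> t _ /contrapT.
  - by move=> t St /sub bt; apply: hr => //; rewrite distrC.
move=> phi tphi; have [_ [cphi _]] := tf_test_fun tphi.
apply: (null_of_local gu ub tphi cphi) => t _.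
by apply: contrapT => nt; apply: S0; exists t.
Qed.

Lemma fourier_cvgN phi : tf phi -> ccvg -oo (fourier phi) 0.
Proof.
move=> tphi; have [K K0 hK] := fourier_weight tphi.
apply/ccvg_n1P => e e0; near=> t; rewrite subr0 (le_trans (hK t))// /weight.
have t1 : t < -1 by near: t; apply: nbhs_ninfty_lt; exact: num_real.
have t2 : t < - (K / e) by near: t; apply: nbhs_ninfty_lt; exact: num_real.
rewrite ler_pdivrMr ?ltr_pwDl ?sqr_ge0// -ler_pdivrMl// mulrC.
have : - t <= t ^+ 2 by nra.
lra.
Unshelve. all: by end_near. Qed.

Lemma null_limit_part (r k : R -> R) (X B : R) : 0 <= B -> measurable_fun setT r ->
  (forall x, X <= x -> `|r x| <= B) -> sdec r -> (forall x, 0 <= k x) -> RL1 k -> 0 < RInt k ->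
  (forall l, 0 < l -> (fun h => RInt (fun x => (if X < x then r x else 0) * k (l * (x - h)))) @ +oo --> (0 : R)) ->
  r @ +oo --> (0 : R).
Proof.
move=> B0 mr rB sr k0 k1 kk lim; pose r1 x := if X < x then r x else 0.
have r1lim : r1 @ +oo --> (0 : R).
  apply: (tauberian_limit (B := B) (k := k)) => //.
  - apply: measurable_fun_if => //; first exact: measurable_fun_ltr.
    exact: measurable_funTS.
  - by move=> x; rewrite /r1; case: ltP => [/ltW/rB//|_]; rewrite normr0.
  (* [X + 1] rather than [X], because the truncation keeps only the points with [X < x]. *)
  move=> e e0; have [d d0 [x0 hd]] := sr e e0; exists d => //; exists (Num.max x0 (X + 1)) => x h.
  rewrite ge_max => /andP[h1 h2] /andP[h3 h4]; rewrite /r1 !ifT; try lra.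
  by apply: hd => //; rewrite h3.
apply: cvg_trans r1lim; apply: near_eq_cvg; near=> x; rewrite /r1 ifT//.
by near: x; apply: nbhs_pinfty_gt; exact: num_real.
Unshelve. all: by end_near. Qed.

(** Up to the factor [l], the dilated kernel [k (l * x)] is the transform of the dilated test
    function, so the hypothesis covers every scale. The head of [u], cut off to obtain a bounded
    function, is integrable and contributes nothing in the limit. *)
Lemma null_limit u X B : laplaceable u -> ubound u X B ->
  sdec (fun x => complex.Re (u x)) -> sdec (fun x => complex.Im (u x)) ->
  (forall phi, tf phi -> null u phi) -> ccvg +oo u 0.
Proof.
move=> gu ub s1 s2 hn; have [[m1 m2] u0 _] := gu; have [X0 B0 hB] := ub.
have [phi [k [[tphi phi0 phiE] [k0 k1 k2 kk]]]] := exists_kernel (@ltr01 R).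
have lim l : 0 < l -> ccvg +oo (fun h => CInt (fun x => (if X < x then u x else 0) * (k (l * (x - h)))%:C)) 0.
  move=> l0; have lV : 0 < l^-1 by rewrite invr_gt0.
  have ln : l != 0 by rewrite gt_eqF.
  pose chi x := phi (l^-1 * x).
  have tchi : tf chi.
    split; first by have := @smooth_affine R _ l^-1 0 tphi.1; under eq_fun do rewrite addr0.
    exists l => x lx; apply: phi0; rewrite normrM gtr0_norm//.
    by rewrite -(mulVf ln) ltr_pM2l.
  have FE t : fourier chi t = l%:C * (k (l * t))%:C by rewrite fourier_scale// invrK phiE.
  have h0 := laplaceable_CL1_itv X gu.
  have [K K0 hK] := fourier_bounded tchi.
  have q1 := CInt_shift_cvg0 h0 (CL1_meas (CL1_fourier tchi)) hK (fourier_cvgN tchi).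
  have F0 : Filter (pinfty_nbhs R) by exact: proper_pinfty_nbhs.
  have := ccvgM F0 (ccvg_cst F0 (l^-1)%:C) (ccvgB F0 (hn _ tchi) q1).
  rewrite subr0 mulr0; apply: ccvg_near; near=> h.
  rewrite /conv -CIntB; last 2 first.
  - exact: CL1_conv gu ub tchi.
  - exact: CL1Mb h0 (CL1_meas (CL1_fourier_shift h tchi)) (fun x => hK _).
  rewrite -CIntZl; last first.
    apply: CL1B; [exact: CL1_conv gu ub tchi|].
    exact: CL1Mb h0 (CL1_meas (CL1_fourier_shift h tchi)) (fun x => hK _).
  congr CInt; apply/funext => x; rewrite -mulrBl mulrCA FE.
  rewrite [(l^-1)%:C * (_ * _)]mulrA -rmorphM /= mulVf// mul1r; congr (_ * _).
  have [x0|x0] := ltP x 0.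
    by rewrite u0// mul0r subrr if_same.
  rewrite indicE; have [xX|xX] := ltP X x; first by rewrite memNset/= ?mulr0 ?subr0// in_itv/= x0/= leNgt xX.
  by rewrite mem_set/= ?mulr1 ?subrr// in_itv/= x0.
split.
- apply: (null_limit_part (X := X) B0 m1 _ s1 k0 k1 kk).
    by move=> x /hB; apply: le_trans; exact: n1_Re.
  move=> l /lim[h _]; apply: cvg_trans h; apply: near_eq_cvg; near=> h.
  rewrite ReCInt; congr RInt; apply/funext => x.
  by rewrite ReM ReC ImC mulr0 subr0; case: ifP.
- apply: (null_limit_part (X := X) B0 m2 _ s2 k0 k1 kk).
    by move=> x /hB; apply: le_trans; exact: n1_Im.
  move=> l /lim[_ h]; apply: cvg_trans h; apply: near_eq_cvg; near=> h.
  rewrite ImCInt; congr RInt; apply/funext => x.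
  by rewrite ImM ReC ImC mulr0 add0r; case: ifP.
Unshelve. all: by end_near. Qed.

Lemma tauberian_core u (E : set R) : laplaceable u ->
  sdec (fun x => complex.Re (u x)) -> sdec (fun x => complex.Im (u x)) ->
  closed E -> mu E = 0%E ->
  (forall t, ~ E t -> pf_at (lap u) t) ->
  (forall t, E t -> pm_at (fun s x => lap u s x / (s +i* (x - t))) t) ->
  ccvg +oo u 0.
Proof.
move=> gu s1 s2 cE0 nE hpf hpm.
have [X [B ub]] : exists X B, ubound u X B.
  apply: (lap_bounded gu s1 s2); have [E0|nE0] := pselect (E 0); first by right; exact: hpm.
  by left; apply/pf_at_pm/hpf.
exact: null_limit gu ub s1 s2 (null_everywhere gu ub cE0 nE hpf hpm).
Qed.

End Core.

(** * The converse direction *)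

Section Converse.
Variable R : realType.
Local Notation mu := (@lebesgue_measure R).
Implicit Types (u p : R -> R[i]) (phi chi : R -> R).

Lemma tf_flip phi : tf phi -> tf (fun t => phi (- t)).
Proof.
move=> [sphi [L hL]]; split; last by exists L => x; rewrite -normrN => /hL.
by have := @smooth_affine R _ (-1) 0 sphi; under eq_fun do rewrite mulN1r addr0.
Qed.

Lemma fourier_flip phi x : tf phi -> fourier (fun t => phi (- t)) x = fourier phi (- x).
Proof.
move=> tphi; rewrite !fourierE -(CInt_flip 0 (CL1_fourier_integrand (- x) tphi)).
by congr CInt; apply/funext => t; rewrite sub0r mulrNN.
Qed.

Lemma CInt_point (f : R -> R[i]) : CInt (fun x => f x * (\1_`[0, 0] x)%:C) = 0.
Proof.
have -> : (fun x => f x * (\1_`[0, 0] x)%:C) = (fun x => f 0 * (\1_`[0, 0] x)%:C).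
  apply/funext => x; rewrite indicE; have [|_] := boolP (x \in _); last by rewrite !mulr0.
  by rewrite inE/= in_itv/= => h; rewrite (_ : x = 0)//; apply/le_anti; rewrite andbC.
rewrite CIntZl; last exact/CL1C/RL1_indic.
by rewrite CIntC RInt_indic// subrr mulr0.
Qed.

Lemma cmeas_heaviside : cmeas (@heaviside R).
Proof. by case: (@laplaceable_heaviside R). Qed.

Lemma n1_heaviside (x : R) : n1 (heaviside x) <= 1.
Proof. by rewrite /heaviside; case: ifP; rewrite ?n10// -[1]/((1 : R)%:C) n1C normr1. Qed.

(** The two half lines overlap at 0 only, and a point carries no mass. *)
Lemma CInt_heaviside_split (f : R -> R[i]) : CL1 f ->
  CInt (fun x => heaviside x * f x) + CInt (fun x => heaviside x * f (- x)) = CInt f.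
Proof.
move=> f1.
have h1 : CL1 (fun x => heaviside x * f x).
  by under eq_fun do rewrite mulrC; exact: CL1Mb f1 cmeas_heaviside n1_heaviside.
have h2 : CL1 (fun x => heaviside x * f (- x)).
  have := CL1_flip 0 f1; under eq_fun do rewrite sub0r; move=> f2.
  by under eq_fun do rewrite mulrC; exact: CL1Mb f2 cmeas_heaviside n1_heaviside.
have f3 : CL1 (fun x => f x * (\1_`[0, 0] x)%:C).
  apply: (CL1Mb (M := 1) f1) => [|x]; first by apply: cmeasC; exact: measurable_indic.
  by rewrite n1C indicE; case: (_ \in _); rewrite ?normr1 ?normr0.
rewrite -(CInt_flip 0 h2) -(CIntD h1 (CL1_flip 0 h2)).
transitivity (CInt f + CInt (fun x => f x * (\1_`[0, 0] x)%:C)); last by rewrite CInt_point addr0.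
rewrite -(CIntD f1 f3); congr CInt; apply/funext => x.
rewrite sub0r opprK -mulrDl -[X in _ = X + _]mulr1 -mulrDr mulrC; congr (_ * _).
rewrite /heaviside oppr_ge0 indicE.
have -> : (x \in `[0, 0]%classic) = (0 <= x <= 0) by apply/idP/idP; rewrite ?inE/= in_itv.
by case: (ltgtP x 0) => x0 //=; rewrite ?addr0 ?add0r.
Qed.

Lemma ubound_heaviside : ubound (@heaviside R) 0 1.
Proof. by split => // x _; exact: n1_heaviside. Qed.

Lemma RInt_odd (f : R -> R) : (forall x, f (- x) = - f x) -> RL1 f -> RInt f = 0.
Proof.
move=> of_ f1; have := RInt_flip f1; under eq_fun do rewrite of_ -mulN1r.
rewrite RIntZl// => h; lra.
Qed.

(* The even part of [phi] pairs with the Laplace transform [1 / (s + i t)] of the half line;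
   the real part is the Poisson kernel, which only sees [phi 0] in the limit. *)
Lemma CInt_fourier0 phi : tf phi -> phi 0 = 0 -> CInt (fourier phi) = 0.
Proof.
move=> tphi p0; have tf' := tf_flip tphi.
pose psi t := phi t + phi (- t); have tpsi : tf psi := tfD tphi tf'.
have psi0 : psi 0 = 0 by rewrite /psi oppr0 p0 addr0.
have psiN t : psi (- t) = psi t by rewrite /psi opprK addrC.
have FE x : fourier psi x = fourier phi x + fourier phi (- x).
  by rewrite fourierD// fourier_flip.
have F0 : ProperFilter (0 : R)^'+ by exact: at_right_proper_filter.
have lim := conv_cvg 0 (@laplaceable_heaviside R) ubound_heaviside tpsi.
have cf := CL1_fourier tphi.
have cf' : CL1 (fun x => fourier phi (- x)).
  by have := CL1_flip 0 cf; under eq_fun do rewrite sub0r.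
have cE : conv (@heaviside R) psi 0 = CInt (fourier phi).
  rewrite -(CInt_heaviside_split cf) -CIntD; last 2 first.
  - by under eq_fun do rewrite mulrC; exact: CL1Mb cf cmeas_heaviside n1_heaviside.
  - by under eq_fun do rewrite mulrC; exact: CL1Mb cf' cmeas_heaviside n1_heaviside.
  by congr CInt; apply/funext => x; rewrite subr0 FE mulrDr.
rewrite -cE; apply: (ccvg_unique F0 lim).
have [K K0 hK] := tf_bounded (tf_derive1 tpsi).
have psiK t : `|psi t| <= K * `|t|.
  have := lip_le t 0 (fun x => smooth_is_derive x tpsi.1) hK.
  by rewrite psi0 !subr0.
have [L hL] := tpsi.2.
have den (s t : R) : 0 < s -> 0 < s ^+ 2 + t ^+ 2.
  by move=> s0; rewrite ltr_pwDl ?sqr_ge0// exprn_gt0.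
have msq (s : R) : 0 < s -> measurable_fun setT (fun t : R => (s ^+ 2 + t ^+ 2)^-1).
  move=> s0; have sn : s != 0 by rewrite gt_eqF.
  have sV : s^-1 != 0 by rewrite invr_eq0.
  rewrite (_ : (fun t => _) = fun t => s ^- 2 * weight (s^-1 * t + 0)).
    by apply: measurable_funM => //; exact: RL1_meas (RL1_affine 0 sV (RL1_weight R)).
  apply/funext => t; rewrite /weight -invfM addr0; congr (_^-1); field.
  by rewrite sn.
have b1 (s t : R) : 0 < s -> `|s * (s ^+ 2 + t ^+ 2)^-1 * psi t| <= K * \1_`[- `|L|, `|L|] t.
  move=> s0; rewrite indicE; have [|] := boolP (t \in _).
    move=> _; have q := divr_ge0 (ltW s0) (ltW (den s t s0)).
    rewrite mulr1 normrM (ger0_norm q); apply: (le_trans (ler_wpM2l q (psiK t))).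
    rewrite mulrCA (ler_piMr (ltW K0))// mulrAC ler_pdivrMr ?den// mul1r.
    have h : `|t| ^+ 2 = t ^+ 2 by rewrite -normrX ger0_norm// sqr_ge0.
    by have := sqr_ge0 (s - `|t|); have := sqr_ge0 (s + `|t|); rewrite -h; lra.
  rewrite notin_setE/= in_itv/= -ler_norml => /negP; rewrite -ltNge => Lt.
  by rewrite hL ?mulr0 ?normr0// (le_lt_trans (ler_norm _) Lt).
have re0 : (fun s => RInt (fun t => s * (s ^+ 2 + t ^+ 2)^-1 * psi t)) @ (0 : R)^'+ --> (0 : R).
  rewrite -[X in _ --> X](RInt0 R).
  apply: (RInt_cvg_at_right (f_ := fun s t => s * (s ^+ 2 + t ^+ 2)^-1 * psi t)
    (g := fun t => K * \1_`[- `|L|, `|L|] t)).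
  - move=> s s0; apply: measurable_funM; last exact: tf_measurable.
    by apply: measurable_funM => //; exact: msq.
  - exact/RL1Zl/RL1_indic.
  - by move=> s s0 t; exact: b1.
  move=> t; have [->|t0] := eqVneq t 0.
    by under eq_fun do rewrite psi0 mulr0; exact: cvg_cst.
  have t2 : 0 < t ^+ 2 by rewrite exprn_even_gt0.
  have C0 : 0 < `|psi t| / t ^+ 2 + 1 by rewrite ltr_pwDr// divr_ge0// ltW.
  apply/cvgr0Pnorm_le => e e0; near=> s; have s0 : 0 < s by [].
  have se : s <= e / (`|psi t| / t ^+ 2 + 1).
    by near: s; apply: nbhs_right_le; rewrite divr_gt0.
  rewrite normrM (ger0_norm (divr_ge0 (ltW s0) (ltW (den s t s0)))).
  move: se; rewrite ler_pdivlMr// => se; apply: le_trans se.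
  rewrite -mulrA (ler_wpM2l (ltW s0))// mulrC.
  have : `|psi t| / (s ^+ 2 + t ^+ 2) <= `|psi t| / t ^+ 2.
    by rewrite ler_wpM2l// lef_pV2 ?posrE ?den// lerDr sqr_ge0.
  lra.
have F1 : Filter (0 : R)^'+ by exact: at_right_proper_filter.
have := ccvgC F1 re0; apply: ccvg_near; near=> s; have s0 : 0 < s by [].
transitivity (CInt (fun t => lap (@heaviside R) s t * ((psi t)%:C * cis (0 * t)))); last first.
  by rewrite lap_pairing//; exact: laplaceable_heaviside.
have ilp : CL1 (fun t => lap (@heaviside R) s t * ((psi t)%:C * cis (0 * t))).
  apply: CL1_lap_tf => //; [exact: laplaceable_heaviside|exact: CL1_tf].
have lE t : lap (@heaviside R) s t * ((psi t)%:C * cis (0 * t)) =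
   (s * (s ^+ 2 + t ^+ 2)^-1 * psi t) +i* (- (t * (s ^+ 2 + t ^+ 2)^-1 * psi t)).
  rewrite lap_heaviside// mul0r cis0 mulr1.
  have -> : (s +i* t)^-1 = (s * (s ^+ 2 + t ^+ 2)^-1) +i* (- (t * (s ^+ 2 + t ^+ 2)^-1)).
    by [].
  by apply: complex_ext; rewrite ?cE ?xE; ring.
apply: complex_ext.
- by rewrite ReCInt ReC; congr RInt; apply/funext => t; rewrite lE.
- rewrite ImCInt ImC RInt_odd//; last exact: RL1_Im ilp.
  by move=> t; rewrite !lE !xE psiN sqrrN; ring.
Unshelve. all: by end_near. Qed.

(** Subtracting a multiple of one fixed test function [om] reduces the claim at 0 to functions that
    vanish there; translation gives the other points. The constant is kept abstract, as it cancels
    against [c^-1] in the end. *)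
Lemma fourier_inversion : exists2 c : R, c != 0 & forall phi (t : R), tf phi ->
  CInt (fun y => fourier phi y * cis (t * y)) = (c * phi t)%:C.
Proof.
have [om [k [[tom _ omE] [k0 k1 _ kk]]]] := exists_kernel (@ltr01 R).
have omI : CInt (fourier om) = (RInt k)%:C.
  by rewrite -CIntC; congr CInt; apply/funext => t; exact: omE.
have om0 : om 0 != 0.
  apply/eqP => h; have := CInt_fourier0 tom h; rewrite omI => -[h']; move: kk; rewrite h' ltxx//.
have main phi : tf phi -> CInt (fourier phi) = (RInt k / om 0 * phi 0)%:C.
  move=> tphi; pose a := - (phi 0 / om 0).
  have ta : tf (fun x => a * om x).
    by have := tfM tom (@smooth_cst R a); under eq_fun do rewrite mulrC.
  have h : CInt (fourier (fun x => phi x + a * om x)) = 0.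
    apply: CInt_fourier0; first exact: tfD.
    by rewrite /a mulNr divfK// subrr.
  have aE y : fourier (fun x => a * om x) y = a%:C * fourier om y.
    rewrite !fourierE -CIntZl; last exact: CL1_fourier_integrand.
    by congr CInt; apply/funext => x; rewrite rmorphM /= mulrA.
  have : CInt (fourier phi) + a%:C * (RInt k)%:C = 0.
    rewrite -omI -CIntZl; last exact: CL1_fourier.
    rewrite -CIntD; [|exact: CL1_fourier|exact/CL1Zl/CL1_fourier].
    by rewrite -[RHS]h; congr CInt; apply/funext => y; rewrite fourierD// aE.
  move/eqP; rewrite addr_eq0 => /eqP ->; rewrite -rmorphM -rmorphN /=; congr (_%:C).
  by rewrite /a; field.
exists (RInt k / om 0); first by rewrite mulf_neq0 ?invr_eq0// gt_eqF.
move=> phi t tphi; have := main _ (tf_shift (- t) tphi); rewrite [phi (0 - - t)](_ : _ = phi t); last by rewrite sub0r opprK.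
move=> <-; congr CInt; apply/funext => y; rewrite fourier_shift// mulrN opprK mulrC [y * t]mulrC.
by [].
Qed.

(** The inversion formula is inserted for [phi] and the integrals are exchanged: the transform of a
    product is a convolution of transforms. *)
Lemma fourier_mul (c : R) chi phi x : tf chi -> tf phi ->
  (forall t : R, CInt (fun y => fourier phi y * cis (t * y)) = (c * phi t)%:C) ->
  c%:C * fourier (fun t => chi t * phi t) x = CInt (fun y => fourier phi y * fourier chi (x - y)).
Proof.
move=> tchi tphi inv; have tcp := tfM tchi tphi.1.
rewrite fourierE -CIntZl; last exact: CL1_fourier_integrand.
have mk : cmeas (fun z : R * R => cis (z.1 * z.2)).
  apply: cmeas_cis; apply: measurable_funM; [exact: measurable_fst|exact: measurable_snd].
have := CFubini_kernel (CL1_fourier_integrand x tchi) (CL1_fourier tphi) mk (fun z => n1_cis _).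
under [in X in X = _ -> _]eq_fun do rewrite inv.
have -> : (fun t => c%:C * ((chi t * phi t)%:C * cis (- (x * t)))) =
  (fun t => (chi t)%:C * cis (- (x * t)) * (c * phi t)%:C).
  by apply/funext => t; rewrite !rmorphM /=; ring.
move=> ->; congr CInt; apply/funext => y; congr (_ * _).
rewrite -fourier_mod; congr CInt; apply/funext => t /=.
by rewrite mulrAC [y * t]mulrC.
Qed.

Lemma normc_n1 (z : R[i]) : `|z| <= (n1 z)%:C.
Proof.
rewrite normc_def lecR -[leRHS](ger0_norm (n1_ge0 z)) -sqrtr_sqr ler_wsqrtr//.
rewrite /n1 sqrrD -[complex.Re z ^+ 2]ger0_norm ?sqr_ge0// -[complex.Im z ^+ 2]ger0_norm ?sqr_ge0//.
by rewrite !normrX addrAC lerDl mulrn_wge0// mulr_ge0.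
Qed.

Lemma CL1_mul_fourier (a : R -> R[i]) chi (y : R) : CL1 a -> tf chi ->
  CL1 (fun x => a x * fourier chi (x + y)).
Proof.
move=> a1 tchi; have [K K0 hK] := fourier_bounded tchi.
exact: CL1Mb a1 (CL1_meas (CL1_shift y (CL1_fourier tchi))) (fun x => hK _).
Qed.

Lemma CInt_fourier_flip (a : R -> R[i]) chi (y : R) : CL1 a -> tf chi ->
  CInt (fun x => a x * fourier chi (x + y)) =
  CInt (fun x => a (- x) * fourier (fun t => chi (- t)) (x - y)).
Proof.
move=> a1 tchi; rewrite -(CInt_flip 0 (CL1_mul_fourier y a1 tchi)); congr CInt; apply/funext => x.
by rewrite sub0r fourier_flip// opprB addrC.
Qed.

Definition plateau (t0 x : R) : R := step (x - t0 + 2) * step (2 - (x - t0)).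

Lemma tf_plateau t0 : tf (plateau t0).
Proof.
have s1 := @smooth_affine R _ 1 (2 - t0) (@smooth_step R).
have s2 := @smooth_affine R _ (-1) (2 + t0) (@smooth_step R).
have -> : plateau t0 = fun x => step (1 * x + (2 - t0)) * step (-1 * x + (2 + t0)).
  by apply/funext => x; rewrite /plateau; congr (step _ * step _); ring.
apply: (@tf_itv R _ (t0 - 2) (t0 + 2)); first exact (smoothM s1 s2).
by move=> x [h|h]; [rewrite step_0 ?mul0r//|rewrite [X in _ * X]step_0 ?mulr0//]; lra.
Qed.

Lemma plateau1 t0 x : `|x - t0| <= 1 -> plateau t0 x = 1.
Proof. by rewrite ler_norml => /andP[h1 h2]; rewrite /plateau !step_1 ?mulr1//; lra. Qed.

(* [psi] is [2 pi] times the reflection of the tail of [u] plus the mollification of its integrable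
   head by the Fourier transform of a test function equal to [1] near [t0]. *)
Lemma pairing_local u X B t0 : laplaceable u -> ubound u X B -> ccvg +oo u 0 ->
  exists V psi, [/\ open V, V t0, bounded_cfun psi, ccvg +oo psi 0 /\ ccvg -oo psi 0 &
    forall phi, test_fun V phi -> conv u phi 0 = inv_fourier_pairing psi phi].
Proof.
move=> gu ub ulim; have [mu0 un _] := gu; have [X0 B0 hB] := ub.
have [c c0 inv] := fourier_inversion.
have [chi [tchi chi1]] : exists chi, tf chi /\ forall x, `|x - t0| <= 1 -> chi x = 1.
  by exists (plateau t0); split; [exact: tf_plateau|exact: plateau1].
have [K K0 hK] := fourier_bounded tchi.
pose a x := u x * (\1_`[0, X] x)%:C.
have a1 : CL1 a by exact: laplaceable_CL1_itv.
pose w x := u x - a x.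
have wE x : w x = if X < x then u x else 0.
  rewrite /w /a indicE; have [x0|x0] := ltP x 0; first by rewrite un// mul0r subrr if_same.
  have [xX|xX] := ltP X x; first by rewrite memNset/= ?mulr0 ?subr0// in_itv/= x0/= leNgt xX.
  by rewrite mem_set/= ?mulr1 ?subrr// in_itv/= x0.
have mw : cmeas w by exact: cmeasB mu0 (CL1_meas a1).
have wB x : n1 (w x) <= B by rewrite wE; case: ltP => [/ltW/hB//|_]; rewrite n10.
pose m y := CInt (fun x => a x * fourier chi (x + y)).
have cm : cmeas m.
  apply: (cmeas_kernel (c := fun z => fourier chi (z.2 + z.1)) a1 _ (fun z => hK _)).
  apply: cmeas_comp (CL1_meas (CL1_fourier tchi)) _.
  by apply: measurable_funD; [exact: measurable_snd|exact: measurable_fst].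
have mB y : n1 (m y) <= K * RInt (fun x => n1 (a x)).
  rewrite -RIntZl; last exact: RL1_n1.
  apply: n1_CInt_dom; [exact: CL1_meas (CL1_mul_fourier y a1 tchi)| |exact/RL1Zl/RL1_n1].
  by move=> x; rewrite (le_trans (n1M _ _))// mulrC ler_wpM2r ?n1_ge0.
have mN : ccvg -oo m 0.
  apply: ccvg_compN.
  exact: CInt_shift_cvg0 a1 (CL1_meas (CL1_fourier tchi)) hK (fourier_cvgN tchi).
have mP : ccvg +oo m 0.
  have tchi' := tf_flip tchi.
  have a1' : CL1 (fun x => a (- x)) by have := CL1_flip 0 a1; under eq_fun do rewrite sub0r.
  have [K' K'0 hK'] := fourier_bounded tchi'.
  suff -> : m = fun h => CInt (fun x => a (- x) * fourier (fun t => chi (- t)) (x - h)).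
    exact: CInt_shift_cvg0 a1' (CL1_meas (CL1_fourier tchi')) hK' (fourier_cvgN tchi').
  by apply/funext => h; exact: CInt_fourier_flip.
have F0 : Filter (pinfty_nbhs R) by exact: proper_pinfty_nbhs.
have F1 : Filter (ninfty_nbhs R) by exact: proper_ninfty_nbhs.
(* The reflection and the factor [2 * pi] undo the conventions of [inv_fourier_pairing]. *)
pose psi y := (2 * pi)%:C * (w (- y) + (c^-1)%:C * m y).
exists (ball t0 1), psi; split.
- exact: ball_open.
- exact: ballxx.
- split.
    apply: cmeasM; first exact: cmeas_cst.
    apply: cmeasD; first exact: cmeas_comp mw _.
    by apply: cmeasM => //; exact: cmeas_cst.
  exists (`|2 * pi| * (B + `|c^-1| * (K * RInt (fun x => n1 (a x))))) => y.
  apply: (le_trans (normc_n1 _)); rewrite lecR n1CM ler_wpM2l// (le_trans (n1D _ _))// lerD//.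
  by rewrite n1CM ler_wpM2l.
- have wP : ccvg +oo (fun y => w (- y)) 0.
    apply: ccvg_near (ccvg_cst F0 0); near=> y.
    have y0 : 0 < y by near: y; apply: nbhs_pinfty_gt; exact: num_real.
    by rewrite wE ifF//; apply/negbTE; rewrite -leNgt; lra.
  have wN : ccvg -oo (fun y => w (- y)) 0.
    apply: ccvg_compN; under eq_fun do rewrite opprK.
    apply: ccvg_near ulim; near=> x; rewrite wE ifT//.
    by near: x; apply: nbhs_pinfty_gt; exact: num_real.
  have z0 : (2 * pi)%:C * (0 + (c^-1)%:C * 0) = 0 :> R[i] by rewrite mulr0 addr0 mulr0.
  split; rewrite -z0.
  + exact (ccvgM F0 (ccvg_cst F0 _) (ccvgD F0 wP (ccvgM F0 (ccvg_cst F0 _) mP))).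
  + exact (ccvgM F1 (ccvg_cst F1 _) (ccvgD F1 wN (ccvgM F1 (ccvg_cst F1 _) mN))).
move=> phi tV; have tphi := test_fun_tf tV.
(* [chi] is 1 on the support of [phi]; inserting it is what turns the integrable head into its
   mollification [m]. *)
have phiE : phi = fun t => chi t * phi t.
  apply/funext => t; have [->|pt] := eqVneq (phi t) 0; first by rewrite mulr0.
  have [_ [_ /(_ _ (test_fun_supp tV pt))]] := tV.
  by rewrite /ball/= distrC => /ltW/chi1 ->; rewrite mul1r.
have cf := CL1_fourier tphi; have [Kp Kp0 hKp] := fourier_bounded tphi.
have mk : cmeas (fun z : R * R => fourier chi (z.1 - z.2)).
  apply: cmeas_comp (CL1_meas (CL1_fourier tchi)) _.
  by apply: measurable_funB; [exact: measurable_fst|exact: measurable_snd].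
have aE : CInt (fun x => a x * fourier phi x) = (c^-1)%:C * CInt (fun y => m y * fourier phi (- y)).
  have i1 : CL1 (fun x => a x * fourier phi x) by exact: CL1Mb a1 (CL1_meas cf) hKp.
  have cV : (c^-1)%:C * c%:C = 1 :> R[i] by rewrite -rmorphM /= mulVf.
  rewrite -[LHS]mul1r -cV -mulrA; congr (_ * _); rewrite -CIntZl//.
  have -> : (fun x => c%:C * (a x * fourier phi x)) =
      fun x => a x * CInt (fun y => fourier phi y * fourier chi (x - y)).
    apply/funext => x; rewrite mulrCA; congr (_ * _).
    by rewrite [X in fourier X x]phiE; apply: fourier_mul => // t; exact: inv.
  rewrite (CFubini_kernel a1 cf mk (fun z => hK _)).
  have i2 : CL1 (fun y => fourier phi y * CInt (fun x => a x * fourier chi (x - y))).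
    apply: CL1Mb cf (cmeas_comp cm _) (fun y => mB (- y)).
    exact: measurable_funN.
  rewrite -(CInt_flip 0 i2); congr CInt; apply/funext => y.
  by rewrite sub0r opprK mulrC.
have i1 : CL1 (fun x => a x * fourier phi x) by exact: CL1Mb a1 (CL1_meas cf) hKp.
have i2 : CL1 (fun x => w x * fourier phi x).
  by under eq_fun do rewrite mulrC; exact: CL1Mb cf mw wB.
have i3 : CL1 (fun y => w (- y) * fourier phi (- y)).
  by have := CL1_flip 0 i2; under eq_fun do rewrite sub0r.
have i4 : CL1 (fun y => m y * fourier phi (- y)).
  have := CL1_flip 0 cf; under eq_fun do rewrite sub0r; move=> cf'.
  by under eq_fun do rewrite mulrC; exact: CL1Mb cf' cm mB.
have pn0 : 2 * pi != 0 :> R by rewrite mulf_neq0// gt_eqF// pi_gt0.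
rewrite /inv_fourier_pairing -[cint _ _]/(CInt _).
have -> : (fun y => psi y * fourier phi (- y)) =
  fun y => (2 * pi)%:C * (w (- y) * fourier phi (- y) + (c^-1)%:C * (m y * fourier phi (- y))).
  by apply/funext => y; rewrite /psi; ring.
rewrite CIntZl; last by apply: CL1D i3 _; exact: CL1Zl.
rewrite mulrA -rmorphM /= mulVf// mul1r CIntD//; last exact: CL1Zl.
rewrite CIntZl// -aE.
have -> : CInt (fun y => w (- y) * fourier phi (- y)) = CInt (fun x => w x * fourier phi x).
  by rewrite -(CInt_flip 0 i2); congr CInt; apply/funext => y; rewrite sub0r.
rewrite -CIntD//; congr CInt; apply/funext => x.
by rewrite subr0 -mulrDl /w subrK.
Unshelve. all: by end_near. Qed.

Lemma ubound_of_cvg u : laplaceable u -> ccvg +oo u 0 -> exists X B, ubound u X B.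
Proof.
move=> _ /ccvg_n1P/(_ 1 ltr01) [M [_ hM]].
exists (Num.max 0 (M + 1)), 1; split => //; first by rewrite le_max lexx.
move=> x; rewrite ge_max => /andP[_ h]; rewrite -[u x]subr0; apply: hM; lra.
Qed.

Lemma abelian_core u : laplaceable u -> ccvg +oo u 0 -> exists f : (R -> R) -> R[i],
  (forall phi, tf phi -> ccvg 0^'+ (fun s => CInt (fun t => lap u s t * (phi t)%:C)) (f phi)) /\
  (forall t0 : R, exists V psi, [/\ open V, V t0, bounded_cfun psi, ccvg +oo psi 0 /\ ccvg -oo psi 0 &
    forall phi, test_fun V phi -> f phi = inv_fourier_pairing psi phi]).
Proof.
move=> gu ulim; have [X [B ub]] := ubound_of_cvg gu ulim.
(* The boundary distribution is integration of [u] against the transform of the test function. *)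
exists (conv u ^~ 0); split => [phi tphi|t0]; last exact: pairing_local gu ub ulim.
have F0 : Filter (0 : R)^'+ by exact: at_right_proper_filter.
apply: ccvg_near (conv_cvg 0 gu ub tphi); near=> s; have s0 : 0 < s by [].
rewrite -lap_pairing//; congr CInt; apply/funext => t.
by rewrite mul0r cis0 mulr1.
Unshelve. all: by end_near. Qed.

End Converse.

(** * Reduction to the remainder *)

Section Reduction.
Variable R : realType.
Local Notation mu := (@lebesgue_measure R).
Implicit Types (u tau g : R -> R[i]).

Lemma cexpE (s t x : R) : cexp (- ((s +i* t) * x%:C)) = (expR (- (s * x)))%:C * cis (- (t * x)).
Proof.
rewrite /cexp /cis; apply: complex_ext; rewrite ?cE ?xE ?mulr0 ?mul0r ?subr0 ?add0r ?addr0//.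
Qed.

Lemma slowly_decreasing_sdec (f : R -> R) : slowly_decreasing_real f -> sdec f.
Proof.
move=> sf e e0; have [d d0 /ereal_sup_gt[_ [x0 _ <-] h]] := sf e e0; exists d => //; exists x0.
move=> x y x0x yd; have /ereal_infP/(_ _ (ex_intro2 _ _ x x0x erefl)) := ltW h.
move=> /ereal_infP/(_ _ (ex_intro2 _ _ y _ erefl)); rewrite lee_fin; apply.
by rewrite /= in_itv.
Qed.

(** Meant for subtracting a function with Lipschitz constant [M], such as the primitive of a bounded
    one: a smaller [d] keeps [M * h] below [e / 2]. *)
Lemma sdec_sub_lip (f f' : R -> R) (M : R) : 0 <= M -> sdec f ->
  (forall x h : R, 0 <= x -> 0 <= h -> f (x + h) - f x - M * h <= f' (x + h) - f' x) -> sdec f'.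
Proof.
move=> M0 sf hf e e0; have e2 : 0 < e / 2 by rewrite divr_gt0.
have [d d0 [x0 hd]] := sf _ e2.
have M1 : 0 < M + 1 by lra.
exists (Num.min d (e / 2 / (M + 1))); first by rewrite lt_min d0 divr_gt0.
exists (Num.max 0 x0) => x h; rewrite ge_max le_min => /andP[x1 x2] /and3P[h0 h1 h2].
have := hf x h x1 h0; have := hd x h x2; rewrite h0 h1 => /(_ isT).
have : M * h <= e / 2.
  apply: (@le_trans _ _ ((M + 1) * h)); first by rewrite ler_wpM2r// lerDl.
  by rewrite mulrC -ler_pdivlMr.
lra.
Qed.

Lemma measurable_itvs (f : R -> R) : (forall n : nat, measurable_fun `[- (n%:R : R), n%:R] f) ->
  measurable_fun setT f.
Proof.
move=> h; have -> : [set: R] = \bigcup_n `[- (n%:R : R), n%:R]%classic.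
  apply/seteqP; split => // x _; have [n hn] := ceil_nat `|x|; exists n => //=.
  by rewrite in_itv/= -ler_norml.
by apply/measurable_fun_bigcup => // n; exact: measurable_itv.
Qed.

Lemma L1loc_cmeas tau : L1loc tau -> cmeas tau.
Proof.
by move=> h; split; apply: measurable_itvs => n; have [/measurable_int/measurable_EFinP h1 /measurable_int/measurable_EFinP h2] := h (- (n%:R : R)) n%:R.
Qed.

(** Makes the function vanish at every negative point, as [laplaceable] demands, instead of almost
    everywhere. *)
Definition half_line tau (x : R) : R[i] := heaviside x * tau x.

Lemma cmeas_half_line tau : cmeas tau -> cmeas (half_line tau).
Proof. by move=> h; exact: cmeasM (@cmeas_heaviside R) h. Qed.

Lemma half_line_itv tau (T x : R) :
  half_line tau x * (\1_`[0, T] x)%:C = tau x * (\1_`[0, T] x)%:C.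
Proof.
rewrite /half_line indicE; have [|_] := boolP (x \in _); last by rewrite !mulr0.
by rewrite inE/= in_itv/= /heaviside => /andP[-> _]; rewrite mul1r.
Qed.

Lemma L1loc_itv tau (T : R) : L1loc tau -> CL1 (fun x => half_line tau x * (\1_`[0, T] x)%:C).
Proof.
move=> lt; have [h1 h2] := lt 0 T; split.
- move/(RL1_restrict _ (measurable_itv _)): h1; congr RL1; apply/funext => x.
  by rewrite half_line_itv patchE indicE !cE mulr0 subr0; case: ifP; rewrite ?mulr1 ?mulr0.
- move/(RL1_restrict _ (measurable_itv _)): h2; congr RL1; apply/funext => x.
  by rewrite half_line_itv patchE indicE !cE mulr0 add0r; case: ifP; rewrite ?mulr1 ?mulr0.
Qed.

Lemma indic_in (T x : R) : 0 <= x -> x <= T -> \1_`[0, T] x = 1 :> R.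
Proof. by move=> x0 xT; rewrite indicE mem_set//= in_itv/= x0. Qed.

Lemma indic_out (T x : R) : T < x -> \1_`[0, T] x = 0 :> R.
Proof. by move=> xT; rewrite indicE memNset//= in_itv/= => /andP[_]; rewrite leNgt xT. Qed.

(** Beyond [X] the function [f + q] is nonnegative with bounded truncated integrals, so Fatou's
    lemma makes it integrable. The head on [[0, X]] is integrable by assumption and is treated
    apart, as no minorant is available there. *)
Lemma RL1_of_trunc (f q : R -> R) (X l : R) : 0 <= X -> RL1 q ->
  (forall T, RL1 (fun x => f x * \1_`[0, T] x)) -> (forall x, x < 0 -> f x = 0) ->
  (forall x, X < x -> - q x <= f x) ->
  (fun T => RInt (fun x => f x * \1_`[0, T] x)) @ +oo --> l -> RL1 f.
Proof.
move=> X0 iq iT f0 fq lim.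
pose late x : R := if X < x then 1 else 0.
have mlate : measurable_fun setT late.
  by apply: measurable_fun_if => //; exact: measurable_fun_ltr.
have late1 x : `|late x| <= 1 by rewrite /late; case: ifP; rewrite ?normr1 ?normr0.
pose h x := (f x + q x) * late x.
have h0 x : 0 <= h x.
  rewrite /h /late; case: ltP => [/fq|_]; last by rewrite mulr0.
  by rewrite mulr1 -subr_ge0 opprK.
have iTl (T : R) : RL1 (fun x => h x * \1_`[0, T] x).
  have := RL1D (iT T) (RL1M (M := 1) iq (measurable_indic (measurable_itv `[0, T])) _).
  move=> /(_ (fun x => _)) H.
  have {}H : RL1 (fun x => f x * \1_`[0, T] x + \1_`[0, T] x * q x).
    by apply: H => x; rewrite indicE; case: (_ \in _); rewrite ?normr1 ?normr0.
  have := RL1M H mlate late1.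
  rewrite (_ : (fun x => _) = (fun x => h x * \1_`[0, T] x))//; apply/funext => x.
  by rewrite /h; ring.
have h_early x : x <= X -> h x = 0 by move=> xX; rewrite /h /late ltNge xX mulr0.
have h_late x : X < x -> h x = f x + q x by move=> xX; rewrite /h /late xX mulr1.
have [T0 [_ hT0]] : \forall T \near +oo, `|RInt (fun x => f x * \1_`[0, T] x)| <= `|l| + 1.
  move/cvgrPdist_le: lim => /(_ 1 ltr01); apply: filterS => T hT.
  by have := ler_normB l (l - RInt (fun x => f x * \1_`[0, T] x)); rewrite subKr; lra.
(* The truncation points exceed both [X] and [T0], from which the truncated integrals are
   bounded. *)
pose T_ (n : nat) := n%:R + (`|T0| + 1 + X).
have T_T0 n : T0 < T_ n by have := ler_norm T0; have := ler0n R n; rewrite /T_; lra.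
have T_X n : X <= T_ n by have := normr_ge0 T0; have := ler0n R n; rewrite /T_; lra.
have ih : RL1 h.
  apply: (RInt_fatou (f_ := fun n x => h x * \1_`[0, T_ n] x)
    (B := `|l| + 1 + `|RInt (fun x => f x * \1_`[0, X] x)| + RInt (fun x => `|q x|))) => //.
  - by move=> n x; rewrite mulr_ge0.
  - move=> x; apply: cvg_near_cst; have [xX|xX] := leP x X.
      by apply: nearW => n; rewrite h_early// mul0r.
    have [m hm] := ceil_nat `|x|; exists m => // n /= mn.
    have mn' : m%:R <= n%:R :> R by rewrite ler_nat.
    rewrite indic_in ?mulr1//; first lra.
    by rewrite (le_trans (ler_norm x))// (le_trans hm)// /T_; have := normr_ge0 T0; lra.
  - move=> n; have iq' : RL1 (fun x => `|q x|) by exact: RL1_norm.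
    have E1 := RIntB (iT (T_ n)) (iT X).
    have i1 := RL1B (iT (T_ n)) (iT X).
    apply: (@le_trans _ _ (RInt (fun x => (f x * \1_`[0, T_ n] x - f x * \1_`[0, X] x) + `|q x|))).
      apply: RInt_le => //; first exact: RL1D.
      move=> x; have [x0|x0] := ltP x 0.
        by rewrite h_early ?(ltW (lt_le_trans x0 X0))// f0// !mul0r subr0 add0r.
      have [xX|xX] := leP x X.
        by rewrite h_early// !indic_in// ?(le_trans xX)// mul0r subrr add0r.
      rewrite h_late// (indic_out xX) mulr0 subr0 mulrDl lerD2l.
      by rewrite indicE; case: (_ \in _); rewrite ?mulr0 ?mulr1 ?ler_norm.
    rewrite RIntD// E1; have := hT0 _ (T_T0 n).
    have := ler_norm (RInt (fun x => f x * \1_`[0, T_ n] x)).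
    have := ler_norm (- RInt (fun x => f x * \1_`[0, X] x)); rewrite normrN; lra.
have := RL1D (RL1B ih (RL1M iq mlate late1)) (iT X).
rewrite (_ : (fun x => _) = f)//; apply/funext => x; rewrite /late.
have [x0|x0] := ltP x 0.
  by rewrite h_early ?(ltW (lt_le_trans x0 X0))// f0// ltNge (ltW (lt_le_trans x0 X0)) !mul0r subr0 addr0.
have [xX|xX] := leP x X; first by rewrite h_early// indic_in// mul0r mulr1 subr0 add0r.
by rewrite h_late// (indic_out xX) mulr0 mul1r addr0 addrK.
Qed.

Lemma RL1_line_exp (s : R) : 0 < s ->
  RL1 (fun x => if 0 <= x then (1 + x) * expR (- (s * x)) else 0).
Proof.
move=> s0; have s2 : 0 < s / 2 by rewrite divr_gt0.
have s2V : 0 < (s / 2)^-1 by rewrite invr_gt0.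
apply: (RL1_dom _ _ (RL1Zl (1 + (s / 2)^-1) (RL1_exp s2))).
  apply: measurable_fun_if => //; first exact: measurable_fun_ler.
  apply: measurable_funTS; apply: measurable_funM; last exact: measurable_expRN.
  exact: measurable_funD.
move=> x; case: ifP => x0; last by rewrite normr0 mulr0.
rewrite ger0_norm; last by rewrite mulr_ge0 ?expR_ge0// addr_ge0.
have -> : expR (- (s * x)) = expR (- (s / 2 * x)) * expR (- (s / 2 * x)).
  by rewrite -expRD; congr expR; field.
rewrite mulrA ler_wpM2r ?expR_ge0//.
have y0 : 0 <= s / 2 * x by rewrite mulr_ge0// ltW.
have e1 : expR (- (s / 2 * x)) <= 1 by rewrite -[leRHS]expR0 ler_expR oppr_le0.
have e2 : x * expR (- (s / 2 * x)) <= (s / 2)^-1.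
  rewrite expRN ler_pdivrMr ?expR_gt0// -ler_pdivrMl ?invr_gt0// invrK.
  by have := expR_ge1Dx (s / 2 * x); lra.
by rewrite mulrDl mul1r lerD.
Qed.

(** Slow decrease yields the minorant [- C * (1 + x)] beyond [X], integrable once damped; this is
    why the improper transform converges absolutely. *)
Lemma laplaceable_of_trunc_part (r : R -> R) (s l : R) : 0 < s -> sdec r -> (forall x, x < 0 -> r x = 0) ->
  (forall T, RL1 (fun x => r x * \1_`[0, T] x)) ->
  (fun T => RInt (fun x => r x * expR (- (s * x)) * \1_`[0, T] x)) @ +oo --> l ->
  RL1 (fun x => r x * expR (- (s * x))).
Proof.
move=> s0 /sdec_onesided[M [X [M0 X0 os]]] r0 iT lim.
pose C := `|r X| + M.
apply: (RL1_of_trunc X0 (RL1Zl C (RL1_line_exp s0)) _ _ _ lim).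
- move=> T; have := @RL1M R _ (fun x => expR (- (s * x)) * \1_`[0, T] x) 1 (iT T) _ _.
  have -> : (fun x => expR (- (s * x)) * \1_`[0, T] x * (r x * \1_`[0, T] x)) =
     (fun x => r x * expR (- (s * x)) * \1_`[0, T] x).
    by apply/funext => x; rewrite indicE; case: (_ \in _); rewrite /= ?mulr1 ?mulr0// mulrC.
  apply; first by apply: measurable_funM; [exact: measurable_expRN|exact: measurable_indic].
  move=> x; rewrite indicE; have [|_] := boolP (x \in _); last by rewrite mulr0 normr0.
  rewrite inE/= in_itv/= => /andP[x0 _]; rewrite mulr1 ger0_norm ?expR_ge0// -expR0 ler_expR oppr_le0.
  by rewrite mulr_ge0// ltW.
- by move=> x /r0 ->; rewrite mul0r.
move=> x Xx; have x0 : 0 <= x by lra.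
rewrite x0 -mulNr mulrA ler_wpM2r ?expR_ge0//.
have := os X x (lexx _) (ltW Xx); have := ler_norm (- r X); rewrite normrN /C => h1 h2.
have h3 : M * (1 + (x - X)) <= M * (1 + x) by rewrite ler_wpM2l//; lra.
have h4 : 0 <= `|r X| * x by rewrite mulr_ge0.
rewrite mulNr mulrDl; lra.
Qed.

Lemma sdec_half_line (f : R -> R) : sdec f -> sdec (fun x => if 0 <= x then f x else 0).
Proof.
move=> h; apply: (sdec_sub_lip (lexx 0) h) => x y x0 y0.
by rewrite x0 addr_ge0// mul0r subr0.
Qed.

Lemma Re_half_line tau x : complex.Re (half_line tau x) = if 0 <= x then complex.Re (tau x) else 0.
Proof. by rewrite /half_line /heaviside; case: ifP => _; rewrite ?mul1r ?mul0r. Qed.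

Lemma Im_half_line tau x : complex.Im (half_line tau x) = if 0 <= x then complex.Im (tau x) else 0.
Proof. by rewrite /half_line /heaviside; case: ifP => _; rewrite ?mul1r ?mul0r. Qed.

Lemma laplace_truncE tau (s t T : R) : laplace_trunc tau (s +i* t) T =
  CInt (fun x => half_line tau x * (expR (- (s * x)))%:C * cis (- (t * x)) * (\1_`[0, T] x)%:C).
Proof.
rewrite /laplace_trunc cint_itv; congr CInt; apply/funext => x.
transitivity (half_line tau x * (\1_`[0, T] x)%:C * ((expR (- (s * x)))%:C * cis (- (t * x)))).
  by rewrite half_line_itv cexpE mulrAC.
by rewrite mulrAC mulrA.
Qed.

Lemma laplaceable_half_line tau : L1loc tau -> slowly_decreasing tau ->
  (forall s : R[i], 0 < complex.Re s -> laplace_converges tau s) -> laplaceable (half_line tau).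
Proof.
move=> lt [/slowly_decreasing_sdec/sdec_half_line s1 /slowly_decreasing_sdec/sdec_half_line s2] conv.
have iT T := L1loc_itv T lt.
split; first exact/cmeas_half_line/L1loc_cmeas.
  by move=> x x0; rewrite /half_line /heaviside leNgt x0 mul0r.
(* At a real point the phase is 1, so the real and imaginary parts separate. *)
move=> s s0; have [l [l1 l2]] := conv (s +i* 0) s0.
have c0 x : - (0 * x) = 0 :> R by rewrite mul0r oppr0.
split.
- under eq_fun do rewrite ReM ReC ImC mulr0 subr0 Re_half_line.
  apply: (laplaceable_of_trunc_part s0 s1 _ _ (l := complex.Re l)).
  + by move=> x x0; rewrite leNgt x0.
  + move=> T; have := RL1_Re (iT T).
    by under eq_fun do rewrite ReM ReC ImC mulr0 subr0 Re_half_line.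
  + apply: cvg_trans l1; apply: near_eq_cvg; near=> T.
    rewrite laplace_truncE ReCInt; congr RInt; apply/funext => x.
    by rewrite c0 cis0 mulr1 ReM ReM !ReC !ImC !mulr0 !subr0 Re_half_line.
- under eq_fun do rewrite ImM ReC ImC mulr0 add0r Im_half_line.
  apply: (laplaceable_of_trunc_part s0 s2 _ _ (l := complex.Im l)).
  + by move=> x x0; rewrite leNgt x0.
  + move=> T; have := RL1_Im (iT T).
    by under eq_fun do rewrite ImM ReC ImC mulr0 add0r Im_half_line.
  + apply: cvg_trans l2; apply: near_eq_cvg; near=> T.
    rewrite laplace_truncE ImCInt; congr RInt; apply/funext => x.
    by rewrite c0 cis0 mulr1 ImM ImM !ReC !ImC !mulr0 !add0r Im_half_line.
Unshelve. all: by end_near. Qed.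

Lemma laplace_lap tau (s t : R) : 0 < s -> laplaceable (half_line tau) ->
  laplace tau (s +i* t) = lap (half_line tau) s t.
Proof.
move=> s0 gt; have il := CL1_lap t gt s0.
have [h1 h2] : ccvg +oo (laplace_trunc tau (s +i* t)) (lap (half_line tau) s t).
  rewrite (funext (laplace_truncE tau s t)).
  apply: (CInt_cvg_pinfty (g := fun x => n1 (half_line tau x * (expR (- (s * x)))%:C * cis (- (t * x))))).
  - move=> T; apply: cmeasM (CL1_meas il) _.
    by apply: cmeasC; exact: measurable_indic.
  - exact: RL1_n1.
  - move=> T x; rewrite n1MC indicE ler_piMr ?n1_ge0//.
    by case: (_ \in _); rewrite ?normr1 ?normr0.
  move=> x; have F0 : Filter (pinfty_nbhs R) by exact: proper_pinfty_nbhs.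
  apply: ccvg_near (ccvg_cst F0 _); near=> T.
  have [x0|x0] := ltP x 0; first by case: gt => _ -> //; rewrite !mul0r.
  by rewrite indic_in ?mulr1//.
by apply: complex_ext; rewrite /laplace !xE; apply: cvg_lim.
Unshelve. all: by end_near. Qed.

Lemma laplaceableB u v : laplaceable u -> laplaceable v -> laplaceable (fun x => u x - v x).
Proof.
move=> [m1 u0 i1] [m2 v0 i2]; split; first exact: cmeasB.
- by move=> x x0; rewrite u0// v0// subrr.
- by move=> s s0; under eq_fun do rewrite mulrBl; exact: CL1B (i1 _ s0) (i2 _ s0).
Qed.

Lemma laplaceableZ (b : R[i]) u : laplaceable u -> laplaceable (fun x => b * u x).
Proof.
move=> [m1 u0 i1]; split; first exact: cmeasM (cmeas_cst _ _) m1.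
- by move=> x x0; rewrite u0// mulr0.
- by move=> s s0; under eq_fun do rewrite -mulrA; exact: CL1Zl (i1 _ s0).
Qed.

Lemma lapB u v (s t : R) : laplaceable u -> laplaceable v -> 0 < s ->
  lap (fun x => u x - v x) s t = lap u s t - lap v s t.
Proof.
move=> gu gv s0; rewrite /lap -CIntB; [|exact: CL1_lap..].
by congr CInt; apply/funext => x; rewrite !mulrBl.
Qed.

Lemma lapZ (b : R[i]) u (s t : R) : laplaceable u -> 0 < s -> lap (fun x => b * u x) s t = b * lap u s t.
Proof.
move=> gu s0; rewrite /lap -CIntZl; last exact: CL1_lap.
by congr CInt; apply/funext => x; rewrite !mulrA.
Qed.

Lemma laplaceable_bounded g (K : R) : cmeas g -> (forall x, n1 (g x) <= K) -> laplaceable (half_line g).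
Proof.
move=> mg gK; split; first exact: cmeas_half_line.
  by move=> x x0; rewrite /half_line /heaviside leNgt x0 mul0r.
move=> s s0; have [_ _ h] := @laplaceable_heaviside R.
by under eq_fun do rewrite /half_line mulrAC; exact: CL1Mb (h s s0) mg gK.
Qed.

Lemma ae_imp (P Q : R -> Prop) : (forall x, P x -> Q x) ->
  {ae mu, forall x, P x} -> {ae mu, forall x, Q x}.
Proof. by move=> PQ; apply: (@filterS _ _ (ae_filter_ringOfSetsType mu)). Qed.

Lemma CInt_ae (f f' : R -> R[i]) : cmeas f -> cmeas f' -> {ae mu, forall x, f x = f' x} ->
  CInt f = CInt f'.
Proof.
move=> [m1 m2] [m3 m4] ff; apply: complex_ext; rewrite ?ReCInt ?ImCInt /RInt /Rintegral; congr fine;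
  apply: ae_eq_integral => //; try exact/measurable_EFinP.
- by apply: ae_imp ff => x -> _.
- by apply: ae_imp ff => x -> _.
Qed.

(** The later estimates are pointwise, so they call for a representative bounded at every point;
    [|M|] secures a nonnegative constant. *)
Lemma Linfty_bounded g : Linfty g -> exists g' (K : R),
  [/\ cmeas g', 0 <= K, forall x, n1 (g' x) <= K & {ae mu, forall x, g x = g' x}].
Proof.
move=> [mg [M gM]]; pose K := 2 * `|M|; have K0 : 0 <= K by rewrite mulr_ge0.
have mn := measurable_n1 mg; case: (mg) => m1 m2.
have mb : measurable_fun setT (fun x => n1 (g x) <= K) by exact: measurable_fun_ler.
exists (fun x => if n1 (g x) <= K then g x else 0), K; split => //.
- split.
  + rewrite (_ : (fun _ => _) = fun x => if n1 (g x) <= K then complex.Re (g x) else 0).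
      by apply: measurable_fun_if => //; exact: measurable_funTS.
    by apply/funext => x; case: ifP.
  + rewrite (_ : (fun _ => _) = fun x => if n1 (g x) <= K then complex.Im (g x) else 0).
      by apply: measurable_fun_if => //; exact: measurable_funTS.
    by apply/funext => x; case: ifP.
- by move=> x; case: ifP => //; rewrite n10.
- apply: ae_imp gM => x /n1_normc h; rewrite ifT//; apply: (le_trans h).
  by rewrite /K ler_wpM2l// ler_norm.
Qed.

Lemma laplace_absE g (s t : R) : laplace_abs g (s +i* t) = lap (half_line g) s t.
Proof.
have -> : laplace_abs g (s +i* t) = CInt (fun x => heaviside x * (g x * cexp (- ((s +i* t) * x%:C)))).
  apply: complex_ext.
  - rewrite ReCInt /laplace_abs /cint xE RInt_restrict; congr RInt; apply/funext => x.
    rewrite patchE /heaviside (_ : (x \in _) = (0 <= x)); last by apply/idP/idP; rewrite ?inE.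
    by case: ifP => _; rewrite ?mul1r ?mul0r.
  - rewrite ImCInt /laplace_abs /cint xE RInt_restrict; congr RInt; apply/funext => x.
    rewrite patchE /heaviside (_ : (x \in _) = (0 <= x)); last by apply/idP/idP; rewrite ?inE.
    by case: ifP => _; rewrite ?mul1r ?mul0r.
by congr CInt; apply/funext => x; rewrite cexpE !mulrA.
Qed.

Lemma cint_prim g x : cint `[0, x] g = prim (half_line g) x.
Proof. by rewrite primE cint_itv; congr CInt; apply/funext => v; rewrite half_line_itv. Qed.

Lemma half_line_ae g g' : {ae mu, forall x, g x = g' x} -> {ae mu, forall x, half_line g x = half_line g' x}.
Proof. by apply: ae_imp => x; rewrite /half_line => ->. Qed.

Lemma cint_itv_ae g g' x : cmeas g -> cmeas g' -> {ae mu, forall x, g x = g' x} ->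
  cint `[0, x] g = prim (half_line g') x.
Proof.
move=> m1 m2 gg; rewrite -cint_prim !cint_itv; apply: CInt_ae.
- by apply: cmeasM m1 _; apply: cmeasC; exact: measurable_indic.
- by apply: cmeasM m2 _; apply: cmeasC; exact: measurable_indic.
- by apply: ae_imp gg => v ->.
Qed.

Lemma laplace_abs_ae g g' (s t : R) : cmeas g -> cmeas g' -> {ae mu, forall x, g x = g' x} ->
  laplace_abs g (s +i* t) = lap (half_line g') s t.
Proof.
move=> m1 m2 gg; rewrite laplace_absE.
have me : cmeas (fun x : R => (expR (- (s * x)))%:C) by apply: cmeasC; exact: measurable_expRN.
have mc : cmeas (fun x : R => cis (- (t * x))) by apply: cmeas_cis; exact: measurable_mulN.
apply: CInt_ae.
- exact: cmeasM (cmeasM (cmeas_half_line m1) me) mc.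
- exact: cmeasM (cmeasM (cmeas_half_line m2) me) mc.
- by apply: ae_imp (half_line_ae gg) => v ->.
Qed.

(** The function rho of the overview; [b] is carried by [heaviside], whose transform supplies the
    term [b / s]. *)
Definition remainder tau (b : R[i]) g (x : R) : R[i] :=
  half_line tau x - b * heaviside x - prim (half_line g) x.

Lemma laplaceable_remainder tau b g : laplaceable (half_line tau) -> laplaceable (half_line g) ->
  laplaceable (remainder tau b g).
Proof.
by move=> g1 g2; exact: laplaceableB (laplaceableB g1 (laplaceableZ b (@laplaceable_heaviside R))) (laplaceable_prim g2).
Qed.

Lemma lap_remainder tau b g (s t : R) : laplaceable (half_line tau) -> laplaceable (half_line g) -> 0 < s ->
  lap (remainder tau b g) s t =
  lap (half_line tau) s t - b / (s +i* t) - lap (half_line g) s t / (s +i* t).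
Proof.
move=> g1 g2 s0; have g3 := laplaceableZ b (@laplaceable_heaviside R).
by rewrite (lapB _ (laplaceableB g1 g3) (laplaceable_prim g2) s0) (lapB _ g1 g3 s0)
  (lapZ _ _ (@laplaceable_heaviside R) s0) lap_heaviside// lap_prim.
Qed.

Lemma n1_half_line g (K x : R) : (forall x, n1 (g x) <= K) -> 0 <= K -> n1 (half_line g x) <= K.
Proof. by move=> gK K0; rewrite /half_line /heaviside; case: ifP; rewrite ?mul1r// mul0r n10. Qed.

Lemma sdec_remainder_Re tau b g (K : R) : slowly_decreasing tau -> laplaceable (half_line g) ->
  0 <= K -> (forall x, n1 (g x) <= K) -> sdec (fun x => complex.Re (remainder tau b g x)).
Proof.
move=> [/slowly_decreasing_sdec s1 _] gg K0 gK; apply: (sdec_sub_lip K0 s1) => x h x0 h0.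
have xh : 0 <= x + h by rewrite addr_ge0.
have := n1_primB gg (lexx 0) x0 (_ : x <= x + h) (fun v _ => n1_half_line v gK K0).
rewrite lerDl h0 addrAC subrr add0r => /(_ isT) hp.
have := le_trans (n1_Re _) hp; rewrite ReB /remainder !ReB !Re_half_line x0 xh /heaviside x0 xh.
by have := ler_norm (complex.Re (prim (half_line g) (x + h)) - complex.Re (prim (half_line g) x)); lra.
Qed.

Lemma sdec_remainder_Im tau b g (K : R) : slowly_decreasing tau -> laplaceable (half_line g) ->
  0 <= K -> (forall x, n1 (g x) <= K) -> sdec (fun x => complex.Im (remainder tau b g x)).
Proof.
move=> [_ /slowly_decreasing_sdec s1] gg K0 gK; apply: (sdec_sub_lip K0 s1) => x h x0 h0.
have xh : 0 <= x + h by rewrite addr_ge0.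
have := n1_primB gg (lexx 0) x0 (_ : x <= x + h) (fun v _ => n1_half_line v gK K0).
rewrite lerDl h0 addrAC subrr add0r => /(_ isT) hp.
have := le_trans (n1_Im _) hp; rewrite ImB /remainder !ImB !Im_half_line x0 xh /heaviside x0 xh.
by have := ler_norm (complex.Im (prim (half_line g) (x + h)) - complex.Im (prim (half_line g) x)); lra.
Qed.

Lemma boundary_pf_at (F : R[i] -> R[i]) G U t :
  (forall s t : R, 0 < s -> F (s +i* t) = G s t) -> U t -> local_pseudofunction_bb F U -> pf_at G t.
Proof.
move=> FG Ut [f [lim /(_ t Ut)[V [[oV Vt VU] [psi [bpsi [p1 [p2 fE]]]]]]]].
exists V, psi; split => // phi tV; rewrite -fE//.
apply: ccvg_near (lim _ (test_funS VU tV)); near=> s; have s0 : 0 < s by [].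
by congr CInt; apply/funext => x; rewrite FG.
Unshelve. all: by end_near. Qed.

Lemma boundary_pm_at (F : R[i] -> R[i]) G t :
  (forall s t : R, 0 < s -> F (s +i* t) = G s t) -> pseudomeasure_bb_at F t -> pm_at G t.
Proof.
move=> FG [a [b [tab [f [lim]]]]].
have tab' : `]a, b[%classic t by rewrite /= in_itv.
move=> /(_ t tab')[V [[oV Vt VU] [psi [bpsi fE]]]].
exists V, psi; split => // phi tV; rewrite -fE//.
apply: ccvg_near (lim _ (test_funS VU tV)); near=> s; have s0 : 0 < s by [].
by congr CInt; apply/funext => x; rewrite FG.
Unshelve. all: by end_near. Qed.

End Reduction.

Theorem theorem5p1 (R : realType) (tau g : R -> R[i]) (b : R[i]) :
  L1loc tau ->
  {ae @lebesgue_measure R, forall x, x < 0 -> tau x = 0} ->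
  slowly_decreasing tau ->
  (forall s : R[i], 0 < complex.Re s -> laplace_converges tau s) ->
  Linfty g ->
  let F := fun s : R[i] =>
    laplace tau s - b / s - laplace_abs g s / s in
  (forall E : set R,
     closed E -> lebesgue_measure E = 0%E ->
     local_pseudofunction_bb F (~` E) ->
     (forall t, E t -> pseudomeasure_bb_at
        (fun s => F s / (s - ('i * t%:C))) t) ->
     ccvg +oo (fun x => tau x - b - cint `[0, x] g) 0)
  /\
  (ccvg +oo (fun x => tau x - b - cint `[0, x] g) 0 ->
     local_pseudofunction_bb F [set: R]).
Proof.
move=> lt _ sd conv Lg F.
have [g' [K [mg' K0 gK gg]]] := Linfty_bounded Lg; have [mg _] := Lg.
have gt := laplaceable_half_line lt sd conv; have gg' := laplaceable_bounded mg' gK.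
have gr := laplaceable_remainder b gt gg'.
(* From here on [F] is the transform of a single function, formed with the bounded representative
   [g']. *)
have FE (s t : R) : 0 < s -> F (s +i* t) = lap (remainder tau b g') s t.
  by move=> s0; rewrite lap_remainder// /F laplace_lap// (laplace_abs_ae _ _ mg mg' gg).
have rE x : 0 <= x -> remainder tau b g' x = tau x - b - cint `[0, x] g.
  by move=> x0; rewrite (cint_itv_ae _ mg mg' gg) /remainder /half_line /heaviside x0 mul1r mulr1.
have F0 : Filter (pinfty_nbhs R) by exact: proper_pinfty_nbhs.
split=> [E cE nE hpf hpm|lim].
- have : ccvg +oo (remainder tau b g') 0.
    apply: (tauberian_core gr (sdec_remainder_Re b sd gg' K0 gK) (sdec_remainder_Im b sd gg' K0 gK) cE nE).
    + by move=> t Et; exact: boundary_pf_at FE Et hpf.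
    + move=> t Et; apply: boundary_pm_at (hpm t Et) => s x s0; rewrite FE//; congr (_ / _).
      by apply: complex_ext; rewrite ?cE ?xE; ring.
  apply: ccvg_near; near=> x; rewrite rE//.
have rlim : ccvg +oo (remainder tau b g') 0.
  apply: ccvg_near lim; near=> x; rewrite rE//.
have [f [flim floc]] := abelian_core gr rlim.
exists f; split=> [phi /test_fun_tf tphi|t0 _].
  apply: ccvg_near (flim phi tphi); near=> s; have s0 : 0 < s by [].
  by congr CInt; apply/funext => t; rewrite FE.
have [V [psi [oV Vt bpsi [p1 p2] fE]]] := floc t0.
by exists V; split => //; exists psi.
Unshelve. all: by end_near. Qed.
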